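(* Fix a duct length $l>0$. For a given constant subsonic state $U_b(0)$ on the entrance and a positive $C^\infty(\mathbb R^+)$ function $m_b(x)$, there is a set $\mathcal S\subset\mathbb R$ with at most countably many points such that for every $\lambda\in\mathbb R\setminus\mathcal S$ (with $l<l_*(\lambda)$) the background solution $U_b$ determined by $U_b(0)$, $m_b$ and $\lambda$ satisfies the S-condition.
   Context: Gas and background solution. Constants $\gamma>1$, $\kappa_0,c_\nu>0$; $p=A(s)\rho^\gamma$, $A(s)=\kappa_0e^{s/c_\nu}$, $c=\sqrt{\gamma p/\rho}$, $M=|\mathbf u|/c$, $E=\frac12|\mathbf u|^2+\frac{c^2}{\gamma-1}$. The background solution $U_b=(p_b,s_b,E_b,v_b\equiv0)$ determined by $U_b(0)$ (positive constants $p_b(0),\rho_b(0),u_b(0)$ with $0<M_b(0)<1$), $m_b$ and $\lambda$ is the smooth $x$-dependent solution, with the given values at $x=0$, of $(\rho_bu_b)'=\lambda\rho_bm_b$, $(\rho_bu_b^2+p_b)'=0$, $(\rho_bE_bu_b)'=0$. The critical length $l_*(\lambda)\in(0,\infty]$ is the supremum of $L$ such that it exists on $[0,L)$ with $\rho_b>0$, $u_b>0$, $0<M_b<1$. Coefficients (functions of $\lambda,x$; prime is $d/dx$; $A_b=A(s_b)$): $a_1=\frac{m_b}{u_b}\big[\frac12-\frac1{(\gamma-1)M_b^2}\big]$, $a_2=\frac{m_bE_b\rho_b^{\gamma-1}}{(\gamma-1)u_b^3}$, $a_3=\frac{m_bE_b}{\rho_bu_b^3}$; $b_1=\frac{\gamma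 m_bA_b}{u_b^3}\big[1+\frac{\gamma-1}2M_b^2\big]$, $b_2=\frac{m_b}{u_b}\big[\gamma+\frac12-\frac{(\gamma-1)^2}2M_b^2+\frac1{(\gamma-1)M_b^2}\big]$, $b_3=\frac{\gamma m_bA_b}{u_b^3\rho_b}\big[1+\frac{\gamma-1}2M_b^2+\frac{(\gamma-1)^2}2M_b^4\big]$; $c_1=\frac{1-M_b^2}{\rho_bu_b}$, $c_2=-\frac{\lambda m_b}{2\rho_bc_b^2}\frac{(\gamma-1)^2M_b^8+(\gamma-1)M_b^6+(5\gamma^2-12\gamma+10)M_b^4+(7\gamma-11)M_b^2+2}{M_b^2(1-M_b^2)}$, $c_3=\frac{\lambda m_b}{2u_b^2}\frac{3(\gamma-1)M_b^4+(\gamma+3)M_b^2+2}{1-M_b^2}$, $c_4=-\frac{\lambda m_b\rho_b^{\gamma-1}}{2c_b^2}\frac{(\gamma-1)M_b^8+(\gamma-1)M_b^6+(2\gamma-6)M_b^4+(\gamma+5)M_b^2+2}{M_b^2(1-M_b^2)}$; $d_1=-\frac{2u_b^2}{p_b}\big[1+\frac1{\gamma M_b^4}\big]p_b'+\frac{\lambda m_bc_b^2}{u_b}\big[\frac{(\gamma-1)^2}2M_b^4+\frac{\gamma-1}2M_b^2-1\big]$, $d_2=\frac{u_b^2}{p_b}\big[1+\frac1{\gamma M_b^4}\big](p_b')^2-\lambda\gamma u_b\big[1+\frac{\gamma-1}2M_b^2\big]m_b'+\gamma\lambda^2m_b^2\big[\frac{(\gamma-1)^2}4\frac{u_b^4}{c_b^4}-1\big]$,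 $d_3=2p_b''-\frac2{p_b}\big[1-\frac1{\gamma M_b^4}\big](p_b')^2-\lambda(\gamma-1)\rho_bu_bm_b'$, $d_4=\frac{\lambda m_b([3(\gamma-1)^2+2]M_b^2+(\gamma-1))}2p_b'-\frac{\gamma p_b(\lambda(\gamma-1)M_b^2+2\lambda)}2m_b'+\frac{\gamma\lambda^2(\gamma-1)^2m_b^2u_b^3p_b}{c_b^4}$, $d_5=-\frac{\gamma+1}{\gamma-1}p_b''+\frac2{(\gamma-1)p_b}\big[1-\frac{1+(\gamma-1)M_b^2}{\gamma M_b^4}\big](p_b')^2+\frac{\lambda m_b}{u_b}p_b'\big[1-\frac{(\gamma-1)^2M_b^4}2\big]+\lambda\rho_bu_b\big[1+\frac{\gamma-1}2M_b^2\big]m_b'-\frac{\gamma\lambda^2(\gamma-1)^2m_b^2u_b^4p_b}{2c_b^6}$, $d_{5+j}=\frac{\lambda\gamma m_bp_bc_j}\pi$ for $j=1,2,3,4$; $e_1=M_b^2-1$, $e_2=\frac{d_1}{c_b^2}$, $e_3=\frac{d_2}{c_b^2}+\frac{(\gamma-1)d_5-d_4/u_b}{\rho_bc_b^2}$, $e_4=\frac{d_3}{c_b^2}+\frac{d_4}{u_bc_b^2}$, $e_5=\frac{\rho_b^{\gamma-1}}{(\gamma-1)c_b^2}\big[(\gamma-1)d_5-\frac{d_4}{u_b}\big]$, $e_j=\frac{d_j}{c_b^2}$ for $j=6,7,8,9$. Let $\Phi(\lambda,x)$ be the $2\times2$ fundamental matrix of the system $\frac{d}{dx}(X,Y)^\top=\lambda\begin{pmatrix}a_1&a_2\\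 b_1&b_2\end{pmatrix}(X,Y)^\top$ with $\Phi(\lambda,0)=I$. Put $[a_4,b_4]^\top=\Phi^{-1}[a_3,b_3]^\top$, $[e_{10},e_{11}]=[e_4,e_5]\Phi$, $[e_{12},e_{13}]=[e_8,e_9]\Phi$. Finally $\gamma_0=-\frac{\gamma m_b(0)u_b(0)}{c_b^2(0)}\cdot\frac{\frac{\gamma^2+1}{2\gamma}M_b^4(0)+\frac{\gamma^2+3}{2\gamma}M_b^2(0)+\frac{3\gamma-1}{2\gamma}}{(M_b^2(0)-1)^2}$. S-condition. $U_b$ (with $l<l_*$) satisfies the S-condition if for each $m=0,1,2,\dots$ the following problem on $(0,l)$ has only the trivial solution $p_m\equiv0$: the boundary conditions are $p_m'(0)+\lambda\gamma_0p_m(0)=0$, $p_m(l)=0$; for $m=0$ the equation is $$e_1p_0''+(\lambda e_2+\pi e_6)p_0'+(e_3+\pi e_7)p_0+\lambda(e_{10}+\pi e_{12})\int_0^xa_4(\lambda,t)p_0(t)\,dt+\lambda(e_{11}+\pi e_{13})\int_0^xb_4(\lambda,t)p_0(t)\,dt=0,$$ and for $m\ge1$ it is $$e_1p_m''+\lambda e_2p_m'+(e_3+m^2)p_m+\lambda e_{10}\int_0^xa_4(\lambda,t)p_m(t)\,dt+\lambda e_{11}\int_0^xb_4(\lambda,t)p_m(t)\,dt=0.$$ *)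

(* Defs.v *)
From Stdlib Require Export Reals.
From Coquelicot Require Export Coquelicot.
Open Scope R_scope.

(* An enumeration that covers S, possibly with repetitions and superfluous
   values, so that the empty and the finite sets are included. *)
Definition at_most_countable (S : R -> Prop) : Prop :=
  exists e : nat -> R, forall x, S x -> exists n, e n = x.

(* [D_in f f' D x] only looks at f on D: at an endpoint of D the derivative is
   one-sided, and nothing depends on the values of f outside D. *)
Definition smooth_on (D : R -> Prop) (f : R -> R) : Prop :=
  exists F : nat -> R -> R,
    (forall x, D x -> F O x = f x) /\
    (forall n x, D x -> D_in (F n) (F (S n)) D x).

Definition half_line (x : R) : Prop := 0 <= x.
Definition ico (L : Rbar) (x : R) : Prop := 0 <= x /\ Rbar_lt x L.
Definition icc (l x : R) : Prop := 0 <= x <= l.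

Record mat2 := Mat2 { m11 : R; m12 : R; m21 : R; m22 : R }.

Definition mat2_id : mat2 := Mat2 1 0 0 1.

Definition mat2_scale (k : R) (P : mat2) : mat2 :=
  Mat2 (k * m11 P) (k * m12 P) (k * m21 P) (k * m22 P).

Definition mat2_mul (P Q : mat2) : mat2 :=
  Mat2 (m11 P * m11 Q + m12 P * m21 Q) (m11 P * m12 Q + m12 P * m22 Q)
       (m21 P * m11 Q + m22 P * m21 Q) (m21 P * m12 Q + m22 P * m22 Q).

Definition mat2_det (P : mat2) : R := m11 P * m22 P - m12 P * m21 P.

Definition mat2_inv (P : mat2) : mat2 :=
  mat2_scale (/ mat2_det P) (Mat2 (m22 P) (- m12 P) (- m21 P) (m11 P)).

Definition mat2_mulcol (P : mat2) (v : R * R) : R * R :=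
  (m11 P * fst v + m12 P * snd v, m21 P * fst v + m22 P * snd v).

Definition mat2_mulrow (v : R * R) (P : mat2) : R * R :=
  (fst v * m11 P + snd v * m21 P, fst v * m12 P + snd v * m22 P).

Definition mat2_D_in (P P' : R -> mat2) (D : R -> Prop) (x : R) : Prop :=
  D_in (fun y => m11 (P y)) (fun y => m11 (P' y)) D x /\
  D_in (fun y => m12 (P y)) (fun y => m12 (P' y)) D x /\
  D_in (fun y => m21 (P y)) (fun y => m21 (P' y)) D x /\
  D_in (fun y => m22 (P y)) (fun y => m22 (P' y)) D x.

Definition sound_speed (gamma p rho : R) : R := sqrt (gamma * p / rho).

Definition mach (gamma p rho u : R) : R := Rabs u / sound_speed gamma p rho.

(* A one-dimensional flow: the transversal velocity is identically zero, so
   that u is the whole velocity. *)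
Record flow := Flow { pres : R -> R; dens : R -> R; vel : R -> R; entr : R -> R }.

Section Background.

Variables (gamma kappa0 c_nu : R) (mb : R -> R) (lam : R).

Definition A_of (s : R) : R := kappa0 * exp (s / c_nu).

Section Flow.

Variable U : flow.

Local Notation p := (pres U).
Local Notation rho := (dens U).
Local Notation u := (vel U).
Local Notation s := (entr U).

Definition sound (x : R) : R := sound_speed gamma (p x) (rho x).
Definition Mach (x : R) : R := mach gamma (p x) (rho x) (u x).
Definition Etot (x : R) : R := / 2 * (Rabs (u x)) ^ 2 + sound x ^ 2 / (gamma - 1).
Definition Aent (x : R) : R := A_of (s x).

Definition is_background_on (p0 rho0 u0 : R) (L : Rbar) : Prop :=
  (p 0 = p0 /\ rho 0 = rho0 /\ u 0 = u0) /\
  (smooth_on (ico L) p /\ smooth_on (ico L) rho /\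
   smooth_on (ico L) u /\ smooth_on (ico L) s) /\
  (forall x, ico L x ->
     p x = A_of (s x) * Rpower (rho x) gamma /\
     0 < rho x /\ 0 < u x /\ 0 < Mach x < 1 /\
     D_in (fun y => rho y * u y) (fun y => lam * rho y * mb y) (ico L) x /\
     D_in (fun y => rho y * u y ^ 2 + p y) (fun _ => 0) (ico L) x /\
     D_in (fun y => rho y * Etot y * u y) (fun _ => 0) (ico L) x).

Local Notation c := sound.
Local Notation M := Mach.
Local Notation E := Etot.

(* The derivatives of p and mb occur only in coefficients that are used at
   interior points, where the two-sided [Derive] is the right notion. *)
Local Notation p' := (Derive p).
Local Notation p'' := (Derive_n p 2).
Local Notation mb' := (Derive mb).

Definition a1 (x : R) : R :=
  mb x / u x * (1 / 2 - 1 / ((gamma - 1) * M x ^ 2)).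
Definition a2 (x : R) : R :=
  mb x * E x * Rpower (rho x) (gamma - 1) / ((gamma - 1) * u x ^ 3).
Definition a3 (x : R) : R :=
  mb x * E x / (rho x * u x ^ 3).

Definition b1 (x : R) : R :=
  gamma * mb x * Aent x / u x ^ 3 * (1 + (gamma - 1) / 2 * M x ^ 2).
Definition b2 (x : R) : R :=
  mb x / u x *
  (gamma + 1 / 2 - (gamma - 1) ^ 2 / 2 * M x ^ 2 + 1 / ((gamma - 1) * M x ^ 2)).
Definition b3 (x : R) : R :=
  gamma * mb x * Aent x / (u x ^ 3 * rho x) *
  (1 + (gamma - 1) / 2 * M x ^ 2 + (gamma - 1) ^ 2 / 2 * M x ^ 4).

Definition c1 (x : R) : R := (1 - M x ^ 2) / (rho x * u x).
Definition c2 (x : R) : R :=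
  - (lam * mb x / (2 * rho x * c x ^ 2)) *
  (((gamma - 1) ^ 2 * M x ^ 8 + (gamma - 1) * M x ^ 6
    + (5 * gamma ^ 2 - 12 * gamma + 10) * M x ^ 4
    + (7 * gamma - 11) * M x ^ 2 + 2)
   / (M x ^ 2 * (1 - M x ^ 2))).
Definition c3 (x : R) : R :=
  lam * mb x / (2 * u x ^ 2) *
  ((3 * (gamma - 1) * M x ^ 4 + (gamma + 3) * M x ^ 2 + 2) / (1 - M x ^ 2)).
Definition c4 (x : R) : R :=
  - (lam * mb x * Rpower (rho x) (gamma - 1) / (2 * c x ^ 2)) *
  (((gamma - 1) * M x ^ 8 + (gamma - 1) * M x ^ 6
    + (2 * gamma - 6) * M x ^ 4 + (gamma + 5) * M x ^ 2 + 2)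
   / (M x ^ 2 * (1 - M x ^ 2))).

Definition d1 (x : R) : R :=
  - (2 * u x ^ 2 / p x) * (1 + 1 / (gamma * M x ^ 4)) * p' x
  + lam * mb x * c x ^ 2 / u x *
    ((gamma - 1) ^ 2 / 2 * M x ^ 4 + (gamma - 1) / 2 * M x ^ 2 - 1).
Definition d2 (x : R) : R :=
  u x ^ 2 / p x * (1 + 1 / (gamma * M x ^ 4)) * p' x ^ 2
  - lam * gamma * u x * (1 + (gamma - 1) / 2 * M x ^ 2) * mb' x
  + gamma * lam ^ 2 * mb x ^ 2 *
    ((gamma - 1) ^ 2 / 4 * (u x ^ 4 / c x ^ 4) - 1).
Definition d3 (x : R) : R :=
  2 * p'' x
  - 2 / p x * (1 - 1 / (gamma * M x ^ 4)) * p' x ^ 2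
  - lam * (gamma - 1) * rho x * u x * mb' x.
Definition d4 (x : R) : R :=
  lam * mb x * ((3 * (gamma - 1) ^ 2 + 2) * M x ^ 2 + (gamma - 1)) / 2 * p' x
  - gamma * p x * (lam * (gamma - 1) * M x ^ 2 + 2 * lam) / 2 * mb' x
  + gamma * lam ^ 2 * (gamma - 1) ^ 2 * mb x ^ 2 * u x ^ 3 * p x / c x ^ 4.
Definition d5 (x : R) : R :=
  - ((gamma + 1) / (gamma - 1)) * p'' x
  + 2 / ((gamma - 1) * p x) *
    (1 - (1 + (gamma - 1) * M x ^ 2) / (gamma * M x ^ 4)) * p' x ^ 2
  + lam * mb x / u x * p' x * (1 - (gamma - 1) ^ 2 * M x ^ 4 / 2)
  + lam * rho x * u x * (1 + (gamma - 1) / 2 * M x ^ 2) * mb' x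
  - gamma * lam ^ 2 * (gamma - 1) ^ 2 * mb x ^ 2 * u x ^ 4 * p x / (2 * c x ^ 6).
Definition d6 (x : R) : R := lam * gamma * mb x * p x * c1 x / PI.
Definition d7 (x : R) : R := lam * gamma * mb x * p x * c2 x / PI.
Definition d8 (x : R) : R := lam * gamma * mb x * p x * c3 x / PI.
Definition d9 (x : R) : R := lam * gamma * mb x * p x * c4 x / PI.

Definition e1 (x : R) : R := M x ^ 2 - 1.
Definition e2 (x : R) : R := d1 x / c x ^ 2.
Definition e3 (x : R) : R :=
  d2 x / c x ^ 2 + ((gamma - 1) * d5 x - d4 x / u x) / (rho x * c x ^ 2).
Definition e4 (x : R) : R := d3 x / c x ^ 2 + d4 x / (u x * c x ^ 2).
Definition e5 (x : R) : R :=
  Rpower (rho x) (gamma - 1) / ((gamma - 1) * c x ^ 2) *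
  ((gamma - 1) * d5 x - d4 x / u x).
Definition e6 (x : R) : R := d6 x / c x ^ 2.
Definition e7 (x : R) : R := d7 x / c x ^ 2.
Definition e8 (x : R) : R := d8 x / c x ^ 2.
Definition e9 (x : R) : R := d9 x / c x ^ 2.

Definition gamma0 : R :=
  - (gamma * mb 0 * u 0 / c 0 ^ 2) *
  (((gamma ^ 2 + 1) / (2 * gamma) * M 0 ^ 4
    + (gamma ^ 2 + 3) / (2 * gamma) * M 0 ^ 2
    + (3 * gamma - 1) / (2 * gamma))
   / (M 0 ^ 2 - 1) ^ 2).

Definition is_fundamental_on (l : R) (Phi : R -> mat2) : Prop :=
  Phi 0 = mat2_id /\
  forall x, icc l x ->
    mat2_D_in Phi
      (fun y => mat2_scale lam (mat2_mul (Mat2 (a1 y) (a2 y) (b1 y) (b2 y)) (Phi y)))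
      (icc l) x.

Section SCondition.

Variable Phi : R -> mat2.

Definition a4 (x : R) : R := fst (mat2_mulcol (mat2_inv (Phi x)) (a3 x, b3 x)).
Definition b4 (x : R) : R := snd (mat2_mulcol (mat2_inv (Phi x)) (a3 x, b3 x)).
Definition e10 (x : R) : R := fst (mat2_mulrow (e4 x, e5 x) (Phi x)).
Definition e11 (x : R) : R := snd (mat2_mulrow (e4 x, e5 x) (Phi x)).
Definition e12 (x : R) : R := fst (mat2_mulrow (e8 x, e9 x) (Phi x)).
Definition e13 (x : R) : R := snd (mat2_mulrow (e8 x, e9 x) (Phi x)).

Definition mode_equation (k : nat) (q : R -> R) (x : R) : Prop :=
  match k with
  | O =>
      e1 x * Derive_n q 2 x + (lam * e2 x + PI * e6 x) * Derive q x
      + (e3 x + PI * e7 x) * q x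
      + lam * (e10 x + PI * e12 x) * RInt (fun t => a4 t * q t) 0 x
      + lam * (e11 x + PI * e13 x) * RInt (fun t => b4 t * q t) 0 x = 0
  | S _ =>
      e1 x * Derive_n q 2 x + lam * e2 x * Derive q x
      + (e3 x + INR k ^ 2) * q x
      + lam * e10 x * RInt (fun t => a4 t * q t) 0 x
      + lam * e11 x * RInt (fun t => b4 t * q t) 0 x = 0
  end.

(* Classical solutions: continuous on [0,l], twice differentiable on (0,l), with
   a (one-sided) derivative q' at the entrance. *)
Definition mode_solution (l : R) (k : nat) (q : R -> R) : Prop :=
  (forall x, icc l x -> continue_in q (icc l) x) /\
  (forall x, 0 < x < l -> ex_derive q x /\ ex_derive (Derive q) x) /\
  (exists q' : R -> R, D_in q q' (icc l) 0 /\ q' 0 + lam * gamma0 * q 0 = 0) /\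
  q l = 0 /\
  (forall x, 0 < x < l -> mode_equation k q x).

End SCondition.

Definition S_condition (l : R) : Prop :=
  forall Phi : R -> mat2, is_fundamental_on l Phi ->
  forall (k : nat) (q : R -> R), mode_solution Phi l k q ->
  forall x, icc l x -> q x = 0.

End Flow.

Definition critical_length (p0 rho0 u0 : R) : Rbar :=
  Lub_Rbar (fun L => 0 < L /\ exists U, is_background_on U p0 rho0 u0 (Finite L)).

Definition is_background (p0 rho0 u0 : R) (U : flow) : Prop :=
  is_background_on U p0 rho0 u0 (critical_length p0 rho0 u0).

End Background.

(* Main.v *)
Require Import Defs.
From Stdlib Require Import Lra Lia Psatz Arith Factorial Cantor Ranalysis5.
From Stdlib Require Import Classical ClassicalEpsilon FunctionalExtensionality.
From Coquelicot Require Import Coquelicot.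
Open Scope R_scope.

(** The momentum flux and the energy flux of the background are constant, so the
    whole state is a rational function of one variable [0 < y < 1], and the mass
    equation integrates to [ln y - y = c0 + K lam int_0^x mb].  Hence the state at
    [x] is an analytic function of [lam int_0^x mb], and the [lam] for which the
    flow is subsonic up to [l] lie in an open half-line containing [0].

    With [Phi] absorbed in the unknowns, mode [m] becomes a linear first-order
    system of four equations whose matrix is analytic in [lam], uniformly in [x].
    Solving it for the power series coefficients in [lam] (a Volterra equation in
    a weighted sequence space) shows that the solution [q_m(x,lam)] with
    [q_m(0) = 1] satisfying the entrance condition is analytic in [lam].  A
    nontrivial solution of the boundary value problem exists only if
    [q_m(l,lam) = 0].  For [lam = 0] the equation is [(1 - M^2) q'' = m^2 q],
    [q'(0) = 0], so [q_m(l,0) >= 1]; the zeros of [q_m(l,.)] are therefore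
    isolated, and there are countably many of them for every [m]. *)

(** * Continuous functions, integrals and uniformly convergent series *)

(** The exceptional set has to be fixed before [lam] and the flow are known, so everything is built
    from [p0], [rho0], [u0] and [mb] alone; the entrance constant [gamma0] depends only on the state
    at 0. Analyticity in [lam] is wanted with one radius for all [x] in [0,l]. Solving for the
    coefficients one after another would produce each of them but no geometric bound, hence one
    Volterra equation for all of them at once, with weights that encode the radius. The coefficients
    [a2], [b1], [b3], [e5], [e9] contain [A(s)] or the non-rational [rho^(gamma-1)]. Multiplying the
    second component of [Phi] times the integrals by [rho^(gamma-1)] leaves only [p/rho], and the
    matrix becomes rational in [y], [mb], [mb'] and [lam]. Analyticity then reduces to sums,
    products and quotients, apart from the one function [y], which solves a transcendental equation.
    It is treated by factorial bounds on derivatives: [v = 1/(1-y)] obeys the polynomial equation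
    [v' = v^3 - v^2]. *)

Definition cfun (f : R -> R) : Prop := forall x, continuous f x.

Lemma cfun_const c : cfun (fun _ => c).
Proof. intros x; apply continuous_const. Qed.

Lemma cfun_plus f g : cfun f -> cfun g -> cfun (fun x => f x + g x).
Proof. intros Hf Hg x; exact (continuous_plus f g x (Hf x) (Hg x)). Qed.

Lemma cfun_minus f g : cfun f -> cfun g -> cfun (fun x => f x - g x).
Proof. intros Hf Hg x; exact (continuous_minus f g x (Hf x) (Hg x)). Qed.

Lemma cfun_mult f g : cfun f -> cfun g -> cfun (fun x => f x * g x).
Proof. intros Hf Hg x; exact (continuous_mult f g x (Hf x) (Hg x)). Qed.

Lemma cfun_comp f g : cfun f -> cfun g -> cfun (fun x => g (f x)).
Proof. intros Hf Hg x; exact (continuous_comp f g x (Hf x) (Hg (f x))). Qed.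

Lemma cfun_pow f n : cfun f -> cfun (fun x => f x ^ n).
Proof.
  intros Hf; induction n as [|n IH]; simpl.
  - apply cfun_const.
  - apply cfun_mult; assumption.
Qed.

Lemma cfun_sum (f : nat -> R -> R) n :
  (forall k, cfun (f k)) -> cfun (fun x => sum_f_R0 (fun k => f k x) n).
Proof.
  intros Hf; induction n as [|n IH]; simpl.
  - apply Hf.
  - apply cfun_plus; auto.
Qed.

Lemma continuous_inv_neq0 (f : R -> R) x : continuous f x -> f x <> 0 -> continuous (fun y => / f y) x.
Proof.
  intros Hf H0. apply continuity_pt_filterlim.
  apply (continuity_pt_inv f x); [apply continuity_pt_filterlim; exact Hf | exact H0].
Qed.

Lemma cfun_inv f : cfun f -> (forall x, f x <> 0) -> cfun (fun x => / f x).
Proof. intros Hf H x; apply continuous_inv_neq0; auto. Qed.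

Lemma cfun_eps f : cfun f <->
  forall x eps, 0 < eps -> exists d, 0 < d /\ forall y, Rabs (y - x) < d -> Rabs (f y - f x) < eps.
Proof.
  split.
  - intros Hf x eps He.
    pose proof (proj1 (filterlim_locally f (f x)) (Hf x) (mkposreal eps He)) as [d Hd].
    exists d; split; [apply cond_pos|]. intros y Hy. exact (Hd y Hy).
  - intros H x. apply (proj2 (filterlim_locally f (f x))). intros eps.
    destruct (H x eps (cond_pos eps)) as [d [Hd Hd2]].
    exists (mkposreal d Hd). intros y Hy. exact (Hd2 y Hy).
Qed.

Lemma cfun_unif g :
  (forall eps, 0 < eps -> exists f, cfun f /\ forall t, Rabs (g t - f t) < eps) -> cfun g.
Proof.
  intros H. apply cfun_eps. intros x eps He.
  destruct (H (eps / 3)) as [f [Hf Hfg]]; [lra|].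
  destruct (proj1 (cfun_eps f) Hf x (eps / 3)) as [d [Hd Hd2]]; [lra|].
  exists d; split; [exact Hd|]. intros y Hy.
  specialize (Hd2 y Hy). pose proof (Hfg x). pose proof (Hfg y).
  revert Hd2 H0 H1. unfold Rabs; repeat destruct Rcase_abs; intros; lra.
Qed.

Lemma cfun_ex_RInt f a b : cfun f -> ex_RInt f a b.
Proof. intros Hf; apply (ex_RInt_continuous f); intros; apply Hf. Qed.

Lemma cfun_RInt f : cfun f -> cfun (fun x => RInt f 0 x).
Proof.
  intros Hf x. apply (continuous_RInt_1 f 0 x (fun z => RInt f 0 z)).
  apply filter_forall; intros z. apply (RInt_correct f), cfun_ex_RInt, Hf.
Qed.

Lemma cfun_RInt_derive f x : cfun f -> is_derive (fun x => RInt f 0 x) x (f x).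
Proof.
  intros Hf. apply (is_derive_RInt f (fun x => RInt f 0 x) 0 x); [|apply Hf].
  apply filter_forall; intros z. apply (RInt_correct f), cfun_ex_RInt, Hf.
Qed.

(** The Weierstrass test. The parameter ranges over an arbitrary type because the Volterra series
    needs uniformity in the point and the index together. *)
Lemma series_unif {T : Type} (f : nat -> T -> R) (A : nat -> R) :
  (forall n t, Rabs (f n t) <= A n) -> ex_series A ->
  forall eps, 0 < eps -> exists N, forall n, (N <= n)%nat -> forall t,
    Rabs (Series (fun k => f k t) - sum_f_R0 (fun k => f k t) n) < eps.
Proof.
  intros HA HexA eps He.
  assert (Hpos : forall n t, 0 <= Rabs (f n t) <= A n) by (split; [apply Rabs_pos|auto]).
  destruct HexA as [lA HlA].
  pose proof (proj1 (is_series_Reals A lA) HlA eps He) as [N HN].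
  exists N; intros n Hn t.
  assert (HexA : ex_series A) by (exists lA; exact HlA).
  assert (Hexf : ex_series (fun k => f k t)).
  { apply (ex_series_le (K := R_AbsRing) (V := R_CompleteNormedModule) (fun k => f k t) A); [intros k; apply HA|exact HexA]. }
  rewrite (Series_incr_n (fun k => f k t) (S n)); [|lia|exact Hexf]. simpl pred.
  replace (sum_f_R0 (fun k : nat => f k t) n + Series (fun k : nat => f (S n + k)%nat t)
    - sum_f_R0 (fun k : nat => f k t) n) with (Series (fun k : nat => f (S n + k)%nat t)) by ring.
  assert (HexAn : ex_series (fun k => A (S n + k)%nat)) by (apply (ex_series_incr_n A (S n)); exact HexA).
  apply Rle_lt_trans with (Series (fun k => A (S n + k)%nat)).
  - apply Rle_trans with (Series (fun k => Rabs (f (S n + k)%nat t))).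
    + apply Series_Rabs.
      apply (ex_series_le (K := R_AbsRing) (V := R_CompleteNormedModule) _ (fun k => A (S n + k)%nat)); [|exact HexAn].
      intros k. unfold norm; simpl. unfold abs; simpl. rewrite Rabs_Rabsolu. apply HA.
    + apply Series_le; [intros k; apply Hpos|exact HexAn].
  - pose proof (HN n Hn) as H1.
    pose proof (Series_incr_n A (S n) ltac:(lia) HexA) as H2. simpl pred in H2.
    rewrite (is_series_unique _ _ HlA) in H2.
    unfold Rdist in H1.
    replace (Series (fun k => A (S n + k)%nat)) with (- (sum_f_R0 A n - lA)) by lra.
    eapply Rle_lt_trans; [apply Rle_abs|]. rewrite Rabs_Ropp. exact H1.
Qed.

Lemma Series_abs_le (f A : nat -> R) :
  (forall n, Rabs (f n) <= A n) -> ex_series A -> Rabs (Series f) <= Series A.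
Proof.
  intros HA Hex.
  apply Rle_trans with (Series (fun k => Rabs (f k))).
  - apply Series_Rabs.
    apply (ex_series_le (K := R_AbsRing) (V := R_CompleteNormedModule) _ A); [|exact Hex].
    intros k. unfold norm; simpl. unfold abs; simpl. rewrite Rabs_Rabsolu. apply HA.
  - apply Series_le; [|exact Hex]. intros n; split; [apply Rabs_pos|apply HA].
Qed.

Lemma cfun_series (f : nat -> R -> R) (A : nat -> R) :
  (forall n, cfun (f n)) -> (forall n t, Rabs (f n t) <= A n) -> ex_series A ->
  cfun (fun t => Series (fun k => f k t)).
Proof.
  intros Hf HA Hex. apply cfun_unif. intros eps He.
  destruct (series_unif f A HA Hex eps He) as [N HN].
  exists (fun t => sum_f_R0 (fun k => f k t) N). split; [apply cfun_sum; exact Hf|].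
  intros t. apply HN; lia.
Qed.

Lemma RInt_abs_le f b M : cfun f -> 0 <= b ->
  (forall t, 0 <= t <= b -> Rabs (f t) <= M) -> Rabs (RInt f 0 b) <= b * M.
Proof.
  intros Hf Hb H. replace (b * M) with ((b - 0) * M) by ring.
  apply abs_RInt_le_const; auto. apply cfun_ex_RInt, Hf.
Qed.

Lemma RInt_sum (f : nat -> R -> R) n b : (forall k, cfun (f k)) ->
  RInt (fun t => sum_f_R0 (fun k => f k t) n) 0 b = sum_f_R0 (fun k => RInt (f k) 0 b) n.
Proof.
  intros Hf; induction n as [|n IH]; simpl.
  - reflexivity.
  - rewrite <- IH. apply (RInt_plus (V := R_CompleteNormedModule)).
    + apply cfun_ex_RInt, cfun_sum, Hf.
    + apply cfun_ex_RInt, Hf.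
Qed.

Lemma RInt_minus_c f g b : cfun f -> cfun g ->
  RInt (fun t => f t - g t) 0 b = RInt f 0 b - RInt g 0 b.
Proof.
  intros Hf Hg. apply (RInt_minus (V := R_CompleteNormedModule) f g); apply cfun_ex_RInt; assumption.
Qed.

Lemma RInt_plus_c f g b : cfun f -> cfun g ->
  RInt (fun t => f t + g t) 0 b = RInt f 0 b + RInt g 0 b.
Proof.
  intros Hf Hg. apply (RInt_plus (V := R_CompleteNormedModule) f g); apply cfun_ex_RInt; assumption.
Qed.

Lemma RInt_scal_c f c b : cfun f ->
  RInt (fun t => c * f t) 0 b = c * RInt f 0 b.
Proof.
  intros Hf. apply (RInt_scal (V := R_CompleteNormedModule) f 0 b c); apply cfun_ex_RInt; assumption.
Qed.

Lemma RInt_series (f : nat -> R -> R) (A : nat -> R) b : 0 <= b ->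
  (forall n, cfun (f n)) -> (forall n t, Rabs (f n t) <= A n) -> ex_series A ->
  is_series (fun k => RInt (f k) 0 b) (RInt (fun t => Series (fun k => f k t)) 0 b).
Proof.
  intros Hb Hf HA Hex. apply is_series_Reals. intros eps He.
  (* [b + 1] instead of [b] keeps the quotient meaningful for [b = 0]. *)
  destruct (series_unif f A HA Hex (eps / (b + 1))) as [N HN].
  { apply Rdiv_lt_0_compat; lra. }
  exists N. intros n Hn. unfold Rdist.
  rewrite <- RInt_sum by exact Hf.
  rewrite <- RInt_minus_c; [|apply cfun_sum, Hf|apply (cfun_series f A); auto].
  apply Rle_lt_trans with (b * (eps / (b + 1))).
  - apply RInt_abs_le; [|exact Hb|].
    + apply cfun_minus; [apply cfun_sum, Hf|apply (cfun_series f A); auto].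
    + intros t _. rewrite Rabs_minus_sym. left. apply HN; lia.
  - replace eps with ((b + 1) * (eps / (b + 1))) at 2 by (field; lra).
    apply Rmult_lt_compat_r; [apply Rdiv_lt_0_compat; lra|lra].
Qed.

(** Composition with the projection onto [0,l] turns continuity on the closed interval into
    continuity on all of R, with values constant outside; suprema over R are then suprema over a
    compact set. *)
Definition clamp (l x : R) : R := Rmax 0 (Rmin x l).

Lemma clamp_in l x : 0 <= l -> 0 <= clamp l x <= l.
Proof. intros Hl; unfold clamp, Rmax, Rmin; repeat destruct Rle_dec; lra. Qed.

Lemma clamp_id l x : 0 <= x <= l -> clamp l x = x.
Proof. intros Hl; unfold clamp, Rmax, Rmin; repeat destruct Rle_dec; lra. Qed.

Lemma clamp_idem l x : 0 <= l -> clamp l (clamp l x) = clamp l x.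
Proof. intros Hl; apply clamp_id, clamp_in, Hl. Qed.

Lemma clamp_lip l x y : Rabs (clamp l x - clamp l y) <= Rabs (x - y).
Proof. unfold clamp, Rmax, Rmin, Rabs; repeat destruct Rle_dec; repeat destruct Rcase_abs; lra. Qed.

Lemma cfun_clamp l : cfun (clamp l).
Proof.
  apply cfun_eps. intros x eps He. exists eps; split; [exact He|].
  intros y Hy. eapply Rle_lt_trans; [apply clamp_lip|exact Hy].
Qed.

Lemma RInt_power (c : R) k b : RInt (fun t => c * t ^ k) 0 b = c * (b ^ S k / INR (S k)).
Proof.
  assert (HS : INR (S k) <> 0) by (apply not_0_INR; lia).
  apply is_RInt_unique.
  replace (c * (b ^ S k / INR (S k))) with
    (minus (c * (b ^ S k / INR (S k))) (c * (0 ^ S k / INR (S k)))).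
  - apply (is_RInt_derive (fun t => c * (t ^ S k / INR (S k))) (fun t => c * t ^ k)).
    + intros x _. auto_derive; [trivial|].
      change (Init.Nat.pred (S k)) with k.
      replace (match k with O => 1 | S _ => INR k + 1 end) with (INR (S k)) by reflexivity.
      field. exact HS.
    + intros x _. apply (cfun_mult (fun _ => c) (fun t => t ^ k)); [apply cfun_const|].
      apply (cfun_pow (fun t => t)). intros y; apply continuous_id.
  - unfold minus, plus, opp; simpl. field. exact HS.
Qed.

Lemma RInt_abs_dom f g b : cfun f -> cfun g -> 0 <= b ->
  (forall t, 0 <= t <= b -> Rabs (f t) <= g t) -> Rabs (RInt f 0 b) <= RInt g 0 b.
Proof.
  intros Hf Hg Hb H.
  eapply Rle_trans; [apply abs_RInt_le; [exact Hb|apply cfun_ex_RInt, Hf]|].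
  apply RInt_le; [exact Hb| | |].
  - apply cfun_ex_RInt. intros x. apply (continuous_comp f Rabs); [apply Hf|].
    apply continuity_pt_filterlim. apply Rcontinuity_abs.
  - apply cfun_ex_RInt, Hg.
  - intros x Hx. apply H; lra.
Qed.

(** * Linear Volterra equations *)

Section Volterra.

Variables (I : Type) (w : I -> R) (L : R -> (I -> R) -> I -> R) (beta l : R).
Hypothesis hl : 0 <= l.
Hypothesis hbeta : 0 <= beta.
Hypothesis hw : forall i, 0 < w i.
Hypothesis L_lin : forall x a b c i, L x (fun j => a j + c * b j) i = L x a i + c * L x b i.
Hypothesis L_bound : forall x a phi, (forall i, Rabs (a i) <= w i * phi) ->
  forall i, Rabs (L x a i) <= w i * (beta * phi).
Hypothesis L_cont : forall f : R -> I -> R, (forall i, cfun (fun x => f x i)) ->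
  forall i, cfun (fun x => L x (f x) i).

(** The clamped upper limit makes every iterate constant outside [0,l], so that the bounds below
    hold on all of R. *)
Definition vstep (f : R -> I -> R) (x : R) (i : I) : R := RInt (fun t => L t (f t) i) 0 (clamp l x).

Lemma vstep_cfun f : (forall i, cfun (fun x => f x i)) -> forall i, cfun (fun x => vstep f x i).
Proof.
  intros Hf i. apply (cfun_comp (clamp l) (fun y => RInt (fun t => L t (f t) i) 0 y)).
  - apply cfun_clamp.
  - apply cfun_RInt, L_cont, Hf.
Qed.

(** Integrating [t^k / k!] over [0,x] gives [x^(k+1) / (k+1)!], and the operator bound contributes
    one factor [beta]. *)
Lemma vstep_bound f C k : 0 <= C -> (forall i, cfun (fun x => f x i)) ->
  (forall x i, 0 <= x <= l -> Rabs (f x i) <= w i * (C * ((beta * x) ^ k / INR (fact k)))) ->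
  forall x i, Rabs (vstep f x i) <= w i * (C * ((beta * clamp l x) ^ S k / INR (fact (S k)))).
Proof.
  intros HC Hf HB x i. unfold vstep.
  pose proof (clamp_in l x hl) as Hcl. set (b := clamp l x) in *.
  assert (Hk : INR (fact k) <> 0) by apply INR_fact_neq_0.
  assert (HSk : INR (S k) <> 0) by (apply not_0_INR; lia).
  apply Rle_trans with (RInt (fun t => (w i * (C * beta * beta ^ k / INR (fact k))) * t ^ k) 0 b).
  - apply RInt_abs_dom; [apply L_cont, Hf| |lra|].
    + apply (cfun_mult (fun _ => _) (fun t => t ^ k)); [apply cfun_const|].
      apply (cfun_pow (fun t => t)). intros y; apply continuous_id.
    + intros t Ht.
      replace (w i * (C * beta * beta ^ k / INR (fact k)) * t ^ k)
        with (w i * (beta * (C * ((beta * t) ^ k / INR (fact k))))).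
      * apply L_bound. intros j. apply HB; lra.
      * rewrite Rpow_mult_distr. field. exact Hk.
  - rewrite RInt_power. rewrite fact_simpl, mult_INR, Rpow_mult_distr.
    right. simpl pow. field. split; assumption.
Qed.

Variables (g : R -> I -> R) (G : R).
Hypothesis hG : 0 <= G.
Hypothesis g_cont : forall i, cfun (fun x => g x i).
Hypothesis g_bound : forall x i, Rabs (g x i) <= w i * G.

(** Terms of the Neumann series. *)
Fixpoint viter (k : nat) : R -> I -> R :=
  match k with O => g | S k => vstep (viter k) end.

Lemma viter_cfun k : forall i, cfun (fun x => viter k x i).
Proof. induction k as [|k IH]; simpl; [exact g_cont|apply vstep_cfun, IH]. Qed.

Lemma viter_bound k x i : Rabs (viter k x i) <= w i * (G * ((beta * clamp l x) ^ k / INR (fact k))).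
Proof.
  revert x i. induction k as [|k IH]; intros x i.
  - simpl. replace (w i * (G * (1 / 1))) with (w i * G) by field. apply g_bound.
  - simpl viter. apply vstep_bound; [exact hG|apply viter_cfun|].
    intros y j Hy. rewrite <- (clamp_id l y Hy) at 2. apply IH.
Qed.

Definition vmaj (k : nat) : R := G * ((beta * l) ^ k / INR (fact k)).

Lemma exp_series x : is_series (fun k => x ^ k / INR (fact k)) (exp x).
Proof.
  pose proof (proj1 (is_pseries_R _ _ _) (is_exp_Reals x)) as H.
  apply (is_series_ext _ _ _) with (2 := H). intros n; unfold Rdiv; apply Rmult_comm.
Qed.

Lemma ex_vmaj : is_series vmaj (G * exp (beta * l)).
Proof. apply (is_series_scal (K := R_AbsRing) (V := R_NormedModule) G), exp_series. Qed.

Lemma viter_bound_unif k x i : Rabs (viter k x i / w i) <= vmaj k.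
Proof.
  unfold Rdiv. rewrite Rabs_mult, (Rabs_pos_eq (/ w i)) by (left; apply Rinv_0_lt_compat, hw).
  apply Rmult_le_reg_r with (w i); [apply hw|].
  rewrite Rmult_assoc, Rinv_l, Rmult_1_r by (apply Rgt_not_eq, hw).
  eapply Rle_trans; [apply viter_bound|]. rewrite Rmult_comm.
  apply Rmult_le_compat_r; [left; apply hw|]. unfold vmaj.
  apply Rmult_le_compat_l; [exact hG|].
  apply Rmult_le_compat_r; [left; apply Rinv_0_lt_compat, INR_fact_lt_0|].
  apply pow_incr. pose proof (clamp_in l x hl). split; [apply Rmult_le_pos; lra|].
  apply Rmult_le_compat_l; lra.
Qed.

(** Dividing by the weight gives all indices the common majorant [vmaj], although the weights
    themselves need not be bounded. *)
Definition vsol (x : R) (i : I) : R := w i * Series (fun k => viter k x i / w i).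

Lemma vsol_cfun i : cfun (fun x => vsol x i).
Proof.
  apply (cfun_mult (fun _ => w i)); [apply cfun_const|].
  apply (cfun_series (fun k x => viter k x i / w i) vmaj).
  - intros n. apply (cfun_mult _ (fun _ => / w i)); [apply viter_cfun|apply cfun_const].
  - intros n t; apply viter_bound_unif.
  - eexists; apply ex_vmaj.
Qed.

Lemma vsol_bound x i : Rabs (vsol x i) <= w i * (G * exp (beta * l)).
Proof.
  unfold vsol. rewrite Rabs_mult, (Rabs_pos_eq (w i)) by (left; apply hw).
  apply Rmult_le_compat_l; [left; apply hw|].
  rewrite <- (is_series_unique _ _ ex_vmaj).
  apply Series_abs_le; [intros n; apply viter_bound_unif|eexists; apply ex_vmaj].
Qed.

Definition vpart (n : nat) (x : R) (i : I) : R := sum_f_R0 (fun k => viter k x i) n.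

Lemma vpart_cfun n i : cfun (fun x => vpart n x i).
Proof. apply (cfun_sum (fun k x => viter k x i)). intros k; apply viter_cfun. Qed.

Lemma vpart_S n x i : vpart (S n) x i = g x i + vstep (vpart n) x i.
Proof.
  revert x i; induction n as [|n IH]; intros x i.
  - reflexivity.
  - change (vpart (S (S n)) x i) with (vpart (S n) x i + vstep (viter (S n)) x i).
    rewrite IH. rewrite Rplus_assoc. f_equal. unfold vstep.
    rewrite <- RInt_plus_c by (apply L_cont; [apply vpart_cfun || apply viter_cfun]).
    apply RInt_ext. intros t _.
    replace (vpart (S n) t) with (fun j => vpart n t j + 1 * viter (S n) t j).
    + rewrite L_lin, Rmult_1_l. reflexivity.
    + apply functional_extensionality; intros j. rewrite Rmult_1_l. reflexivity.
Qed.

Lemma vsol_approx eps : 0 < eps -> exists N, forall n, (N <= n)%nat -> forall x i,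
  Rabs (vsol x i - vpart n x i) <= w i * eps.
Proof.
  intros He.
  destruct (series_unif (fun k (t : R * I) => viter k (fst t) (snd t) / w (snd t)) vmaj) with (eps := eps)
    as [N HN]; [intros; apply viter_bound_unif|eexists; apply ex_vmaj|exact He|].
  exists N; intros n Hn x i. specialize (HN n Hn (x, i)). simpl in HN.
  unfold vsol, vpart.
  replace (w i * Series (fun k : nat => viter k x i / w i) - sum_f_R0 (fun k : nat => viter k x i) n)
    with (w i * (Series (fun k : nat => viter k x i / w i) - sum_f_R0 (fun k : nat => viter k x i / w i) n)).
  - rewrite Rabs_mult, (Rabs_pos_eq (w i)) by (left; apply hw).
    apply Rmult_le_compat_l; [left; apply hw|lra].
  - rewrite Rmult_minus_distr_l. f_equal. rewrite scal_sum. apply sum_eq. intros k _.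
    field. apply Rgt_not_eq, hw.
Qed.

(** [L] is only known to respect finite combinations, so the equation is obtained as the limit of
    the one for partial sums, which holds with an index shift ([vpart_S]); the operator bound
    controls the error under the integral. *)
Lemma vsol_eq x i : vsol x i = g x i + vstep vsol x i.
Proof.
  apply cond_eq. intros eps He.
  pose proof (hw i) as Hwi.
  (* Chosen so that the two errors [w i * e] and [l * (w i * (beta * e))] add up to [eps / 2]. *)
  set (e := eps / (2 * w i * (1 + l * beta))).
  assert (Hlb : 0 <= l * beta) by (apply Rmult_le_pos; assumption).
  assert (He' : 0 < e).
  { apply Rdiv_lt_0_compat; [exact He|]. apply Rmult_lt_0_compat; lra. }
  destruct (vsol_approx e He') as [N HN].
  pose proof (HN (S N) ltac:(lia) x i) as H1.
  assert (H2 : Rabs (vstep vsol x i - vstep (vpart N) x i) <= l * (w i * (beta * e))).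
  { unfold vstep. pose proof (clamp_in l x hl).
    rewrite <- RInt_minus_c by (apply L_cont; [apply vpart_cfun || apply vsol_cfun]).
    apply Rle_trans with (clamp l x * (w i * (beta * e))).
    - apply RInt_abs_le; [|lra|].
      + apply cfun_minus; apply L_cont; [apply vsol_cfun|apply vpart_cfun].
      + intros t _.
        replace (L t (vsol t) i - L t (vpart N t) i) with (L t (fun j => vsol t j + (-1) * vpart N t j) i)
          by (rewrite L_lin; ring).
        apply L_bound. intros j. replace (vsol t j + -1 * vpart N t j) with (vsol t j - vpart N t j) by ring.
        apply HN; lia.
    - apply Rmult_le_compat_r; [|lra]. apply Rmult_le_pos; [lra|]. apply Rmult_le_pos; lra. }
  rewrite vpart_S in H1.
  replace (vsol x i - (g x i + vstep vsol x i))
    with ((vsol x i - (g x i + vstep (vpart N) x i)) - (vstep vsol x i - vstep (vpart N) x i)) by ring.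
  eapply Rle_lt_trans; [apply Rabs_triang|]. rewrite Rabs_Ropp.
  apply Rle_lt_trans with (w i * e + l * (w i * (beta * e))); [lra|].
  replace (w i * e + l * (w i * (beta * e))) with (eps / 2).
  - lra.
  - unfold e. field. split; lra.
Qed.

End Volterra.

Lemma volterra_exists (I : Type) (w : I -> R) (L : R -> (I -> R) -> I -> R) (beta l : R)
  (g : R -> I -> R) (G : R) :
  0 <= l -> 0 <= beta -> (forall i, 0 < w i) ->
  (forall x a b c i, L x (fun j => a j + c * b j) i = L x a i + c * L x b i) ->
  (forall x a phi, (forall i, Rabs (a i) <= w i * phi) ->
     forall i, Rabs (L x a i) <= w i * (beta * phi)) ->
  (forall f : R -> I -> R, (forall i, cfun (fun x => f x i)) ->
     forall i, cfun (fun x => L x (f x) i)) ->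
  0 <= G -> (forall i, cfun (fun x => g x i)) -> (forall x i, Rabs (g x i) <= w i * G) ->
  exists z : R -> I -> R, (forall i, cfun (fun x => z x i)) /\
    (forall x i, Rabs (z x i) <= w i * (G * exp (beta * l))) /\
    (forall x i, z x i = g x i + RInt (fun t => L t (z t) i) 0 (clamp l x)).
Proof.
  intros hl hb hw hlin hbd hc hG gc gb.
  exists (vsol I w L l g). split; [|split].
  - intros i. exact (vsol_cfun I w L beta l hl hb hw hbd hc g G hG gc gb i).
  - intros x i. exact (vsol_bound I w L beta l hl hb hw hbd hc g G hG gc gb x i).
  - intros x i. exact (vsol_eq I w L beta l hl hb hw hlin hbd hc g G hG gc gb x i).
Qed.

(** Using the equation repeatedly improves the bound to [w i * (C * (beta * x)^k / k!)] for every
    [k], which tends to 0. *)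
Lemma volterra_unique (I : Type) (w : I -> R) (L : R -> (I -> R) -> I -> R) (beta l : R)
  (f : R -> I -> R) (C : R) :
  0 <= l -> 0 <= beta -> (forall i, 0 < w i) ->
  (forall x a phi, (forall i, Rabs (a i) <= w i * phi) ->
     forall i, Rabs (L x a i) <= w i * (beta * phi)) ->
  (forall f : R -> I -> R, (forall i, cfun (fun x => f x i)) ->
     forall i, cfun (fun x => L x (f x) i)) ->
  0 <= C -> (forall i, cfun (fun x => f x i)) ->
  (forall x i, 0 <= x <= l -> Rabs (f x i) <= w i * C) ->
  (forall x i, 0 <= x <= l -> f x i = RInt (fun t => L t (f t) i) 0 x) ->
  forall x i, 0 <= x <= l -> f x i = 0.
Proof.
  intros hl hb hw hbd hc hC fc fb fe x i Hx.
  assert (H : forall k x i, 0 <= x <= l -> Rabs (f x i) <= w i * (C * ((beta * x) ^ k / INR (fact k)))).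
  { induction k as [|k IH]; intros y j Hy.
    - simpl. replace (w j * (C * (1 / 1))) with (w j * C) by field. apply fb, Hy.
    - rewrite fe by exact Hy.
      pose proof (vstep_bound I w L beta l hl hbd hc f C k hC fc IH y j) as H.
      unfold vstep in H. rewrite clamp_id in H by exact Hy. exact H. }
  assert (Hlim : is_lim_seq (fun k => w i * (C * ((beta * x) ^ k / INR (fact k)))) 0).
  { replace (Finite 0) with (Rbar_mult (w i * C) 0) by (simpl; f_equal; ring).
    apply is_lim_seq_ext with (fun k => (w i * C) * ((beta * x) ^ k / INR (fact k))); [intros; ring|].
    apply is_lim_seq_scal_l. apply (ex_series_lim_0 (fun k => (beta * x) ^ k / INR (fact k))).
    eexists; apply exp_series. }
  assert (Hle : Rbar_le (Rabs (f x i)) 0).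
  { apply (is_lim_seq_le (fun _ => Rabs (f x i)) _ _ _) with (3 := Hlim).
    - intros k; apply H, Hx.
    - apply is_lim_seq_const. }
  simpl in Hle. pose proof (Rabs_pos (f x i)).
  destruct (Req_dec (f x i) 0) as [E|E]; [exact E|]. apply Rabs_no_R0 in E. lra.
Qed.

(** * Families that are analytic in a parameter *)

(* The coefficients are constant outside [0,l], so that uniformity in [x] on [0,l]
   is uniformity on R. *)
Definition expansion (l lam0 r M : R) (a : nat -> R -> R) (F : R -> R -> R) : Prop :=
  (forall n, cfun (a n)) /\ (forall n x, a n (clamp l x) = a n x) /\
  (forall n x, Rabs (a n x) * r ^ n <= M) /\
  (forall x h, Rabs h < r -> is_series (fun n => a n x * h ^ n) (F x (lam0 + h))).

Definition analytic_at (l lam0 : R) (F : R -> R -> R) : Prop :=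
  exists r M a, 0 < r /\ expansion l lam0 r M a F.

Lemma expansion_mono l lam0 r M a F r' M' : 0 < r' <= r -> M <= M' ->
  expansion l lam0 r M a F -> expansion l lam0 r' M' a F.
Proof.
  intros Hr HM (H1 & H2 & H3 & H4). split; [exact H1|split; [exact H2|split]].
  - intros n x. apply Rle_trans with (Rabs (a n x) * r ^ n); [|specialize (H3 n x); lra].
    apply Rmult_le_compat_l; [apply Rabs_pos|]. apply pow_incr; lra.
  - intros x h Hh. apply H4; lra.
Qed.

Lemma expansion_M_pos l lam0 r M a F : 0 < r -> expansion l lam0 r M a F -> 0 <= M.
Proof.
  intros Hr (_ & _ & H3 & _). specialize (H3 O 0). simpl in H3.
  pose proof (Rabs_pos (a O 0)). lra.
Qed.

Lemma bound_CV_radius (a : nat -> R) r M h : 0 < r ->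
  (forall n, Rabs (a n) * r ^ n <= M) -> Rabs h < r -> Rbar_lt (Rabs h) (CV_radius a).
Proof.
  intros Hr Ha Hh. apply Rbar_lt_le_trans with r; [exact Hh|].
  apply (proj1 (CV_radius_bounded a)). exists M. intros n.
  rewrite Rabs_mult, (Rabs_pos_eq (r ^ n)) by (apply pow_le; lra). apply Ha.
Qed.

Lemma expansion_CV l lam0 r M a F x h : 0 < r -> expansion l lam0 r M a F -> Rabs h < r ->
  Rbar_lt (Rabs h) (CV_radius (fun n => a n x)).
Proof.
  intros Hr (_ & _ & H3 & _) Hh. apply (bound_CV_radius _ r M h Hr); [|exact Hh].
  intros n; apply H3.
Qed.

Lemma expansion_0 l lam0 r M a F x : 0 < r -> expansion l lam0 r M a F -> a O x = F x lam0.
Proof.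
  intros Hr (_ & _ & _ & H4).
  specialize (H4 x 0). rewrite Rabs_R0, Rplus_0_r in H4. specialize (H4 Hr).
  pose proof (proj2 (is_pseries_R _ _ _) H4) as H.
  pose proof (PSeries_0 (fun n => a n x)) as E.
  rewrite <- E. apply is_pseries_unique, H.
Qed.

Lemma analytic_ext_loc l lam0 F G : analytic_at l lam0 F ->
  (exists d, 0 < d /\ forall x h, Rabs h < d -> F x (lam0 + h) = G x (lam0 + h)) ->
  analytic_at l lam0 G.
Proof.
  intros (r & M & a & Hr & HF) (d & Hd & HE).
  exists (Rmin r d), M, a. split; [apply Rmin_pos; assumption|].
  apply (expansion_mono _ _ _ _ _ _ (Rmin r d) M) in HF;
    [|split; [apply Rmin_pos; assumption|apply Rmin_l]|lra].
  destruct HF as (H1 & H2 & H3 & H4). split; [exact H1|split; [exact H2|split; [exact H3|]]].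
  intros x h Hh. rewrite <- HE; [apply H4, Hh|].
  eapply Rlt_le_trans; [exact Hh|apply Rmin_r].
Qed.

Lemma analytic_ext l lam0 F G : (forall x lam, F x lam = G x lam) ->
  analytic_at l lam0 F -> analytic_at l lam0 G.
Proof.
  intros H HF. apply (analytic_ext_loc _ _ F); [exact HF|].
  exists 1; split; [lra|]. intros; apply H.
Qed.

Lemma is_series_finite (a : nat -> R) N s : (forall n, (N < n)%nat -> a n = 0) ->
  sum_f_R0 a N = s -> is_series a s.
Proof.
  intros H <-. apply is_series_Reals. intros eps He. exists N. intros n Hn.
  assert (E : sum_f_R0 a n = sum_f_R0 a N).
  { induction n as [|n IH].
    - replace N with O by lia. reflexivity.
    - destruct (Nat.eq_dec N (S n)) as [E|E]; [rewrite <- E; reflexivity|].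
      simpl. rewrite IH by lia. rewrite H by lia. ring. }
  rewrite E. unfold Rdist. rewrite Rminus_diag, Rabs_R0. exact He.
Qed.

Lemma cfun_clamp_bounded l phi : 0 <= l -> cfun phi -> (forall x, phi (clamp l x) = phi x) ->
  exists M, forall x, Rabs (phi x) <= M.
Proof.
  intros Hl Hc Hcl.
  destruct (continuity_ab_maj (fun x => Rabs (phi x)) 0 l Hl) as (m & Hm & _).
  - intros c _. apply (continuity_pt_comp phi Rabs); [apply continuity_pt_filterlim, Hc|apply Rcontinuity_abs].
  - exists (Rabs (phi m)). intros x. rewrite <- Hcl. apply Hm, clamp_in, Hl.
Qed.

(** Compactness of [0,l] makes pointwise nonvanishing uniform; this is what gives reciprocals a
    radius independent of [x]. *)
Lemma cfun_clamp_away l phi : 0 <= l -> cfun phi -> (forall x, phi (clamp l x) = phi x) ->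
  (forall x, phi x <> 0) -> exists d, 0 < d /\ forall x, d <= Rabs (phi x).
Proof.
  intros Hl Hc Hcl H0.
  destruct (continuity_ab_min (fun x => Rabs (phi x)) 0 l Hl) as (m & Hm & _).
  - intros c _. apply (continuity_pt_comp phi Rabs); [apply continuity_pt_filterlim, Hc|apply Rcontinuity_abs].
  - exists (Rabs (phi m)). split; [apply Rabs_pos_lt, H0|].
    intros x. rewrite <- (Hcl x). apply Hm, clamp_in, Hl.
Qed.

Lemma analytic_fun l lam0 phi : 0 <= l -> cfun phi -> (forall x, phi (clamp l x) = phi x) ->
  analytic_at l lam0 (fun x _ => phi x).
Proof.
  intros Hl Hc Hcl. destruct (cfun_clamp_bounded l phi Hl Hc Hcl) as [M HM].
  exists 1, M, (fun n x => match n with O => phi x | S _ => 0 end).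
  split; [lra|split; [|split; [|split]]].
  - intros [|n]; [exact Hc|apply cfun_const].
  - intros [|n] x; [apply Hcl|reflexivity].
  - intros [|n] x; [simpl; rewrite Rmult_1_r; apply HM|].
    rewrite Rabs_R0, Rmult_0_l. apply Rle_trans with (2 := HM 0). apply Rabs_pos.
  - intros x h _.
    apply (is_series_finite _ 0); [intros [|n] Hn; [lia|ring]|simpl; ring].
Qed.

Lemma analytic_const l lam0 c : 0 <= l -> analytic_at l lam0 (fun _ _ => c).
Proof. intros Hl; apply (analytic_fun l lam0 (fun _ => c) Hl); [apply cfun_const|reflexivity]. Qed.

Lemma analytic_param l lam0 : analytic_at l lam0 (fun _ lam => lam).
Proof.
  exists 1, (Rabs lam0 + 1), (fun n _ => match n with O => lam0 | 1%nat => 1 | _ => 0 end).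
  split; [lra|split; [|split; [|split]]].
  - intros n; apply cfun_const.
  - reflexivity.
  - intros [|[|n]] _; rewrite pow1, Rmult_1_r; pose proof (Rabs_pos lam0);
      rewrite ?Rabs_R1, ?Rabs_R0; lra.
  - intros _ h _.
    apply (is_series_finite _ 1); [intros [|[|n]] Hn; [lia|lia|ring]|simpl; ring].
Qed.

Lemma analytic_plus l lam0 F G : analytic_at l lam0 F -> analytic_at l lam0 G ->
  analytic_at l lam0 (fun x lam => F x lam + G x lam).
Proof.
  intros (r & M & a & Hr & HF) (r' & M' & b & Hr' & HG).
  assert (Hm : 0 < Rmin r r') by (apply Rmin_pos; assumption).
  apply (expansion_mono _ _ _ _ _ _ (Rmin r r') M) in HF; [|split; [exact Hm|apply Rmin_l]|lra].
  apply (expansion_mono _ _ _ _ _ _ (Rmin r r') M') in HG; [|split; [exact Hm|apply Rmin_r]|lra].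
  destruct HF as (H1 & H2 & H3 & H4), HG as (G1 & G2 & G3 & G4).
  exists (Rmin r r'), (M + M'), (fun n x => a n x + b n x).
  split; [exact Hm|split; [|split; [|split]]].
  - intros n; apply cfun_plus; auto.
  - intros n x; rewrite H2, G2; reflexivity.
  - intros n x. specialize (H3 n x). specialize (G3 n x).
    pose proof (Rabs_triang (a n x) (b n x)).
    assert (0 <= Rmin r r' ^ n) by (apply pow_le; lra). nra.
  - intros x h Hh.
    apply (is_series_ext (K := R_AbsRing) (V := R_NormedModule)
             (fun n => plus (a n x * h ^ n) (b n x * h ^ n))).
    + intros n. unfold plus; simpl. ring.
    + apply (is_series_plus (K := R_AbsRing) (V := R_NormedModule) _ _ _ _ (H4 x h Hh) (G4 x h Hh)).
Qed.

Lemma sum_const_le (f : nat -> R) c n : (forall k, (k <= n)%nat -> f k <= c) ->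
  sum_f_R0 f n <= INR (S n) * c.
Proof.
  intros H; induction n as [|n IH].
  - simpl. specialize (H O (le_n _)). lra.
  - rewrite S_INR. simpl sum_f_R0. specialize (H (S n) (le_n _)) as H1.
    assert (sum_f_R0 f n <= INR (S n) * c) by (apply IH; intros; apply H; lia). lra.
Qed.

Lemma INR_S_le_pow2 n : INR (S n) <= 2 ^ n.
Proof.
  induction n as [|n IH]; [simpl; lra|]. rewrite S_INR. simpl pow.
  assert (1 <= 2 ^ n) by (apply pow_R1_Rle; lra). lra.
Qed.

Lemma sum_abs_le (f : nat -> R) n : Rabs (sum_f_R0 f n) <= sum_f_R0 (fun k => Rabs (f k)) n.
Proof.
  induction n as [|n IH]; simpl; [lra|].
  eapply Rle_trans; [apply Rabs_triang|]. lra.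
Qed.

(** The Cauchy product has coefficients of size at most [(n + 1) * M * M' / q^n]. Since
    [n + 1 <= 2^n], halving the radius absorbs the extra factor. *)
Lemma analytic_mult l lam0 F G : analytic_at l lam0 F -> analytic_at l lam0 G ->
  analytic_at l lam0 (fun x lam => F x lam * G x lam).
Proof.
  intros (r & M & a & Hr & HF) (r' & M' & b & Hr' & HG).
  assert (Hm : 0 < Rmin r r') by (apply Rmin_pos; assumption).
  apply (expansion_mono _ _ _ _ _ _ (Rmin r r') M) in HF; [|split; [exact Hm|apply Rmin_l]|lra].
  apply (expansion_mono _ _ _ _ _ _ (Rmin r r') M') in HG; [|split; [exact Hm|apply Rmin_r]|lra].
  set (q := Rmin r r') in *.
  pose proof (expansion_M_pos _ _ _ _ _ _ Hm HF) as HM.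
  pose proof (expansion_M_pos _ _ _ _ _ _ Hm HG) as HM'.
  pose proof (fun x h => expansion_CV l lam0 q M a F x h Hm HF) as CF.
  pose proof (fun x h => expansion_CV l lam0 q M' b G x h Hm HG) as CG.
  destruct HF as (H1 & H2 & H3 & H4), HG as (G1 & G2 & G3 & G4).
  exists (q / 2), (M * M'), (fun n x => PS_mult (fun k => a k x) (fun k => b k x) n).
  split; [lra|split; [|split; [|split]]].
  - intros n. unfold PS_mult. apply (cfun_sum (fun k x => a k x * b (n - k)%nat x)).
    intros k; apply cfun_mult; auto.
  - intros n x. unfold PS_mult. apply sum_eq. intros k _. rewrite H2, G2; reflexivity.
  - intros n x. unfold PS_mult, Rdiv. rewrite Rpow_mult_distr, <- Rmult_assoc.
    assert (Hq : 0 <= q ^ n) by (apply pow_le; lra).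
    assert (H2n : 0 < 2 ^ n) by (apply pow_lt; lra).
    rewrite pow_inv.
    apply Rmult_le_reg_r with (2 ^ n); [exact H2n|].
    rewrite Rmult_assoc, Rinv_l, Rmult_1_r by lra.
    apply Rle_trans with (INR (S n) * (M * M')).
    + eapply Rle_trans; [apply Rmult_le_compat_r; [exact Hq|apply sum_abs_le]|].
      rewrite Rmult_comm, scal_sum. apply sum_const_le. intros k Hk.
      rewrite Rabs_mult.
      replace (q ^ n) with (q ^ k * q ^ (n - k)) by (rewrite <- pow_add; f_equal; lia).
      replace (Rabs (a k x) * Rabs (b (n - k)%nat x) * (q ^ k * q ^ (n - k)))
        with ((Rabs (a k x) * q ^ k) * (Rabs (b (n - k)%nat x) * q ^ (n - k))) by ring.
      apply Rmult_le_compat; [| |apply H3|apply G3];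
        (apply Rmult_le_pos; [apply Rabs_pos|apply pow_le; lra]).
    + rewrite Rmult_comm. apply Rmult_le_compat_l; [apply Rmult_le_pos; assumption|apply INR_S_le_pow2].
  - intros x h Hh. assert (Hh' : Rabs h < q) by lra.
    apply (proj1 (is_pseries_R _ _ _)). apply is_pseries_mult.
    + apply is_pseries_R, H4, Hh'.
    + apply is_pseries_R, G4, Hh'.
    + apply CF, Hh'.
    + apply CG, Hh'.
Qed.

(** Coefficients of the reciprocal series, from the requirement that the Cauchy product with [a] be
    1. The recursion calls all smaller indices, hence the fuel. *)
Fixpoint inv_coef_fuel (a : nat -> R) (fuel n : nat) : R :=
  match fuel, n with
  | O, _ => 0
  | S _, O => / a O
  | S f, S m => - / a O * sum_f_R0 (fun k => a (S k) * inv_coef_fuel a f (m - k)%nat) m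
  end.

Definition inv_coef (a : nat -> R) (n : nat) : R := inv_coef_fuel a (S n) n.

Lemma inv_coef_fuel_eq a f : forall n, (n < f)%nat -> inv_coef_fuel a f n = inv_coef a n.
Proof.
  induction f as [f IH] using lt_wf_ind. intros n Hn.
  destruct f as [|f]; [lia|]. destruct n as [|m]; [reflexivity|].
  unfold inv_coef. simpl. f_equal. apply sum_eq. intros k Hk. f_equal.
  rewrite (IH f) by lia. symmetry. apply (IH (S m)); lia.
Qed.

Lemma inv_coef_S a m : inv_coef a (S m) =
  - / a O * sum_f_R0 (fun k => a (S k) * inv_coef a (m - k)%nat) m.
Proof.
  change (inv_coef a (S m)) with
    (- / a O * sum_f_R0 (fun k => a (S k) * inv_coef_fuel a (S m) (m - k)%nat) m).
  f_equal. apply sum_eq. intros k Hk. f_equal.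
  apply inv_coef_fuel_eq; lia.
Qed.

Lemma inv_coef_mult a : a O <> 0 ->
  forall n, PS_mult a (inv_coef a) n = match n with O => 1 | S _ => 0 end.
Proof.
  intros H0 [|m]; unfold PS_mult.
  - simpl. unfold inv_coef; simpl. field; exact H0.
  - rewrite decomp_sum by lia. 
    rewrite Nat.sub_0_r, inv_coef_S. cbn [pred Nat.sub]. field; exact H0.
Qed.

Lemma geom_sum_le q n : 0 <= q < 1 -> sum_f_R0 (fun k => q ^ S k) n <= q / (1 - q).
Proof.
  intros Hq.
  assert (E : sum_f_R0 (fun k => q ^ S k) n = q / (1 - q) * (1 - q ^ S n)).
  { induction n as [|n IH]; [simpl; field; lra|].
    change (sum_f_R0 (fun k => q ^ S k) (S n)) with (sum_f_R0 (fun k => q ^ S k) n + q ^ S (S n)).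
    rewrite IH. simpl. field; lra. }
  rewrite E. assert (0 <= q ^ S n) by (apply pow_le; lra).
  assert (0 <= q / (1 - q)) by (apply Rmult_le_pos; [lra|left; apply Rinv_0_lt_compat; lra]).
  nra.
Qed.

(** Induction along the recursion: the scaled terms are at most [/ d * M * / d] times a geometric
    sum of ratio [q = d / (d + M)]. This ratio is the one with [q / (1 - q) = d / M], which closes
    the induction with the constant [/ d]. *)
Lemma inv_coef_bound a r M d : 0 < r -> 0 < M -> 0 < d <= Rabs (a O) ->
  (forall n, Rabs (a n) * r ^ n <= M) ->
  forall n, Rabs (inv_coef a n) * (r * (d / (d + M))) ^ n <= / d.
Proof.
  intros Hr HM Hd Ha.
  assert (Ha0 : a O <> 0) by (intros E; rewrite E, Rabs_R0 in Hd; lra).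
  assert (Hid : Rabs (/ a O) <= / d).
  { rewrite Rabs_inv. apply Rinv_le_contravar; lra. }
  set (q := d / (d + M)).
  assert (Hq : 0 < q < 1).
  { unfold q. split; [apply Rdiv_lt_0_compat; lra|].
    apply Rmult_lt_reg_r with (d + M); [lra|]. unfold Rdiv.
    rewrite Rmult_assoc, Rinv_l by lra. lra. }
  assert (Hq2 : q / (1 - q) = d / M) by (unfold q; field; split; lra).
  intros n. induction n as [n IH] using lt_wf_ind.
  destruct n as [|m].
  - unfold inv_coef; simpl. rewrite Rmult_1_r. exact Hid.
  - rewrite inv_coef_S, Rabs_mult, Rabs_Ropp, Rmult_assoc.
    replace (/ d) with (/ d * 1) by ring.
    apply Rmult_le_compat; [apply Rabs_pos| |exact Hid|].
    { apply Rmult_le_pos; [apply Rabs_pos|apply pow_le; nra]. }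
    assert (Hrq : 0 <= (r * q) ^ S m) by (apply pow_le; nra).
    eapply Rle_trans; [apply Rmult_le_compat_r; [exact Hrq|apply sum_abs_le]|].
    rewrite Rmult_comm, scal_sum.
    apply Rle_trans with (sum_f_R0 (fun k => q ^ S k * (M * / d)) m).
    + apply sum_Rle. intros k Hk. rewrite Rabs_mult.
      replace ((r * q) ^ S m) with (r ^ S k * q ^ S k * (r * q) ^ (m - k)).
      * replace (Rabs (a (S k)) * Rabs (inv_coef a (m - k)) * (r ^ S k * q ^ S k * (r * q) ^ (m - k)))
          with (q ^ S k * ((Rabs (a (S k)) * r ^ S k) * (Rabs (inv_coef a (m - k)) * (r * q) ^ (m - k)))) by ring.
        apply Rmult_le_compat_l; [apply pow_le; lra|].
        apply Rmult_le_compat; [| |apply Ha|apply IH; lia].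
        -- apply Rmult_le_pos; [apply Rabs_pos|apply pow_le; lra].
        -- apply Rmult_le_pos; [apply Rabs_pos|apply pow_le; nra].
      * rewrite <- Rpow_mult_distr, <- pow_add. f_equal; lia.
    + rewrite <- scal_sum. pose proof (geom_sum_le q m ltac:(lra)) as Hg. rewrite Hq2 in Hg.
      apply Rle_trans with (M * / d * (d / M)).
      * apply Rmult_le_compat_l; [|exact Hg]. apply Rmult_le_pos; [lra|left; apply Rinv_0_lt_compat; lra].
      * right; field; split; lra.
Qed.

Lemma cfun_inv_coef (a : nat -> R -> R) : (forall n, cfun (a n)) -> (forall x, a O x <> 0) ->
  forall n, cfun (fun x => inv_coef (fun k => a k x) n).
Proof.
  intros Ha H0 n. unfold inv_coef. generalize (S n) as f. intros f; revert n.
  induction f as [|f IH]; intros n; simpl; [apply cfun_const|].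
  destruct n as [|m]; [apply cfun_inv; auto|].
  apply cfun_mult.
  - intros x. apply (continuous_opp (V := R_NormedModule)). apply (cfun_inv (a O)); auto.
  - apply (cfun_sum (fun k x => a (S k) x * inv_coef_fuel (fun k => a k x) f (m - k)%nat)).
    intros k; apply cfun_mult; auto.
Qed.

Lemma analytic_inv l lam0 F : 0 <= l -> analytic_at l lam0 F -> (forall x, F x lam0 <> 0) ->
  analytic_at l lam0 (fun x lam => / F x lam).
Proof.
  intros Hl (r & M & a & Hr & HF) H0.
  pose proof (fun x => expansion_0 _ _ _ _ _ _ x Hr HF) as E0.
  pose proof (expansion_M_pos _ _ _ _ _ _ Hr HF) as HM.
  pose proof (fun x h => expansion_CV l lam0 r M a F x h Hr HF) as CF.
  destruct HF as (H1 & H2 & H3 & H4).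
  destruct (cfun_clamp_away l (a O) Hl (H1 O) (H2 O)) as (d & Hd & Had).
  { intros x; rewrite E0; apply H0. }
  assert (Ha0 : forall x, a O x <> 0) by (intros x; rewrite E0; apply H0).
  (* [inv_coef_bound] asks for a strictly positive bound, whereas [M] is only recorded as
     nonnegative. *)
  set (q := d / (d + (M + 1))).
  assert (Hq : 0 < q < 1).
  { unfold q. split; [apply Rdiv_lt_0_compat; lra|].
    apply Rmult_lt_reg_r with (d + (M + 1)); [lra|]. unfold Rdiv.
    rewrite Rmult_assoc, Rinv_l by lra. lra. }
  assert (Hb : forall n x, Rabs (inv_coef (fun k => a k x) n) * (r * q) ^ n <= / d).
  { intros n x. apply (inv_coef_bound (fun k => a k x) r (M + 1) d); [lra|lra|split; [lra|apply Had]|].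
    intros k; specialize (H3 k x); lra. }
  assert (Hrq : 0 < r * q < r) by nra.
  exists (r * q), (/ d), (fun n x => inv_coef (fun k => a k x) n).
  split; [apply Hrq|split; [|split; [|split]]].
  - apply cfun_inv_coef; assumption.
  - intros n x. f_equal. apply functional_extensionality; intros k; apply H2.
  - exact Hb.
  - intros x h Hh.
    assert (CB : Rbar_lt (Rabs h) (CV_radius (inv_coef (fun k => a k x)))).
    { apply (bound_CV_radius _ (r * q) (/ d)); [lra|intros n; apply Hb|exact Hh]. }
    assert (Hh' : Rabs h < r) by lra.
    pose proof (PSeries_correct _ _ (CV_radius_inside _ _ CB)) as HB.
    replace (/ F x (lam0 + h)) with (PSeries (inv_coef (fun k => a k x)) h).
    + apply is_pseries_R, HB.
    + pose proof (PSeries_mult (fun k => a k x) _ h (CF x h Hh') CB) as Hm.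
      rewrite (PSeries_ext _ (fun n => match n with O => 1 | S _ => 0 end)) in Hm
        by (intros n; apply inv_coef_mult, Ha0).
      rewrite (is_pseries_unique (fun k => a k x) h (F x (lam0 + h))) in Hm
        by (apply is_pseries_R, H4, Hh').
      assert (E1 : PSeries (fun n => match n with O => 1 | S _ => 0 end) h = 1).
      { apply is_pseries_unique, is_pseries_R.
        apply (is_series_finite _ 0); [intros [|n] Hn; [lia|ring]|simpl; ring]. }
      rewrite E1 in Hm.
      (* [F] does not vanish at [lam0 + h] either, since its product with the reciprocal series is
         1. *)
      assert (F x (lam0 + h) <> 0) by (intros E; rewrite E in Hm; lra).
      apply Rmult_eq_reg_l with (F x (lam0 + h)); [|assumption].
      rewrite <- Hm. field. assumption.
Qed.

Lemma analytic_opp l lam0 F : 0 <= l -> analytic_at l lam0 F ->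
  analytic_at l lam0 (fun x lam => - F x lam).
Proof.
  intros Hl HF. apply (analytic_ext l lam0 (fun x lam => (-1) * F x lam)); [intros; ring|].
  apply analytic_mult; [apply analytic_const, Hl|exact HF].
Qed.

Lemma analytic_minus l lam0 F G : 0 <= l -> analytic_at l lam0 F -> analytic_at l lam0 G ->
  analytic_at l lam0 (fun x lam => F x lam - G x lam).
Proof.
  intros Hl HF HG. apply (analytic_plus l lam0 F (fun x lam => - G x lam)); [exact HF|].
  apply analytic_opp; assumption.
Qed.

Lemma analytic_div l lam0 F G : 0 <= l -> analytic_at l lam0 F -> analytic_at l lam0 G ->
  (forall x, G x lam0 <> 0) -> analytic_at l lam0 (fun x lam => F x lam / G x lam).
Proof.
  intros Hl HF HG H0. apply (analytic_mult l lam0 F (fun x lam => / G x lam)); [exact HF|].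
  apply analytic_inv; assumption.
Qed.

Lemma analytic_pow l lam0 F n : 0 <= l -> analytic_at l lam0 F ->
  analytic_at l lam0 (fun x lam => F x lam ^ n).
Proof.
  intros Hl HF. induction n as [|n IH]; simpl.
  - apply analytic_const, Hl.
  - apply (analytic_mult l lam0 F (fun x lam => F x lam ^ n)); assumption.
Qed.

(** * Linear systems with analytic coefficients *)

(** Taking the smallest radius and the largest bound works because only finitely many families are
    involved; the estimates for systems need common constants. *)
Lemma analytic_family l lam0 (F : nat -> R -> R -> R) D :
  (forall i, (i <= D)%nat -> analytic_at l lam0 (F i)) ->
  exists r M, 0 < r /\ 0 <= M /\
    forall i, (i <= D)%nat -> exists a, expansion l lam0 r M a (F i).
Proof.
  induction D as [|D IH]; intros H.
  - destruct (H O (le_n _)) as (r & M & a & Hr & Ha). exists r, M.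
    split; [exact Hr|split; [eapply expansion_M_pos; eauto|]].
    intros i Hi. replace i with O by lia. exists a; exact Ha.
  - destruct IH as (r & M & Hr & HM & IH); [intros; apply H; lia|].
    destruct (H (S D) (le_n _)) as (r' & M' & a & Hr' & Ha).
    exists (Rmin r r'), (Rmax M M').
    assert (Hm : 0 < Rmin r r') by (apply Rmin_pos; assumption).
    split; [exact Hm|split; [apply Rle_trans with M; [exact HM|apply Rmax_l]|]].
    intros i Hi. destruct (Nat.eq_dec i (S D)) as [->|E].
    + exists a. apply (expansion_mono _ _ _ _ _ _ _ _) with (3 := Ha);
        [split; [exact Hm|apply Rmin_r]|apply Rmax_r].
    + destruct (IH i) as [b Hb]; [lia|]. exists b.
      apply (expansion_mono _ _ _ _ _ _ _ _) with (3 := Hb);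
        [split; [exact Hm|apply Rmin_l]|apply Rmax_l].
Qed.

Lemma analytic_family2 l lam0 (F : nat -> nat -> R -> R -> R) D E :
  (forall i j, (i <= D)%nat -> (j <= E)%nat -> analytic_at l lam0 (F i j)) ->
  exists r M, 0 < r /\ 0 <= M /\
    forall i j, (i <= D)%nat -> (j <= E)%nat -> exists a, expansion l lam0 r M a (F i j).
Proof.
  intros H. induction D as [|D IH].
  - destruct (analytic_family l lam0 (F O) E) as (r & M & Hr & HM & Ha); [intros; apply H; lia|].
    exists r, M. split; [exact Hr|split; [exact HM|]].
    intros i j Hi Hj. replace i with O by lia. apply Ha, Hj.
  - destruct IH as (r & M & Hr & HM & IH); [intros; apply H; lia|].
    destruct (analytic_family l lam0 (F (S D)) E) as (r' & M' & Hr' & HM' & Ha); [intros; apply H; lia|].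
    exists (Rmin r r'), (Rmax M M').
    assert (Hm : 0 < Rmin r r') by (apply Rmin_pos; assumption).
    split; [exact Hm|split; [apply Rle_trans with M; [exact HM|apply Rmax_l]|]].
    intros i j Hi Hj. destruct (Nat.eq_dec i (S D)) as [->|Ne].
    + destruct (Ha j Hj) as [b Hb]. exists b.
      apply (expansion_mono _ _ _ _ _ _ _ _) with (3 := Hb);
        [split; [exact Hm|apply Rmin_r]|apply Rmax_r].
    + destruct (IH i j) as [b Hb]; [lia|exact Hj|]. exists b.
      apply (expansion_mono _ _ _ _ _ _ _ _) with (3 := Hb);
        [split; [exact Hm|apply Rmin_l]|apply Rmax_l].
Qed.

Lemma is_series_sum (f : nat -> nat -> R) (s : nat -> R) D :
  (forall j, (j <= D)%nat -> is_series (f j) (s j)) ->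
  is_series (fun n => sum_f_R0 (fun j => f j n) D) (sum_f_R0 s D).
Proof.
  induction D as [|D IH]; intros H; simpl; [apply H; lia|].
  apply (is_series_plus (K := R_AbsRing) (V := R_NormedModule)
    (fun n => sum_f_R0 (fun j => f j n) D) (f (S D)) (sum_f_R0 s D) (s (S D))).
  - apply IH; intros; apply H; lia.
  - apply H; lia.
Qed.

(** The Volterra lemma has no range condition on its indices, so the arrays of expansions have to be
    total; the default fills them outside the range. *)
Lemma choose2 {A : Type} (D E : nat) (P : nat -> nat -> A -> Prop) (dflt : A) :
  (forall i j, (i <= D)%nat -> (j <= E)%nat -> exists a, P i j a) ->
  exists f : nat -> nat -> A, (forall i j, (i <= D)%nat -> (j <= E)%nat -> P i j (f i j)) /\
    (forall i j, ~ ((i <= D)%nat /\ (j <= E)%nat) -> f i j = dflt).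
Proof.
  intros H.
  exists (fun i j => match excluded_middle_informative ((i <= D)%nat /\ (j <= E)%nat) with
    | left H' => proj1_sig (constructive_indefinite_description _ (H i j (proj1 H') (proj2 H')))
    | right _ => dflt end).
  split; intros i j; [intros Hi Hj|intros Hn]; destruct excluded_middle_informative as [H'|H'].
  - apply (proj2_sig (constructive_indefinite_description _ (H i j (proj1 H') (proj2 H')))).
  - tauto.
  - tauto.
  - reflexivity.
Qed.

(** * The linear system for all power series coefficients at once *)

Section CoefficientSystem.

Variables (l r M : R) (D : nat) (a : nat -> nat -> nat -> R -> R).
Hypothesis hr : 0 < r.
Hypothesis hM : 0 <= M.
Hypothesis a_cont : forall i j n, cfun (a i j n).
Hypothesis a_bound : forall i j n x, Rabs (a i j n x) * r ^ n <= M.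

(** Index pairs are (power of the parameter, component). Coefficients of this size give a series
    that converges for parameters below [r / 2]; the lost factor 2 is what makes [coper] bounded. *)
Definition cweight (p : nat * nat) : R := (2 / r) ^ fst p.

(** Coefficient of the product of the matrix with the unknown vector: a convolution in the power, a
    sum over the components [j]. *)
Definition coper (x : R) (y : nat * nat -> R) (p : nat * nat) : R :=
  sum_f_R0 (fun j => sum_f_R0 (fun k => a (snd p) j k x * y ((fst p - k)%nat, j)) (fst p)) D.

Lemma cweight_pos p : 0 < cweight p.
Proof. apply pow_lt, Rdiv_lt_0_compat; lra. Qed.

Lemma coper_lin x y z c p : coper x (fun q => y q + c * z q) p = coper x y p + c * coper x z p.
Proof.
  unfold coper. rewrite scal_sum, <- sum_plus. apply sum_eq. intros j _.
  rewrite (Rmult_comm _ c), scal_sum, <- sum_plus. apply sum_eq. intros k _. ring.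
Qed.

(** Term [k] of the convolution is at most [M * (/ r)^k * (2 / r)^(n - k) * phi = (/ 2)^k * M * (2 /
    r)^n * phi]. The powers of [/ 2] sum to at most 2, for each of the [D + 1] components. *)
Lemma coper_bound x y phi : (forall p, Rabs (y p) <= cweight p * phi) ->
  forall p, Rabs (coper x y p) <= cweight p * (INR (S D) * (2 * M) * phi).
Proof.
  intros Hy [n i]. unfold coper; simpl fst; simpl snd.
  assert (Hphi : 0 <= phi).
  { specialize (Hy (O, O)). pose proof (Rabs_pos (y (O, O))). unfold cweight in Hy; simpl in Hy. lra. }
  eapply Rle_trans; [apply sum_abs_le|].
  replace (cweight (n, i) * (INR (S D) * (2 * M) * phi))
    with (INR (S D) * (cweight (n, i) * (2 * M) * phi)) by ring.
  apply sum_const_le. intros j _.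
  eapply Rle_trans; [apply sum_abs_le|].
  apply Rle_trans with (sum_f_R0 (fun k => (/ 2) ^ k * (cweight (n, i) * M * phi)) n).
  - apply sum_Rle. intros k Hk. rewrite Rabs_mult.
    replace ((/ 2) ^ k * (cweight (n, i) * M * phi))
      with ((M * (/ r) ^ k) * (cweight ((n - k)%nat, j) * phi)).
    + apply Rmult_le_compat; [apply Rabs_pos|apply Rabs_pos| |apply Hy].
      specialize (a_bound i j k x). assert (Hrk : 0 < r ^ k) by (apply pow_lt, hr).
      apply Rmult_le_reg_r with (r ^ k); [exact Hrk|].
      rewrite Rmult_assoc, <- Rpow_mult_distr, Rinv_l, pow1 by lra. lra.
    + unfold cweight; simpl fst.
      replace ((2 / r) ^ n) with ((2 / r) ^ k * (2 / r) ^ (n - k)) by (rewrite <- pow_add; f_equal; lia).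
      replace ((/ r) ^ k) with ((/ 2) ^ k * (2 / r) ^ k).
      * ring.
      * rewrite <- Rpow_mult_distr. f_equal. field; lra.
  - rewrite <- scal_sum. rewrite Rmult_comm.
    replace (cweight (n, i) * (2 * M) * phi) with (2 * (cweight (n, i) * M * phi)) by ring.
    apply Rmult_le_compat_r.
    + apply Rmult_le_pos; [|exact Hphi]. apply Rmult_le_pos; [left; apply cweight_pos|exact hM].
    + destruct n as [|n]; [simpl; lra|]. rewrite decomp_sum by lia. simpl pred.
      pose proof (geom_sum_le (/ 2) n ltac:(lra)) as Hg. simpl pow at 1. lra.
Qed.

Lemma coper_cont (f : R -> nat * nat -> R) : (forall p, cfun (fun x => f x p)) ->
  forall p, cfun (fun x => coper x (f x) p).
Proof.
  intros Hf p. unfold coper.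
  apply (cfun_sum (fun j x => sum_f_R0 (fun k => a (snd p) j k x * f x ((fst p - k)%nat, j)) (fst p))).
  intros j. apply (cfun_sum (fun k x => a (snd p) j k x * f x ((fst p - k)%nat, j))).
  intros k. apply cfun_mult; auto.
Qed.

End CoefficientSystem.

Definition linear_solution (l : R) (D : nat) (B : nat -> nat -> R -> R) (g : nat -> R -> R)
  (z : nat -> R -> R) : Prop :=
  forall x i, (i <= D)%nat ->
    z i x = g i x + RInt (fun t => sum_f_R0 (fun j => B i j t * z j t) D) 0 (clamp l x).

(** The Volterra solution [z] supplies the coefficients, and its weighted bound makes the sum [Z]
    analytic. That [Z] solves the system for each fixed [h] follows by termwise integration and
    Cauchy products. *)
Theorem analytic_linear_system l lam0 D (B : nat -> nat -> R -> R -> R) (g : nat -> R -> R -> R) :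
  0 <= l ->
  (forall i j, (i <= D)%nat -> (j <= D)%nat -> analytic_at l lam0 (B i j)) ->
  (forall i, (i <= D)%nat -> analytic_at l lam0 (g i)) ->
  exists Z : nat -> R -> R -> R, (forall i, (i <= D)%nat -> analytic_at l lam0 (Z i)) /\
    exists d, 0 < d /\ forall h, Rabs h < d ->
      (forall i, (i <= D)%nat -> cfun (fun x => Z i x (lam0 + h))) /\
      linear_solution l D (fun i j x => B i j x (lam0 + h)) (fun i x => g i x (lam0 + h))
        (fun i x => Z i x (lam0 + h)).
Proof.
  intros Hl HB Hg.
  destruct (analytic_family2 l lam0 B D D HB) as (rB & MB & HrB & HMB & HaB).
  destruct (analytic_family l lam0 g D Hg) as (rg & Mg & Hrg & HMg & Hag).
  set (r := Rmin rB rg). assert (Hr : 0 < r) by (apply Rmin_pos; assumption).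
  set (M := Rmax MB Mg). assert (HM : 0 <= M) by (apply Rle_trans with MB; [exact HMB|apply Rmax_l]).
  destruct (choose2 D D (fun i j a => expansion l lam0 r M a (B i j)) (fun _ _ => 0)) as (a & Ha & Ha0).
  { intros i j Hi Hj. destruct (HaB i j Hi Hj) as [b Hb]. exists b.
    apply (expansion_mono _ _ _ _ _ _ _ _) with (3 := Hb);
      [split; [exact Hr|apply Rmin_l]|apply Rmax_l]. }
  destruct (choose2 D D (fun i _ a => expansion l lam0 r M a (g i)) (fun _ _ => 0)) as (c' & Hc' & Hc0').
  { intros i j Hi Hj. destruct (Hag i Hi) as [b Hb]. exists b.
    apply (expansion_mono _ _ _ _ _ _ _ _) with (3 := Hb);
      [split; [exact Hr|apply Rmin_r]|apply Rmax_r]. }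
  (* [choose2] was applied with a dummy second index. *)
  set (c := fun i => c' i O).
  assert (Hc : forall i, (i <= D)%nat -> expansion l lam0 r M (c i) (g i)) by (intros; apply Hc'; lia).
  assert (Hc0 : forall i, ~ (i <= D)%nat -> c i = (fun _ _ => 0)) by (intros; apply Hc0'; lia).
  clearbody c. clear c' Hc' Hc0'.
  assert (a_cont : forall i j n, cfun (a i j n)).
  { intros i j n. destruct (excluded_middle_informative ((i <= D)%nat /\ (j <= D)%nat)) as [[H1 H2]|H].
    - apply (Ha i j H1 H2).
    - rewrite Ha0 by exact H. apply cfun_const. }
  assert (a_bound : forall i j n x, Rabs (a i j n x) * r ^ n <= M).
  { intros i j n x. destruct (excluded_middle_informative ((i <= D)%nat /\ (j <= D)%nat)) as [[H1 H2]|H].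
    - apply (Ha i j H1 H2).
    - rewrite Ha0 by exact H. rewrite Rabs_R0. lra. }
  assert (c_cont : forall i n, cfun (c i n)).
  { intros i n. destruct (excluded_middle_informative (i <= D)%nat) as [H|H].
    - apply (Hc i H).
    - rewrite Hc0 by exact H. apply cfun_const. }
  assert (c_inv : forall i n x, c i n (clamp l x) = c i n x).
  { intros i n x. destruct (excluded_middle_informative (i <= D)%nat) as [H|H].
    - apply (Hc i H).
    - rewrite Hc0 by exact H. reflexivity. }
  assert (c_bound : forall i n x, Rabs (c i n x) * r ^ n <= M).
  { intros i n x. destruct (excluded_middle_informative (i <= D)%nat) as [H|H].
    - apply (Hc i H).
    - rewrite Hc0 by exact H. rewrite Rabs_R0. lra. }
  set (beta := INR (S D) * (2 * M)).
  assert (Hbeta : 0 <= beta) by (apply Rmult_le_pos; [apply pos_INR|lra]).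
  destruct (volterra_exists (nat * nat) (cweight r) (coper D a) beta l (fun x p => c (snd p) (fst p) x) M)
    as (z & zc & zb & ze); auto.
  - intros p; apply cweight_pos, Hr.
  - intros; apply coper_lin.
  - intros x y phi Hy. apply coper_bound; assumption.
  - intros f Hf. apply coper_cont; assumption.
  - intros x [n i]; unfold cweight; simpl.
    assert (Hrn : 0 < r ^ n) by (apply pow_lt, Hr).
    apply Rmult_le_reg_r with (r ^ n); [exact Hrn|].
    eapply Rle_trans; [apply c_bound|].
    replace ((2 / r) ^ n * M * r ^ n) with (2 ^ n * M).
    + assert (1 <= 2 ^ n) by (apply pow_R1_Rle; lra). nra.
    + replace (2 ^ n) with ((2 / r) ^ n * r ^ n); [ring|].
      rewrite <- Rpow_mult_distr. f_equal. field; lra.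
  - set (C := M * exp (beta * l)) in *.
    assert (HC : 0 <= C) by (apply Rmult_le_pos; [exact HM|left; apply exp_pos]).
    assert (Hr2 : 0 < r / 2) by lra.
    assert (zb' : forall i n x, Rabs (z x (n, i)) * (r / 2) ^ n <= C).
    { intros i n x. specialize (zb x (n, i)). unfold cweight in zb; simpl in zb.
      assert (Hrn : 0 < (r / 2) ^ n) by (apply pow_lt, Hr2).
      apply Rle_trans with ((2 / r) ^ n * C * (r / 2) ^ n); [apply Rmult_le_compat_r; lra|].
      replace ((2 / r) ^ n * C * (r / 2) ^ n) with (((2 / r) * (r / 2)) ^ n * C) by (rewrite Rpow_mult_distr; ring).
      replace (2 / r * (r / 2)) with 1 by (field; lra). rewrite pow1. lra. }
    assert (zs : forall i x h, Rabs h < r / 2 -> ex_series (fun n => z x (n, i) * h ^ n)).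
    { intros i x h Hh.
      destruct (CV_radius_inside (fun n => z x (n, i)) h) as [s Hs].
      - apply (bound_CV_radius _ (r / 2) C); auto.
      - exists s. apply is_pseries_R, Hs. }
    exists (fun i x lam => Series (fun n => z x (n, i) * (lam - lam0) ^ n)).
    assert (Han : forall i, expansion l lam0 (r / 2) C (fun n x => z x (n, i))
      (fun x lam => Series (fun n => z x (n, i) * (lam - lam0) ^ n))).
    { intros i. split; [|split; [|split]].
      - intros n; apply zc.
      - intros n x. rewrite ze, (ze x). simpl fst; simpl snd.
        rewrite clamp_idem by exact Hl. rewrite c_inv. reflexivity.
      - intros n x; apply zb'.
      - intros x h Hh. replace (lam0 + h - lam0) with h by ring.
        apply (Series_correct _ (zs i x h Hh)). }
    split; [intros i _; exists (r / 2), C, (fun n x => z x (n, i)); split; [exact Hr2|apply Han]|].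
    exists (r / 2). split; [exact Hr2|]. intros h Hh. cbv beta.
    replace (lam0 + h - lam0) with h by ring.
    (* Weight times [|h|^n] is [q^n], so [q < 1] provides a geometric majorant for the solution and
       for its image under [coper]. *)
    set (q := Rabs h * (2 / r)).
    assert (Hq : 0 <= q < 1).
    { unfold q. split; [apply Rmult_le_pos; [apply Rabs_pos|left; apply Rdiv_lt_0_compat; lra]|].
      apply Rmult_lt_reg_r with (r / 2); [lra|]. rewrite Rmult_assoc.
      replace (2 / r * (r / 2)) with 1 by (field; lra). lra. }
    assert (Hgeo : forall K, ex_series (fun n => K * q ^ n)).
    { intros K. apply (ex_series_scal (K := R_AbsRing) (V := R_NormedModule) K).
      apply ex_series_geom. rewrite Rabs_pos_eq; lra. }
    assert (Hzmaj : forall (K v : R) n i, Rabs v <= cweight r (n, i) * K -> Rabs (v * h ^ n) <= K * q ^ n).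
    { intros K v n i Hv. rewrite Rabs_mult, <- RPow_abs. unfold q. rewrite Rpow_mult_distr.
      unfold cweight in Hv; simpl in Hv.
      assert (0 <= Rabs h ^ n) by (apply pow_le, Rabs_pos).
      apply Rle_trans with ((2 / r) ^ n * K * Rabs h ^ n); [apply Rmult_le_compat_r; assumption|right; ring]. }
    split.
    + intros i _. apply (cfun_series (fun n x => z x (n, i) * h ^ n) (fun n => C * q ^ n)).
      * intros n. apply cfun_mult; [apply zc|apply cfun_const].
      * intros n t. apply (Hzmaj C _ n i), zb.
      * apply Hgeo.
    + intros x i Hi. cbv beta.
      assert (Hcl := clamp_in l x Hl).
      assert (S1 : is_series (fun n => RInt (fun t => coper D a t (z t) (n, i) * h ^ n) 0 (clamp l x))
        (RInt (fun t => Series (fun n => coper D a t (z t) (n, i) * h ^ n)) 0 (clamp l x))).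
      { apply (RInt_series (fun n t => coper D a t (z t) (n, i) * h ^ n) (fun n => (beta * C) * q ^ n)).
        - apply Hcl.
        - intros n. apply cfun_mult; [apply coper_cont; auto|apply cfun_const].
        - intros n t. apply (Hzmaj (beta * C) _ n i).
          apply (coper_bound r M D a Hr HM a_bound); intros p; apply zb.
        - apply Hgeo. }
      apply is_series_unique.
      apply (is_series_ext (K := R_AbsRing) (V := R_NormedModule)
        (fun n => plus (c i n x * h ^ n) (RInt (fun t => coper D a t (z t) (n, i) * h ^ n) 0 (clamp l x)))).
      { intros n. rewrite ze. simpl fst; simpl snd.
        rewrite (RInt_ext _ (fun t => h ^ n * coper D a t (z t) (n, i))) by (intros; apply Rmult_comm).
        rewrite RInt_scal_c by (apply coper_cont; auto).
        unfold plus; simpl. ring. }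
      apply (is_series_plus (K := R_AbsRing) (V := R_NormedModule)).
      * apply (Hc i Hi). apply Rlt_trans with (1 := Hh). lra.
      * replace (RInt (fun t => sum_f_R0 (fun j => B i j t (lam0 + h) * Series (fun n => z t (n, j) * h ^ n)) D)
          0 (clamp l x)) with (RInt (fun t => Series (fun n => coper D a t (z t) (n, i) * h ^ n)) 0 (clamp l x));
          [exact S1|].
        (* The integrands agree: the convolution coefficients sum to the matrix at [lam0 + h]
           applied to the summed solution. *)
        apply RInt_ext. intros t _.
        apply is_series_unique.
        apply (is_series_ext (K := R_AbsRing) (V := R_NormedModule)
          (fun n => sum_f_R0 (fun j => PS_mult (fun k => a i j k t) (fun k => z t (k, j)) n * h ^ n) D)).
        { intros n. unfold coper, PS_mult; simpl fst; simpl snd.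
          rewrite (Rmult_comm _ (h ^ n)), scal_sum. reflexivity. }
        apply (is_series_sum (fun j n => PS_mult (fun k => a i j k t) (fun k => z t (k, j)) n * h ^ n)).
        intros j Hj. apply (proj1 (is_pseries_R _ _ _)). apply is_pseries_mult.
        -- apply is_pseries_R. apply (Ha i j Hi Hj). lra.
        -- apply is_pseries_R. apply (Series_correct _ (zs j t h Hh)).
        -- apply (bound_CV_radius _ r M); [exact Hr|intros; apply a_bound|lra].
        -- apply (bound_CV_radius _ (r / 2) C); auto.
Qed.

(** The difference of two solutions satisfies the homogeneous Volterra equation, here with all
    weights 1. Matrix and difference are set to zero for indices above [D], where nothing is
    assumed. *)
Theorem linear_system_unique l D (B : nat -> nat -> R -> R) (z z' : nat -> R -> R) (g : nat -> R -> R) :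
  0 <= l ->
  (forall i j, (i <= D)%nat -> (j <= D)%nat -> cfun (B i j) /\ forall x, B i j (clamp l x) = B i j x) ->
  (forall i, (i <= D)%nat -> cfun (z i)) -> (forall i, (i <= D)%nat -> cfun (z' i)) ->
  (forall x i, 0 <= x <= l -> (i <= D)%nat ->
    z i x = g i x + RInt (fun t => sum_f_R0 (fun j => B i j t * z j t) D) 0 x) ->
  (forall x i, 0 <= x <= l -> (i <= D)%nat ->
    z' i x = g i x + RInt (fun t => sum_f_R0 (fun j => B i j t * z' j t) D) 0 x) ->
  forall x i, 0 <= x <= l -> (i <= D)%nat -> z i x = z' i x.
Proof.
  intros Hl HB Hz Hz' He He'.
  set (B0 := fun i j x => if excluded_middle_informative ((i <= D)%nat /\ (j <= D)%nat) then B i j x else 0).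
  assert (HB0 : forall i j x, (i <= D)%nat -> (j <= D)%nat -> B0 i j x = B i j x).
  { intros i j x Hi Hj. unfold B0. destruct excluded_middle_informative; [reflexivity|tauto]. }
  assert (B0c : forall i j, cfun (B0 i j)).
  { intros i j. unfold B0. destruct excluded_middle_informative as [[H1 H2]|H].
    - apply (HB i j H1 H2).
    - apply cfun_const. }
  assert (HM : exists M, 0 <= M /\ forall i j x, Rabs (B0 i j x) <= M).
  (* A function that does not depend on the parameter is analytic in it; [analytic_family2] then
     serves to bound all entries at once. *)
  { destruct (analytic_family2 l 0 (fun i j x _ => B i j x) D D) as (r & M & Hr & HM & Ha).
    { intros i j Hi Hj. apply analytic_fun; [exact Hl|apply HB; assumption|apply HB; assumption]. }
    exists M. split; [exact HM|]. intros i j x. unfold B0.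
    destruct excluded_middle_informative as [[H1 H2]|H]; [|rewrite Rabs_R0; exact HM].
    destruct (Ha i j H1 H2) as [a Hab].
    rewrite <- (expansion_0 _ _ _ _ _ _ x Hr Hab). destruct Hab as (_ & _ & H3 & _).
    specialize (H3 O x). simpl in H3. lra. }
  destruct HM as (M & HM & HBM).
  set (L := fun x (y : nat -> R) i => sum_f_R0 (fun j => B0 i j x * y j) D).
  set (f := fun x i => if excluded_middle_informative (i <= D)%nat then z i x - z' i x else 0).
  assert (fc : forall i, cfun (fun x => f x i)).
  { intros i. unfold f. destruct excluded_middle_informative; [apply cfun_minus; auto|apply cfun_const]. }
  assert (fD : forall x i, (i <= D)%nat -> f x i = z i x - z' i x).
  { intros x i Hi. unfold f. destruct excluded_middle_informative; [reflexivity|tauto]. }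
  assert (Lc : forall f : R -> nat -> R, (forall i, cfun (fun x => f x i)) ->
     forall i, cfun (fun x => L x (f x) i)).
  { intros u Hu i. apply (cfun_sum (fun j x => B0 i j x * u x j)). intros j; apply cfun_mult; auto. }
  assert (HC : exists C, 0 <= C /\ forall x i, 0 <= x <= l -> Rabs (f x i) <= 1 * C).
  { destruct (analytic_family l 0 (fun i x _ => f (clamp l x) i) D) as (r & C & Hr & HC & Ha).
    { intros i Hi. apply (analytic_fun l 0 (fun x => f (clamp l x) i)); [exact Hl| |].
      - apply (cfun_comp (clamp l) (fun x => f x i)); [apply cfun_clamp|apply fc].
      - intros x; rewrite clamp_idem; auto. }
    exists C. split; [exact HC|]. intros x i Hx. rewrite Rmult_1_l.
    destruct (excluded_middle_informative (i <= D)%nat) as [Hi|Hi].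
    - destruct (Ha i Hi) as [a Hab].
      pose proof (expansion_0 _ _ _ _ _ _ x Hr Hab) as E. cbv beta in E. rewrite clamp_id in E by exact Hx.
      rewrite <- E. destruct Hab as (_ & _ & H3 & _). specialize (H3 O x). simpl in H3. lra.
    - unfold f. destruct excluded_middle_informative; [tauto|]. rewrite Rabs_R0; exact HC. }
  destruct HC as (C & HC & fb).
  intros x i Hx Hi.
  enough (E : f x i = 0) by (rewrite fD in E by exact Hi; lra).
  apply (volterra_unique nat (fun _ => 1) L (INR (S D) * M) l f C); auto.
  - apply Rmult_le_pos; [apply pos_INR|exact HM].
  - intros; lra.
  - intros y u phi Hu j. rewrite Rmult_1_l. unfold L.
    eapply Rle_trans; [apply sum_abs_le|]. rewrite Rmult_assoc. apply sum_const_le.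
    intros k _. rewrite Rabs_mult. specialize (Hu k). rewrite Rmult_1_l in Hu.
    apply Rmult_le_compat; [apply Rabs_pos|apply Rabs_pos|apply HBM|exact Hu].
  - intros y j Hy. destruct (excluded_middle_informative (j <= D)%nat) as [Hj|Hj].
    + rewrite fD by exact Hj. rewrite He, He' by assumption.
      replace (g j y + RInt (fun t => sum_f_R0 (fun j0 => B j j0 t * z j0 t) D) 0 y -
        (g j y + RInt (fun t => sum_f_R0 (fun j0 => B j j0 t * z' j0 t) D) 0 y)) with
        (RInt (fun t => sum_f_R0 (fun j0 => B j j0 t * z j0 t) D) 0 y -
         RInt (fun t => sum_f_R0 (fun j0 => B j j0 t * z' j0 t) D) 0 y) by ring.
      assert (Q : forall u : nat -> R -> R, (forall i, (i <= D)%nat -> cfun (u i)) ->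
        cfun (fun t => sum_f_R0 (fun j0 => B j j0 t * u j0 t) D)).
      { intros u Hu. assert (Q : forall n, (n <= D)%nat -> cfun (fun t => sum_f_R0 (fun j0 => B j j0 t * u j0 t) n)).
        { induction n as [|n IH]; intros Hn; simpl.
          - apply cfun_mult; [apply HB; lia|apply Hu; lia].
          - apply cfun_plus; [apply IH; lia|]. apply cfun_mult; [apply HB; lia|apply Hu; lia]. }
        apply Q; lia. }
      rewrite <- RInt_minus_c by auto.
      apply RInt_ext. intros t _. unfold L.
      rewrite <- minus_sum. apply sum_eq. intros k Hk.
      rewrite HB0, fD by assumption. ring.
    + assert (E : forall t, L t (f t) j = 0).
      { intros t. unfold L. rewrite (sum_eq _ (fun _ => 0)).
        - rewrite sum_cte. ring.
        - intros k _. unfold B0. destruct excluded_middle_informative; [tauto|ring]. }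
      rewrite (RInt_ext _ (fun _ => 0)) by (intros; apply E).
      rewrite RInt_const. unfold f. destruct excluded_middle_informative; [tauto|].
      unfold scal; simpl; unfold mult; simpl. ring.
Qed.

(** * The subsonic branch *)

Lemma locally_between (a b t : R) (P : R -> Prop) :
  a < t < b -> (forall y, a < y < b -> P y) -> locally t P.
Proof.
  intros Ht H. exists (mkposreal (Rmin (t - a) (b - t)) ltac:(apply Rmin_pos; lra)).
  intros y Hy. apply H. unfold ball in Hy; simpl in Hy; unfold AbsRing_ball, abs, minus, plus, opp in Hy; simpl in Hy.
  pose proof (Rmin_l (t - a) (b - t)). pose proof (Rmin_r (t - a) (b - t)).
  apply Rabs_def2 in Hy. lra.
Qed.

Lemma iterated_derivatives (F : nat -> R -> R) a b :
  (forall n t, a < t < b -> is_derive (F n) t (F (S n) t)) ->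
  forall n t, a < t < b -> is_derive_n (F O) n t (F n t).
Proof.
  intros H n; induction n as [|n IH]; intros t Ht; [reflexivity|].
  simpl. apply (is_derive_ext_loc (F n)); [|apply H, Ht].
  apply (locally_between a b); [exact Ht|]. intros y Hy.
  symmetry. apply is_derive_n_unique, IH, Hy.
Qed.

(** The Lagrange remainder after degree [n] is at most [C * (q * s)^(n + 1)]: the factorial in the
    bound on the derivatives cancels the one in Taylor's formula. *)
Lemma taylor_series_right (F : nat -> R -> R) a b t0 s C q :
  (forall n t, a < t < b -> is_derive (F n) t (F (S n) t)) ->
  (forall n t, a < t < b -> Rabs (F n t) <= C * q ^ n * INR (fact n)) ->
  a < t0 -> 0 < s -> t0 + s < b -> 0 <= q * s < 1 ->
  is_series (fun n => F n t0 / INR (fact n) * s ^ n) (F O (t0 + s)).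
Proof.
  intros HF HB Ha Hs Hb Hq.
  assert (HT : forall n, Rabs (sum_f_R0 (fun n => F n t0 / INR (fact n) * s ^ n) n - F O (t0 + s))
    <= C * (q * s) ^ S n).
  { intros n. destruct (Taylor_Lagrange (F O) n t0 (t0 + s)) as (zeta & Hz & E).
    - lra.
    - intros t Ht k _.
      destruct k as [|k]; [exact Logic.I|].
      exists (F (S k) t). apply (iterated_derivatives F a b HF (S k)). lra.
    - rewrite E. replace (t0 + s - t0) with s by ring.
      rewrite (is_derive_n_unique _ _ _ _ (iterated_derivatives F a b HF (S n) zeta ltac:(lra))).
      rewrite (sum_eq (fun m => s ^ m / INR (fact m) * Derive_n (F O) m t0)
        (fun n => F n t0 / INR (fact n) * s ^ n)).
      + match goal with |- Rabs (?A - (?A + ?B)) <= _ => replace (A - (A + B)) with (- B) by ring end.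
        rewrite Rabs_Ropp, Rabs_mult. unfold Rdiv.
        assert (Hf := INR_fact_lt_0 (S n)).
        rewrite (Rabs_pos_eq (s ^ S n * / INR (fact (S n))));
          [|apply Rmult_le_pos; [apply pow_le; lra|left; apply Rinv_0_lt_compat, Hf]].
        apply Rle_trans with (s ^ S n * / INR (fact (S n)) * (C * q ^ S n * INR (fact (S n)))).
        * apply Rmult_le_compat_l; [apply Rmult_le_pos; [apply pow_le; lra|left; apply Rinv_0_lt_compat, Hf]|].
          apply HB. lra.
        * right. rewrite Rpow_mult_distr. field. lra.
      + intros k _.
        rewrite (is_derive_n_unique _ _ _ _ (iterated_derivatives F a b HF k t0 ltac:(lra))).
        field. apply INR_fact_neq_0. }
  apply is_series_Reals. intros eps He.
  assert (HC : 0 <= C).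
  { specialize (HB O t0 ltac:(lra)). simpl in HB. pose proof (Rabs_pos (F O t0)). lra. }
  destruct (pow_lt_1_zero (q * s)) with (y := eps / (C + 1)) as [N HN].
  { rewrite Rabs_pos_eq; lra. }
  { apply Rdiv_lt_0_compat; lra. }
  exists N. intros n Hn. unfold Rdist. eapply Rle_lt_trans; [apply HT|].
  specialize (HN (S n) ltac:(lia)). rewrite Rabs_pos_eq in HN by (apply pow_le; lra).
  apply Rle_lt_trans with (C * (eps / (C + 1))); [apply Rmult_le_compat_l; lra|].
  replace eps with ((C + 1) * (eps / (C + 1))) at 2 by (field; lra).
  apply Rmult_lt_compat_r; [apply Rdiv_lt_0_compat; lra|lra].
Qed.

Lemma taylor_series (F : nat -> R -> R) a b t0 s C q :
  (forall n t, a < t < b -> is_derive (F n) t (F (S n) t)) ->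
  (forall n t, a < t < b -> Rabs (F n t) <= C * q ^ n * INR (fact n)) ->
  a < t0 < b -> a < t0 + s < b -> 0 <= q -> q * Rabs s < 1 ->
  is_series (fun n => F n t0 / INR (fact n) * s ^ n) (F O (t0 + s)).
Proof.
  intros HF HB Ht Hts Hq Hqs.
  assert (Hqs0 : 0 <= q * Rabs s) by (apply Rmult_le_pos; [exact Hq|apply Rabs_pos]).
  destruct (Rtotal_order s 0) as [Hs|[->|Hs]].
  - rewrite Rabs_left in Hqs, Hqs0 by exact Hs.
    (* To the left of [t0] the reflected function [t -> F (- t)] is expanded to the right; its
       derivatives carry the signs [(-1)^n]. *)
    pose proof (taylor_series_right (fun n t => (-1) ^ n * F n (- t)) (- b) (- a) (- t0) (- s) C q) as H.
    cbv beta in H. replace (- (- t0 + - s)) with (t0 + s) in H by ring.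
    rewrite Ropp_involutive in H.
    apply (is_series_ext (K := R_AbsRing) (V := R_NormedModule)
      (fun n => (-1) ^ n * F n t0 / INR (fact n) * (- s) ^ n)).
    + intros n. replace (- s) with ((-1) * s) by ring. rewrite Rpow_mult_distr.
      replace ((-1) ^ n * F n t0 / INR (fact n) * ((-1) ^ n * s ^ n))
        with (((-1) ^ n * (-1) ^ n) * (F n t0 / INR (fact n) * s ^ n)) by (unfold Rdiv; ring).
      rewrite <- Rpow_mult_distr. replace (-1 * -1) with 1 by ring. rewrite pow1. apply Rmult_1_l.
    + rewrite pow_O, Rmult_1_l in H. apply H; try lra.
      * intros n t Ht'. 
        replace ((-1) ^ S n * F (S n) (- t)) with ((-1) ^ n * (-1 * F (S n) (- t))) by (simpl; ring).
        apply (is_derive_scal (fun t => F n (- t))).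
        apply (is_derive_comp (F n) Ropp t (F (S n) (- t)) (-1)); [apply HF; lra|].
        auto_derive; [trivial|ring].
      * intros n t Ht'. rewrite Rabs_mult, pow_1_abs, Rmult_1_l.
        apply HB; lra.
  - rewrite Rplus_0_r. apply (is_series_finite _ 0).
    + intros n Hn. rewrite pow_ne_zero by lia. ring.
    + simpl. field.
  - rewrite Rabs_pos_eq in Hqs, Hqs0 by lra.
    apply (taylor_series_right F a b t0 s C q); try assumption; lra.
Qed.

(* [s - exp s] is the primitive that integrates the background equation; its
   increasing branch [s < 0] is the subsonic one and is inverted by [sbr]. *)
Definition sbr (tau : R) : R :=
  epsilon (inhabits 0) (fun s => s < 0 /\ s - exp s = tau).

(** From [exp s = exp s' * exp (s - s') >= exp s' * (1 + s - s')] the increment is at least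
    [(1 - exp s') * (s' - s)]. *)
Lemma sbr_mono s s' : s < s' -> s' < 0 -> s - exp s < s' - exp s'.
Proof.
  intros H H'.
  assert (E : exp s = exp s' * exp (s - s')) by (rewrite <- exp_plus; f_equal; ring).
  pose proof (exp_ineq1_le (s - s')) as H1.
  assert (H2 : exp s' < 1) by (rewrite <- exp_0; apply exp_increasing, H').
  pose proof (exp_pos s') as H3. rewrite E. nra.
Qed.

Lemma sbr_spec tau : tau < -1 -> sbr tau < 0 /\ sbr tau - exp (sbr tau) = tau.
Proof.
  intros H. apply (epsilon_spec (inhabits 0) (fun s => s < 0 /\ s - exp s = tau)).
  (* On [tau, 0] the function goes from [tau - exp tau < tau] to [-1 > tau]. *)
  destruct (IVT_gen (fun s => s - exp s) tau 0 tau) as (s & Hs & E).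
  - intros x. apply continuity_pt_filterlim.
    apply (continuous_minus (V := R_NormedModule) (fun s => s) exp);
      [apply continuous_id|apply continuous_exp].
  - pose proof (exp_pos tau). rewrite exp_0.
    rewrite Rmin_left, Rmax_right; lra.
  - exists s. split; [|exact E]. rewrite Rmin_left, Rmax_right in Hs by lra.
    destruct (Rle_lt_or_eq_dec s 0) as [Hl|He]; [lra|exact Hl|].
    subst s. rewrite exp_0 in E. lra.
Qed.

Lemma sbr_unique s : s < 0 -> sbr (s - exp s) = s.
Proof.
  intros Hs.
  assert (H : s - exp s < -1).
  { destruct (Rlt_or_le (s / 2) 0) as [H|H]; [|lra].
    pose proof (sbr_mono s (s / 2) ltac:(lra) H). pose proof (exp_ineq1_le (s / 2)). lra. }
  destruct (sbr_spec _ H) as [H1 H2].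
  destruct (Rtotal_order (sbr (s - exp s)) s) as [L|[E|L]]; [|exact E|].
  - pose proof (sbr_mono _ _ L Hs). lra.
  - pose proof (sbr_mono _ _ L H1). lra.
Qed.

Lemma sbr_lt tau tau' : tau < tau' -> tau' < -1 -> sbr tau < sbr tau'.
Proof.
  intros H H'. destruct (sbr_spec tau ltac:(lra)) as [H1 H2], (sbr_spec tau' H') as [H3 H4].
  destruct (Rtotal_order (sbr tau) (sbr tau')) as [L|[E|L]]; [exact L|rewrite E in H2; lra|].
  pose proof (sbr_mono _ _ L H1). lra.
Qed.

Lemma psi_derive s : is_derive (fun s => s - exp s) s (1 - exp s).
Proof. auto_derive; [trivial|ring]. Qed.

Lemma sbr_continuous tau : tau < -1 -> continuity_pt sbr tau.
Proof.
  intros H.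
  (* [tb] is the midpoint of [tau] and -1, so [ta, tb] is a neighbourhood of [tau] inside the range
     of the branch. *)
  set (ta := tau - 1). set (tb := (tau - 1) / 2).
  destruct (sbr_spec ta ltac:(unfold ta; lra)) as [Ha1 Ha2].
  destruct (sbr_spec tb ltac:(unfold tb; lra)) as [Hb1 Hb2].
  apply (continuity_pt_recip_interv (fun s => s - exp s) sbr (sbr ta) (sbr tb)).
  - apply sbr_lt; unfold ta, tb; lra.
  - intros x y H1 H2 H3. apply sbr_mono; lra.
  - intros x H1 H2. rewrite Ha2 in H1; rewrite Hb2 in H2. unfold comp, id. apply sbr_spec. unfold tb in H2; lra.
  - intros x H1 H2. rewrite Ha2 in H1; rewrite Hb2 in H2. split.
    + destruct (Rle_lt_or_eq_dec _ _ H1) as [L|E]; [left; apply sbr_lt; [exact L|unfold tb in H2; lra]|rewrite E; lra].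
    + destruct (Rle_lt_or_eq_dec _ _ H2) as [L|E]; [left; apply sbr_lt; [exact L|unfold tb; lra]|rewrite E; lra].
  - intros x H1. apply continuity_pt_filterlim.
    apply (ex_derive_continuous (V := R_NormedModule) (fun s => s - exp s)). eexists; apply psi_derive.
  - rewrite Ha2, Hb2. unfold ta, tb; lra.
Qed.

Lemma sbr_derive tau : tau < -1 -> is_derive sbr tau (/ (1 - exp (sbr tau))).
Proof.
  intros H. apply is_derive_Reals.
  set (ta := tau - 1). set (tb := (tau - 1) / 2).
  assert (Prf : forall a : R, sbr ta <= a <= sbr tb -> derivable_pt (fun s => s - exp s) a).
  { intros a _. apply ex_derive_Reals_0. eexists; apply psi_derive. }
  assert (Hin : sbr ta <= sbr tau <= sbr tb) by (split; left; apply sbr_lt; unfold ta, tb; lra).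
  assert (E : derive_pt (fun s => s - exp s) (sbr tau) (Prf (sbr tau) Hin) = 1 - exp (sbr tau)).
  { rewrite Derive_Reals. apply is_derive_unique, psi_derive. }
  replace (/ (1 - exp (sbr tau))) with (1 / derive_pt (fun s => s - exp s) (sbr tau) (Prf (sbr tau) Hin))
    by (rewrite E; unfold Rdiv; ring).
  apply (derivable_pt_lim_recip_interv (fun s => s - exp s) sbr ta tb tau Prf).
  - apply sbr_continuous, H.
  - unfold ta, tb; lra.
  - unfold ta, tb; lra.
  - intros x Hx. apply sbr_spec. unfold id; unfold tb in Hx; lra.
  - rewrite E. destruct (sbr_spec tau H) as [H1 _].
    apply exp_increasing in H1. rewrite exp_0 in H1. apply Rgt_not_eq. lra.
Qed.

(** This is [1 / (1 - y)] for [y = exp (sbr tau)], and also the derivative of [sbr]. It satisfies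
    [v' = v^3 - v^2], so all its derivatives are polynomials in itself; [y] is recovered as
    [1 - / vbr]. *)
Definition vbr (tau : R) : R := / (1 - exp (sbr tau)).

Lemma exp_sbr_bounds tau : tau < -1 -> 0 < exp (sbr tau) < 1.
Proof.
  intros H. destruct (sbr_spec tau H) as [H1 _].
  pose proof (exp_increasing _ _ H1). rewrite exp_0 in *. pose proof (exp_pos (sbr tau)). lra.
Qed.

Lemma vbr_ge1 tau : tau < -1 -> 1 < vbr tau.
Proof.
  intros H. pose proof (exp_sbr_bounds tau H). unfold vbr.
  rewrite <- Rinv_1 at 1. apply Rinv_lt_contravar; lra.
Qed.

Lemma vbr_le tau tau' : tau <= tau' -> tau' < -1 -> vbr tau <= vbr tau'.
Proof.
  intros H H'. destruct (Rle_lt_or_eq_dec _ _ H) as [L|E]; [|rewrite E; lra].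
  pose proof (exp_increasing _ _ (sbr_lt _ _ L H')).
  pose proof (exp_sbr_bounds tau' H'). unfold vbr.
  left; apply Rinv_lt_contravar; [|lra]. apply Rmult_lt_0_compat; lra.
Qed.

Lemma vbr_derive tau : tau < -1 -> is_derive vbr tau (vbr tau ^ 3 - vbr tau ^ 2).
Proof.
  intros H. pose proof (exp_sbr_bounds tau H) as Hb. pose proof (sbr_derive tau H) as Hd.
  unfold vbr.
  evar_last.
  - apply (is_derive_inv (fun t => 1 - exp (sbr t)) tau (- (exp (sbr tau) * / (1 - exp (sbr tau))))); [|lra].
    replace (- (exp (sbr tau) * / (1 - exp (sbr tau)))) with (minus 0 (scal (/ (1 - exp (sbr tau))) (exp (sbr tau)))).
    + apply (is_derive_minus (fun _ => 1) (fun t => exp (sbr t))).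
      * apply (is_derive_const (V := R_NormedModule)).
      * apply (is_derive_comp exp sbr); [|exact Hd]. apply is_derive_Reals, derivable_pt_lim_exp.
    + unfold minus, plus, opp, scal; simpl; unfold mult; simpl. ring.
  - field. lra.
Qed.

(* [n]-th derivative of [vbr ^ k], from [vbr' = vbr ^ 3 - vbr ^ 2]. *)
Fixpoint vder (n k : nat) (tau : R) : R :=
  match n with
  | O => vbr tau ^ k
  | S n => INR k * (vder n (S (S k)) tau - vder n (S k) tau)
  end.

Lemma vder_derive n k tau : tau < -1 -> is_derive (vder n k) tau (vder (S n) k tau).
Proof.
  intros H. revert k; induction n as [|n IH]; intros k.
  - simpl vder. pose proof (vbr_derive tau H) as Hd.
    evar_last; [apply (is_derive_pow vbr k tau _ Hd)|].
    destruct k as [|k]; [simpl; ring|]. simpl pred. simpl pow. ring.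
  - change (vder (S (S n)) k tau) with (INR k * (vder (S n) (S (S k)) tau - vder (S n) (S k) tau)).
    apply (is_derive_scal (fun t => vder n (S (S k)) t - vder n (S k) t)).
    apply (is_derive_minus (vder n (S (S k))) (vder n (S k))); apply IH.
Qed.

(** The product [k (k + 2) ... (k + 2n - 2)], because the factor [INR k] in [vder] comes with an
    exponent that grows by at most 2 per derivative. For [k = 1] it is the double factorial (2n -
    1)!!. *)
Fixpoint oddprod (n k : nat) : R :=
  match n with O => 1 | S n => oddprod n k * (INR k + 2 * INR n) end.

Lemma oddprod_pos n k : 0 <= oddprod n k.
Proof.
  induction n as [|n IH]; cbn [oddprod]; [lra|].
  apply Rmult_le_pos; [exact IH|]. pose proof (pos_INR k). pose proof (pos_INR n). lra.
Qed.

Lemma oddprod_S n k : oddprod n (S k) <= oddprod n (S (S k)).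
Proof.
  induction n as [|n IH]; cbn [oddprod]; [lra|].
  pose proof (pos_INR (S k)). pose proof (pos_INR n).
  apply Rmult_le_compat; [apply oddprod_pos|lra|exact IH|]. rewrite (S_INR (S k)). lra.
Qed.

Lemma oddprod_shift n k : INR k * oddprod n (S (S k)) = oddprod (S n) k.
Proof.
  induction n as [|n IH].
  - cbn [oddprod]. simpl (INR 0). ring.
  - change (oddprod (S n) (S (S k))) with (oddprod n (S (S k)) * (INR (S (S k)) + 2 * INR n)).
    rewrite <- Rmult_assoc, IH. change (oddprod (S (S n)) k) with (oddprod (S n) k * (INR k + 2 * INR (S n))).
    rewrite !S_INR. ring.
Qed.

Lemma oddprod_1 n : oddprod n 1 <= 2 ^ n * INR (fact n).
Proof.
  induction n as [|n IH]; [simpl; lra|].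
  change (oddprod (S n) 1) with (oddprod n 1 * (INR 1 + 2 * INR n)).
  rewrite fact_simpl, mult_INR, (S_INR n). simpl pow.
  pose proof (oddprod_pos n 1). pose proof (pos_INR n).
  apply Rle_trans with (2 ^ n * INR (fact n) * (2 * (INR n + 1))); [|right; ring].
  apply Rmult_le_compat; simpl INR; lra.
Qed.

(** Each derivative replaces a power by two, with exponents raised by 1 and by 2. Since [V > 1] and
    [oddprod] grows with [k], both are bounded by the larger one, whence the factor [2^n]. *)
Lemma vder_bound V n k tau : tau < -1 -> vbr tau <= V ->
  Rabs (vder n k tau) <= 2 ^ n * V ^ (k + 2 * n) * oddprod n k.
Proof.
  intros H HV. pose proof (vbr_ge1 tau H) as H1. revert k; induction n as [|n IH]; intros k.
  - simpl vder. rewrite Nat.mul_0_r, Nat.add_0_r. simpl.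
    rewrite Rabs_pos_eq by (apply pow_le; lra). rewrite Rmult_1_r, Rmult_1_l. apply pow_incr; lra.
  - change (vder (S n) k tau) with (INR k * (vder n (S (S k)) tau - vder n (S k) tau)).
    rewrite Rabs_mult, (Rabs_pos_eq (INR k)) by apply pos_INR.
    rewrite <- oddprod_shift.
    replace (2 ^ S n * V ^ (k + 2 * S n) * (INR k * oddprod n (S (S k))))
      with (INR k * (2 * (2 ^ n * V ^ (k + 2 * S n) * oddprod n (S (S k))))) by (rewrite <- (tech_pow_Rmult 2 n); generalize (V ^ (k + 2 * S n)); intros; ring).
    apply Rmult_le_compat_l; [apply pos_INR|].
    eapply Rle_trans; [apply Rabs_triang|]. rewrite Rabs_Ropp.
    assert (A1 := IH (S (S k))). assert (A2 := IH (S k)).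
    replace (S (S k) + 2 * n)%nat with (k + 2 * S n)%nat in A1 by lia.
    assert (A3 : 2 ^ n * V ^ (S k + 2 * n) * oddprod n (S k) <= 2 ^ n * V ^ (k + 2 * S n) * oddprod n (S (S k))).
    { apply Rmult_le_compat; [|apply oddprod_pos| |apply oddprod_S].
      - apply Rmult_le_pos; apply pow_le; lra.
      - apply Rmult_le_compat_l; [apply pow_le; lra|]. apply Rle_pow; [lra|lia]. }
    lra.
Qed.

Lemma analytic_vbr l lam0 c0 phi : 0 <= l -> cfun phi -> (forall x, phi (clamp l x) = phi x) ->
  (forall x, 0 <= phi x <= phi l) -> 0 < phi l -> c0 < -1 -> c0 + lam0 * phi l < -1 ->
  analytic_at l lam0 (fun x lam => vbr (c0 + lam * phi x)).
Proof.
  intros Hl Hc Hcl Hphi Hpl Hc0 H0.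
  (* Half the distance from -1 to an upper bound of [c0 + lam0 * phi x]; being affine in [phi x],
     this is largest at an end of [0, phi l]. *)
  set (m := (-1 - Rmax c0 (c0 + lam0 * phi l)) / 2).
  assert (Hm : 0 < m).
  { unfold m. apply Rdiv_lt_0_compat; [|lra]. unfold Rmax; destruct Rle_dec; lra. }
  set (b := -1 - m). assert (Hb : b < -1) by (unfold b; lra).
  set (V := vbr b). assert (HV : 1 < V) by apply vbr_ge1, Hb.
  (* [2^n] from the two terms per derivative, [2^n] from [oddprod_1] and [V^(2n)] from the
     exponents. *)
  set (q := 4 * V ^ 2). assert (Hq : 0 < q) by (unfold q; nra).
  assert (Ht0 : forall x, c0 + lam0 * phi x <= -1 - 2 * m).
  { intros x. specialize (Hphi x). unfold m.
    replace (-1 - 2 * ((-1 - Rmax c0 (c0 + lam0 * phi l)) / 2)) with (Rmax c0 (c0 + lam0 * phi l)) by field.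
    destruct (Rle_lt_dec 0 lam0).
    - apply Rle_trans with (c0 + lam0 * phi l); [nra|apply Rmax_r].
    - apply Rle_trans with c0; [nra|apply Rmax_l]. }
  assert (Hvd : forall n t, t < b -> Rabs (vder n 1 t) <= V * q ^ n * INR (fact n)).
  { intros n t Ht. eapply Rle_trans; [apply (vder_bound V); [lra|apply vbr_le; lra]|].
    replace (V * q ^ n * INR (fact n)) with (2 ^ n * V ^ (1 + 2 * n) * (2 ^ n * INR (fact n))).
    - apply Rmult_le_compat_l; [apply Rmult_le_pos; apply pow_le; lra|apply oddprod_1].
    - unfold q. rewrite pow_add, pow_mult. simpl (V ^ 1).
      replace (4 * V ^ 2) with (2 * 2 * V ^ 2) by ring. rewrite !Rpow_mult_distr. ring. }
  (* The first entry keeps [c0 + (lam0 + h) * phi x] below [b], the second keeps [q * |h * phi x|]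
     at most 1/2. *)
  set (r := Rmin (m / phi l) (/ (2 * q * phi l))).
  assert (Hr : 0 < r).
  { apply Rmin_pos; [apply Rdiv_lt_0_compat; assumption|apply Rinv_0_lt_compat].
    apply Rmult_lt_0_compat; lra. }
  assert (Hr1 : r * phi l <= m).
  { apply Rle_trans with (m / phi l * phi l); [apply Rmult_le_compat_r; [lra|apply Rmin_l]|].
    right; field; lra. }
  assert (Hr2 : q * (r * phi l) <= / 2).
  { apply Rle_trans with (q * (/ (2 * q * phi l) * phi l)).
    - apply Rmult_le_compat_l; [lra|]. apply Rmult_le_compat_r; [lra|apply Rmin_r].
    - right; field; lra. }
  exists r, V, (fun n x => vder n 1 (c0 + lam0 * phi x) / INR (fact n) * phi x ^ n).
  split; [exact Hr|split; [|split; [|split]]].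
  - intros n. apply cfun_mult; [|apply cfun_pow, Hc].
    apply (cfun_mult _ (fun _ => / INR (fact n))); [|apply cfun_const].
    intros x. apply (continuous_comp (fun x => c0 + lam0 * phi x) (vder n 1)).
    + apply (cfun_plus (fun _ => c0) (fun x => lam0 * phi x)); [apply cfun_const|].
      apply (cfun_mult (fun _ => lam0)); [apply cfun_const|exact Hc].
    + apply (ex_derive_continuous (V := R_NormedModule)). eexists. apply vder_derive.
      specialize (Ht0 x). lra.
  - intros n x. rewrite Hcl. reflexivity.
  - intros n x. specialize (Hphi x). specialize (Ht0 x).
    assert (Hf := INR_fact_lt_0 n).
    unfold Rdiv. rewrite !Rabs_mult, Rabs_inv, (Rabs_pos_eq (INR (fact n))), (Rabs_pos_eq (phi x ^ n)) by
      (try apply pow_le; lra).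
    apply Rle_trans with (V * q ^ n * INR (fact n) * / INR (fact n) * phi l ^ n * r ^ n).
    + apply Rmult_le_compat_r; [apply pow_le; lra|].
      apply Rmult_le_compat; [apply Rmult_le_pos; [apply Rabs_pos|left; apply Rinv_0_lt_compat, Hf]|apply pow_le; lra| |apply pow_incr; lra].
      apply Rmult_le_compat_r; [left; apply Rinv_0_lt_compat, Hf|]. apply Hvd. unfold b; lra.
    + replace (V * q ^ n * INR (fact n) * / INR (fact n) * phi l ^ n * r ^ n) with (V * (q * (r * phi l)) ^ n).
      * assert (Hp : (q * (r * phi l)) ^ n <= 1).
        { rewrite <- (pow1 n) at 1. apply pow_incr. split; [|lra].
          apply Rmult_le_pos; [lra|]. apply Rmult_le_pos; lra. }
        nra.
      * rewrite !Rpow_mult_distr. field. lra.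
  - intros x h Hh. specialize (Hphi x). specialize (Ht0 x).
    assert (Hs : Rabs (h * phi x) <= Rabs h * phi l).
    { rewrite Rabs_mult, (Rabs_pos_eq (phi x)) by lra. apply Rmult_le_compat_l; [apply Rabs_pos|lra]. }
    assert (Hs2 : Rabs h * phi l < r * phi l) by (apply Rmult_lt_compat_r; lra).
    pose proof (Rle_abs (h * phi x)) as Hs3. pose proof (Rle_abs (- (h * phi x))) as Hs4. rewrite Rabs_Ropp in Hs4.
    apply (is_series_ext (K := R_AbsRing) (V := R_NormedModule)
      (fun n => vder n 1 (c0 + lam0 * phi x) / INR (fact n) * (h * phi x) ^ n)).
    { intros n. rewrite Rpow_mult_distr. unfold Rdiv. change (@eq R (vder n 1 (c0 + lam0 * phi x) * / INR (fact n) * (h ^ n * phi x ^ n)) (vder n 1 (c0 + lam0 * phi x) * / INR (fact n) * phi x ^ n * h ^ n)). ring. }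
    replace (vbr (c0 + (lam0 + h) * phi x)) with (vder 0 1 ((c0 + lam0 * phi x) + h * phi x))
      by (simpl vder; rewrite Rmult_1_r; f_equal; ring).
    apply (taylor_series (fun n => vder n 1) (c0 + lam0 * phi x - m - 1) b _ _ V q).
    + intros n t Ht. apply vder_derive; lra.
    + intros n t Ht. apply Hvd; lra.
    + unfold b; lra.
    + unfold b; lra.
    + lra.
    + apply Rle_lt_trans with (q * (r * phi l)); [|lra].
      apply Rmult_le_compat_l; lra.
Qed.

(** * Zeros of analytic functions *)

Definition real_analytic_at (f : R -> R) (x0 : R) : Prop :=
  exists r M a, 0 < r /\ (forall n, Rabs (a n) * r ^ n <= M) /\
    forall h, Rabs h < r -> is_series (fun n => a n * h ^ n) (f (x0 + h)).

Lemma is_series_shift (a : nat -> R) h s N : (forall n, (n < N)%nat -> a n = 0) ->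
  is_series (fun k => a (N + k)%nat * h ^ k) s -> is_series (fun n => a n * h ^ n) (h ^ N * s).
Proof.
  revert a; induction N as [|N IH]; intros a Ha Hs.
  - simpl. rewrite Rmult_1_l. exact Hs.
  - apply (is_series_decr_1 (K := R_AbsRing) (V := R_NormedModule)).
    rewrite (Ha O) by lia.
    match goal with |- is_series _ ?x => replace x with (h * (h ^ N * s) : R_NormedModule) by
      (unfold plus, opp; simpl; change (@eq R (h * (h ^ N * s)) (h * h ^ N * s + - (0 * 1))); ring) end.
    apply (is_series_ext (K := R_AbsRing) (V := R_NormedModule) (fun n => h * (a (S n) * h ^ n))).
    + intros n. simpl. change (@eq R (h * (a (S n) * h ^ n)) (a (S n) * (h * h ^ n))). ring.
    + apply (is_series_scal (K := R_AbsRing) (V := R_NormedModule) h (fun n => a (S n) * h ^ n)).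
      apply (IH (fun n => a (S n))); [intros; apply Ha; lia|exact Hs].
Qed.

(** If [a N] is the first nonzero coefficient, then [f (x0 + h) = h^N * s(h)] with [s] continuous at
    0 and [s(0) = a N]. *)
Lemma analytic_zero_alternative f x0 : real_analytic_at f x0 ->
  (exists d, 0 < d /\ forall h, Rabs h < d -> f (x0 + h) = 0) \/
  (exists d, 0 < d /\ forall h, 0 < Rabs h < d -> f (x0 + h) <> 0).
Proof.
  intros (r & M & a & Hr & Ha & Hs).
  destruct (classic (exists n, a n <> 0)) as [Hn|Hn].
  - right.
    destruct (Wf_nat.dec_inh_nat_subset_has_unique_least_element (fun n => a n <> 0)) as (N & [HN HN2] & _);
      [intros n; apply classic|exact Hn|].
    assert (HN0 : forall n, (n < N)%nat -> a n = 0).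
    { intros n Hlt. destruct (Req_dec (a n) 0) as [E|E]; [exact E|]. specialize (HN2 n E). lia. }
    set (b := fun k => a (N + k)%nat).
    assert (Hrn : 0 < r ^ N) by (apply pow_lt, Hr).
    assert (Hb : forall k, Rabs (b k) * r ^ k <= M / r ^ N).
    { intros k. apply Rmult_le_reg_r with (r ^ N); [exact Hrn|].
      unfold Rdiv. rewrite (Rmult_assoc M), Rinv_l, Rmult_1_r by lra.
      rewrite Rmult_assoc, <- pow_add, Nat.add_comm. apply Ha. }
    assert (CB : forall h, Rabs h < r -> Rbar_lt (Rabs h) (CV_radius b)).
    { intros h Hh. apply (bound_CV_radius b r (M / r ^ N)); assumption. }
    assert (Hc : continuity_pt (PSeries b) 0).
    { apply PSeries_continuity, CB. rewrite Rabs_R0; exact Hr. }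
    destruct (Hc (Rabs (a N))) as (d & Hd & Hd2); [apply Rabs_pos_lt, HN|].
    exists (Rmin r d). split; [apply Rmin_pos; assumption|].
    intros h [Hh0 Hh].
    assert (Hh1 : Rabs h < r) by (eapply Rlt_le_trans; [exact Hh|apply Rmin_l]).
    assert (Hh2 : Rabs h < d) by (eapply Rlt_le_trans; [exact Hh|apply Rmin_r]).
    assert (Hne : h <> 0) by (intros E; rewrite E, Rabs_R0 in Hh0; lra).
    assert (E : f (x0 + h) = h ^ N * PSeries b h).
    { rewrite <- (is_series_unique _ _ (Hs h Hh1)). apply is_series_unique.
      apply is_series_shift; [exact HN0|].
      apply (proj1 (is_pseries_R _ _ _)). apply PSeries_correct, CV_radius_inside, CB, Hh1. }
    rewrite E. apply Rmult_integral_contrapositive. split; [apply pow_nonzero, Hne|].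
    assert (Hd3 : Rabs (PSeries b h - PSeries b 0) < Rabs (a N)).
    { apply Hd2. split; [split; [exact Logic.I|auto]|]. simpl. unfold Rdist. rewrite Rminus_0_r. exact Hh2. }
    rewrite PSeries_0 in Hd3. unfold b at 2 in Hd3. rewrite Nat.add_0_r in Hd3.
    intros E0. rewrite E0, Rminus_0_l, Rabs_Ropp in Hd3. lra.
  - left. exists r. split; [exact Hr|]. intros h Hh.
    assert (Ha0 : forall n, a n = 0).
    { intros n. apply NNPP. intros E. apply Hn. exists n; exact E. }
    rewrite <- (is_series_unique _ _ (Hs h Hh)). apply is_series_unique.
    apply (is_series_finite _ 0); [intros; rewrite Ha0; ring|simpl; rewrite Ha0; ring].
Qed.

(** Identity theorem on a half-line. On the segment from [x1] to 0 the set of flat points is open,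
    and it is closed because a limit of zeros excludes the second case of
    [analytic_zero_alternative]; flatness at [x1] would thus reach 0. *)
Lemma analytic_not_flat f B x1 : 0 < B -> (forall x, x < B -> real_analytic_at f x) -> f 0 <> 0 ->
  x1 < B -> ~ exists d, 0 < d /\ forall h, Rabs h < d -> f (x1 + h) = 0.
Proof.
  intros HB Hf Hf0 Hx1.
  set (flat := fun x => exists d, 0 < d /\ forall h, Rabs h < d -> f (x + h) = 0).
  change (~ flat x1). intros F1.
  assert (Fz : forall x, flat x -> f x = 0).
  { intros x (d & Hd & H). rewrite <- (Rplus_0_r x). apply H. rewrite Rabs_R0; exact Hd. }
  assert (Hx0 : x1 <> 0) by (intros E; apply Hf0, Fz; rewrite E in F1; exact F1).
  assert (Hax : 0 < Rabs x1) by (apply Rabs_pos_lt, Hx0).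
  (* Runs from [x1] at [s = 0] to the origin at [s = 1], whatever the sign of [x1], and stays below
     [B]. *)
  set (g := fun s => x1 * (1 - s)).
  assert (Hg : forall s, 0 <= s <= 1 -> g s < B) by (intros s Hs; unfold g; nra).
  assert (Hgd : forall s t, Rabs (g s - g t) = Rabs x1 * Rabs (s - t)).
  { intros s t. unfold g. rewrite <- Rabs_mult, <- Rabs_Ropp. f_equal. ring. }
  set (E := fun s => 0 <= s <= 1 /\ forall t, 0 <= t <= s -> flat (g t)).
  assert (E0 : E 0).
  { split; [lra|]. intros t Ht. replace (g t) with x1; [exact F1|]. unfold g. replace t with 0 by lra. ring. }
  destruct (completeness E) as (s & Hub & Hlub).
  { exists 1. intros y [Hy _]. lra. }
  { exists 0; exact E0. }
  assert (Hs0 : 0 <= s) by (apply Hub, E0).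
  assert (Hs1 : s <= 1) by (apply Hlub; intros y [Hy _]; lra).
  assert (Hnear : forall e, 0 < e -> exists y, E y /\ s - e < y <= s).
  { intros e He. apply NNPP. intros Hn. assert (s <= s - e); [|lra].
    apply Hlub. intros y Hy. destruct (Rle_lt_dec y (s - e)) as [L|L]; [exact L|].
    exfalso. apply Hn. exists y. split; [exact Hy|]. split; [exact L|apply Hub, Hy]. }
  assert (Fs : flat (g s)).
  { destruct (analytic_zero_alternative f (g s)) as [F|(d & Hd & HdF)]; [apply Hf, Hg; lra|exact F|].
    destruct (Hnear (d / Rabs x1)) as (y & Ey & Hy); [apply Rdiv_lt_0_compat; assumption|].
    destruct (Req_dec y s) as [->|Hne]; [apply Ey; destruct Ey; lra|].
    assert (Hlt : y < s) by (destruct Hy as [_ [H|H]]; [exact H|contradiction]).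
    exfalso. apply (HdF (g y - g s)).
    - rewrite Hgd. split.
      + apply Rmult_lt_0_compat; [exact Hax|]. apply Rabs_pos_lt. lra.
      + rewrite (Rabs_left (y - s)) by lra.
        apply Rmult_lt_reg_r with (/ Rabs x1); [apply Rinv_0_lt_compat, Hax|].
        replace (Rabs x1 * - (y - s) * / Rabs x1) with (s - y) by (field; lra).
        unfold Rdiv in Hy. lra.
    - replace (g s + (g y - g s)) with (g y) by ring. apply Fz, Ey. destruct Ey; lra. }
  assert (Fl : forall t, 0 <= t < s -> flat (g t)).
  { intros t Ht. destruct (Hnear (s - t)) as (y & Ey & Hy); [lra|]. apply Ey. lra. }
  destruct (Rle_lt_or_eq_dec _ _ Hs1) as [L|Es].
  - destruct Fs as (d & Hd & HdF).
    set (e := Rmin (1 - s) (d / (2 * Rabs x1))).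
    assert (He : 0 < e) by (apply Rmin_pos; [lra|apply Rdiv_lt_0_compat; lra]).
    assert (He1 : e <= 1 - s) by apply Rmin_l.
    assert (He2 : Rabs x1 * e <= d / 2).
    { apply Rle_trans with (Rabs x1 * (d / (2 * Rabs x1))); [apply Rmult_le_compat_l; [lra|apply Rmin_r]|].
      right; field; lra. }
    assert (Ee : E (s + e)).
    { split; [lra|]. intros t Ht. destruct (Rlt_le_dec t s) as [Lt|Lt]; [apply Fl; lra|].
      exists (d / 2). split; [lra|]. intros h Hh.
      replace (g t + h) with (g s + (g t - g s + h)) by ring. apply HdF.
      eapply Rle_lt_trans; [apply Rabs_triang|]. rewrite Hgd, (Rabs_pos_eq (t - s)) by lra.
      assert (Rabs x1 * (t - s) <= Rabs x1 * e) by (apply Rmult_le_compat_l; lra). lra. }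
    specialize (Hub _ Ee). lra.
  - apply Hf0, Fz. replace (g s) with 0 in Fs by (unfold g; rewrite Es; ring). exact Fs.
Qed.

(** An isolated point is the only point of [Z] in some ball with rational center and radius
    [/ INR (S m)]; to each such ball [epsilon] attaches a point of [Z] inside it, if there is
    one. *)
Lemma isolated_countable (Z : R -> Prop) :
  (forall z, Z z -> exists d, 0 < d /\ forall z', Z z' -> Rabs (z' - z) < d -> z' = z) ->
  at_most_countable Z.
Proof.
  intros HZ.
  set (center := fun s k m => (if Nat.eqb s 0 then 1 else -1) * (INR k / INR (S m))).
  exists (fun n => let (s, n') := of_nat n in let (k, m) := of_nat n' in
    epsilon (inhabits 0) (fun z => Z z /\ Rabs (z - center s k m) < / INR (S m))).
  intros z Hz. destruct (HZ z Hz) as (d & Hd & Huniq).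
  (* The radius of the ball is below [d / 2], so two points in it are closer than [d]. *)
  destruct (archimed_cor1 (d / 2)) as (m & Hm & Hm0); [lra|].
  destruct m as [|m]; [lia|].
  assert (HSm : 0 < INR (S m)) by (apply lt_0_INR; lia).
  assert (Hi : 0 < / INR (S m)) by (apply Rinv_0_lt_compat, HSm).
  destruct (nfloor_ex (Rabs z * INR (S m))) as (k & Hk); [apply Rmult_le_pos; [apply Rabs_pos|lra]|].
  assert (Hkz : 0 <= Rabs z - INR k / INR (S m) < / INR (S m)).
  { replace (Rabs z - INR k / INR (S m)) with ((Rabs z * INR (S m) - INR k) * / INR (S m)) by (field; lra).
    split; [apply Rmult_le_pos; lra|]. rewrite <- (Rmult_1_l (/ INR (S m))) at 2.
    apply Rmult_lt_compat_r; lra. }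
  set (s := if Rle_dec 0 z then O else 1%nat).
  assert (Hc : Rabs (z - center s k m) < / INR (S m)).
  { unfold center, s. destruct (Rle_dec 0 z) as [H|H]; simpl Nat.eqb; cbv iota.
    - rewrite (Rabs_pos_eq z) in Hkz by exact H. rewrite Rmult_1_l, Rabs_pos_eq; lra.
    - rewrite (Rabs_left z) in Hkz by lra. rewrite Rabs_left1; lra. }
  exists (to_nat (s, to_nat (k, m))). rewrite cancel_of_to, cancel_of_to.
  destruct (epsilon_spec (inhabits 0) (fun z => Z z /\ Rabs (z - center s k m) < / INR (S m))) as [H1 H2].
  { exists z; split; assumption. }
  apply Huniq; [exact H1|].
  set (z' := epsilon _ _) in *.
  replace (z' - z) with ((z' - center s k m) - (z - center s k m)) by ring.
  eapply Rle_lt_trans; [apply Rabs_triang|]. rewrite Rabs_Ropp. lra.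
Qed.

Lemma countable_union (Z : nat -> R -> Prop) : (forall n, at_most_countable (Z n)) ->
  at_most_countable (fun x => exists n, Z n x).
Proof.
  intros H.
  set (e := fun n => proj1_sig (constructive_indefinite_description _ (H n))).
  exists (fun k => let (n, j) := of_nat k in e n j).
  intros x [n Hx].
  destruct (proj2_sig (constructive_indefinite_description _ (H n)) x Hx) as [j Hj].
  exists (to_nat (n, j)). rewrite cancel_of_to. exact Hj.
Qed.

Lemma analytic_zeros_countable f B : 0 < B -> (forall x, x < B -> real_analytic_at f x) -> f 0 <> 0 ->
  at_most_countable (fun x => x < B /\ f x = 0).
Proof.
  intros HB Hf Hf0. apply isolated_countable. intros z [HzB Hz].
  destruct (analytic_zero_alternative f z (Hf z HzB)) as [F|(d & Hd & H)].
  - exfalso. exact (analytic_not_flat f B z HB Hf Hf0 HzB F).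
  - exists d. split; [exact Hd|]. intros z' [_ Hz'] Hd'.
    destruct (Req_dec z' z) as [E|E]; [exact E|]. exfalso.
    apply (H (z' - z)).
    + split; [apply Rabs_pos_lt; lra|exact Hd'].
    + replace (z + (z' - z)) with z' by ring. exact Hz'.
Qed.

(** * The background solution *)

Lemma D_in_ext f g f' D x : (forall y, D y -> f y = g y) -> D x -> D_in f f' D x -> D_in g f' D x.
Proof.
  intros H Hx Hf eps He. destruct (Hf eps He) as (a & Ha & Hl). exists a. split; [exact Ha|].
  intros y Hy. rewrite <- (H x Hx), <- (H y) by apply Hy. apply Hl, Hy.
Qed.

Lemma D_in_interior f f' D x a b : D_in f f' D x -> a < x < b -> (forall y, a < y < b -> D y) ->
  is_derive f x (f' x).
Proof.
  intros H Hx HD. apply is_derive_Reals. intros eps He.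
  destruct (H eps He) as (d & Hd & Hl).
  assert (Hm : 0 < Rmin d (Rmin (x - a) (b - x))) by (repeat apply Rmin_pos; lra).
  exists (mkposreal _ Hm). intros h Hh0 Hh. simpl in Hh.
  pose proof (Rmin_l d (Rmin (x - a) (b - x))). pose proof (Rmin_r d (Rmin (x - a) (b - x))).
  pose proof (Rmin_l (x - a) (b - x)). pose proof (Rmin_r (x - a) (b - x)).
  specialize (Hl (x + h)). simpl in Hl. unfold Rdist in Hl.
  replace (x + h - x) with h in Hl by ring. apply Hl. split; [split|lra].
  - apply HD. assert (Hh2 : Rabs h < Rmin (x - a) (b - x)) by lra. apply Rabs_def2 in Hh2. lra.
  - lra.
Qed.

Lemma continue_in_cfun f D l : 0 <= l -> (forall x, 0 <= x <= l -> D x) ->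
  (forall x, 0 <= x <= l -> continue_in f D x) -> cfun (fun x => f (clamp l x)).
Proof.
  intros Hl HD H. apply cfun_eps. intros x eps He.
  destruct (H (clamp l x) (clamp_in l x Hl) eps He) as (d & Hd & Hc).
  exists d. split; [exact Hd|]. intros y Hy.
  destruct (Req_dec (clamp l x) (clamp l y)) as [E|E].
  - rewrite E, Rminus_diag, Rabs_R0. exact He.
  - apply (Hc (clamp l y)). split; [split; [apply HD, clamp_in, Hl|exact E]|].
    simpl. unfold Rdist. eapply Rle_lt_trans; [apply clamp_lip|exact Hy].
Qed.

Lemma D_in_cfun f f' D l : 0 <= l -> (forall x, 0 <= x <= l -> D x) ->
  (forall x, 0 <= x <= l -> D_in f f' D x) -> cfun (fun x => f (clamp l x)).
Proof.
  intros Hl HD H. apply (continue_in_cfun f D); [exact Hl|exact HD|].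
  intros x Hx. apply (cont_deriv f f' D), H, Hx.
Qed.

Lemma is_derive_clamp (f : R -> R) l x d : 0 < x < l -> is_derive f x d -> is_derive (fun x => f (clamp l x)) x d.
Proof.
  intros Hx H. apply (is_derive_ext_loc f); [|exact H].
  apply (locally_between 0 l); [exact Hx|]. intros y Hy. rewrite clamp_id; [reflexivity|lra].
Qed.

(** The derivative is available only in the open interval; continuity of the clamped function
    carries the identity to the endpoints. *)
Lemma primitive_on_icc (f g : R -> R) l : 0 <= l -> cfun (fun x => f (clamp l x)) -> cfun g ->
  (forall x, 0 < x < l -> is_derive f x (g x)) ->
  forall x, 0 <= x <= l -> f x = f 0 + RInt g 0 x.
Proof.
  intros Hl Hf Hg Hd x Hx.
  destruct (MVT_gen (fun y => f (clamp l y) - RInt g 0 y) 0 x (fun _ => 0)) as (c & Hc & E).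
  - rewrite Rmin_left, Rmax_right by lra. intros y Hy.
    evar_last.
    + apply (is_derive_minus (fun y => f (clamp l y)) (fun y => RInt g 0 y) y (g y) (g y)).
      * apply is_derive_clamp; [lra|apply Hd; lra].
      * apply cfun_RInt_derive, Hg.
    + apply Rplus_opp_r.
  - intros y _. apply continuity_pt_filterlim.
    apply (cfun_minus (fun y => f (clamp l y)) (fun y => RInt g 0 y)); [exact Hf|apply cfun_RInt, Hg].
  - cbv beta in E. rewrite !clamp_id, RInt_point in E by lra. unfold zero in E; simpl in E. lra.
Qed.

Lemma constant_on_icc (f : R -> R) l : 0 <= l -> cfun (fun x => f (clamp l x)) ->
  (forall x, 0 < x < l -> is_derive f x 0) -> forall x, 0 <= x <= l -> f x = f 0.
Proof.
  intros Hl Hf Hd x Hx. rewrite (primitive_on_icc f (fun _ => 0) l Hl Hf (cfun_const 0) Hd x Hx).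
  rewrite RInt_const. unfold scal; simpl; unfold mult; simpl. ring.
Qed.

Lemma sound_sq gamma p rho : 0 < gamma * p / rho -> sound_speed gamma p rho ^ 2 = gamma * p / rho.
Proof. intros H. unfold sound_speed. simpl. rewrite Rmult_1_r. apply sqrt_sqrt. lra. Qed.

Lemma mach_sq gamma p rho u : 0 < gamma -> 0 < p -> 0 < rho ->
  mach gamma p rho u ^ 2 = rho * u ^ 2 / (gamma * p).
Proof.
  intros Hg Hp Hr.
  assert (Hc : 0 < gamma * p / rho) by (apply Rdiv_lt_0_compat; [apply Rmult_lt_0_compat|]; assumption).
  unfold mach, Rdiv at 1. rewrite Rpow_mult_distr, pow2_abs, pow_inv, sound_sq by exact Hc.
  field. repeat split; lra.
Qed.

(* All states with the same momentum flux and energy flux are functions of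
   [y = u / us - 1], with [0 < y < 1] exactly in the subsonic regime. *)
Definition mflux (p0 rho0 u0 : R) : R := rho0 * u0 ^ 2 + p0.
Definition uref (gamma p0 rho0 u0 : R) : R :=
  (gamma - 1) * (/ 2 * rho0 * u0 ^ 3 + gamma / (gamma - 1) * p0 * u0) / (gamma * mflux p0 rho0 u0).

Definition u_of (us y : R) : R := us * (1 + y).
Definition p_of (gamma P y : R) : R := P / (gamma + 1) * (2 * gamma / (1 + y) - (gamma - 1)).
Definition rho_of (gamma P us y : R) : R :=
  2 * gamma * P / ((gamma + 1) * us ^ 2) * (y / (1 + y) ^ 3).

Lemma uref_pos gamma p rho u : 1 < gamma -> 0 < p -> 0 < rho -> 0 < u ->
  0 < mflux p rho u /\ 0 < uref gamma p rho u.
Proof.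
  intros Hg Hp Hr Hu.
  assert (HP : 0 < mflux p rho u).
  { unfold mflux. assert (0 < rho * u ^ 2) by (apply Rmult_lt_0_compat; [|apply pow_lt]; assumption). lra. }
  split; [exact HP|]. unfold uref. apply Rdiv_lt_0_compat; [|apply Rmult_lt_0_compat; lra].
  apply Rmult_lt_0_compat; [lra|].
  assert (0 < / 2 * rho * u ^ 3).
  { apply Rmult_lt_0_compat; [lra|apply pow_lt; assumption]. }
  assert (0 < gamma / (gamma - 1) * p * u).
  { repeat apply Rmult_lt_0_compat; try assumption; try lra. apply Rinv_0_lt_compat; lra. }
  lra.
Qed.

Lemma uref_ratio gamma p rho u : 1 < gamma -> 0 < p -> 0 < rho -> 0 < u ->
  u / uref gamma p rho u - 1 =
  (gamma + 1) * (rho * u ^ 2) / ((gamma - 1) * (rho * u ^ 2) + 2 * gamma * p).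
Proof.
  intros Hg Hp Hr Hu.
  assert (H1 : 0 < rho * u ^ 2) by (apply Rmult_lt_0_compat; [|apply pow_lt]; assumption).
  assert (H2 : 0 < gamma * p) by (apply Rmult_lt_0_compat; lra).
  assert (H3 : 0 < (gamma - 1) * (rho * u ^ 2)) by (apply Rmult_lt_0_compat; lra).
  unfold uref, mflux. field. repeat split; lra || nra.
Qed.

(** Everything is expressed through [rho * u^2] and [p]. By [uref_ratio], [y < 1] amounts to
    [rho * u^2 < gamma * p], that is, to [M^2 < 1]. *)
Lemma state_of_y gamma p rho u : 1 < gamma -> 0 < p -> 0 < rho -> 0 < u ->
  mach gamma p rho u < 1 ->
  let us := uref gamma p rho u in let y := u / us - 1 in
  0 < y < 1 /\ u = u_of us y /\ p = p_of gamma (mflux p rho u) y /\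
  rho = rho_of gamma (mflux p rho u) us y.
Proof.
  intros Hg Hp Hr Hu HM us y.
  destruct (uref_pos gamma p rho u Hg Hp Hr Hu) as [HP Hus]. fold us in Hus.
  assert (H1 : 0 < rho * u ^ 2) by (apply Rmult_lt_0_compat; [|apply pow_lt]; assumption).
  assert (H2 : 0 < gamma * p) by (apply Rmult_lt_0_compat; lra).
  assert (H3 : 0 < (gamma - 1) * (rho * u ^ 2)) by (apply Rmult_lt_0_compat; lra).
  assert (HMM : rho * u ^ 2 < gamma * p).
  { assert (Hm0 : 0 <= mach gamma p rho u).
    { unfold mach, sound_speed. apply Rmult_le_pos; [apply Rabs_pos|].
      left; apply Rinv_0_lt_compat, sqrt_lt_R0, Rdiv_lt_0_compat; assumption. }
    assert (Hm2 : mach gamma p rho u ^ 2 < 1) by nra.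
    rewrite mach_sq in Hm2 by lra.
    apply Rmult_lt_reg_r with (/ (gamma * p)); [apply Rinv_0_lt_compat, H2|].
    rewrite Rinv_r by lra. exact Hm2. }
  assert (Ey : y = (gamma + 1) * (rho * u ^ 2) / ((gamma - 1) * (rho * u ^ 2) + 2 * gamma * p))
    by (apply uref_ratio; assumption).
  assert (Eu : u = us * (1 + y)) by (unfold y; field; lra).
  assert (Hden : 0 < (gamma - 1) * (rho * u ^ 2) + 2 * gamma * p) by lra.
  assert (Hy : 0 < y < 1).
  { rewrite Ey. split; [apply Rdiv_lt_0_compat; [apply Rmult_lt_0_compat; lra|exact Hden]|].
    apply Rmult_lt_reg_r with ((gamma - 1) * (rho * u ^ 2) + 2 * gamma * p); [exact Hden|].
    unfold Rdiv. rewrite Rmult_assoc, Rinv_l by lra. lra. }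
  assert (Ey1 : 1 + y = 2 * gamma * mflux p rho u / ((gamma - 1) * (rho * u ^ 2) + 2 * gamma * p)).
  { rewrite Ey. unfold mflux. field. lra. }
  assert (Ep : p = p_of gamma (mflux p rho u) y).
  { unfold p_of. rewrite Ey1. unfold mflux in *. field. repeat split; lra. }
  split; [exact Hy|split; [exact Eu|split; [exact Ep|]]].
  assert (Ex : rho * u ^ 2 = 2 * gamma * mflux p rho u / (gamma + 1) * (y / (1 + y))).
  { rewrite Ey1, Ey. field. repeat split; lra. }
  unfold rho_of. apply Rmult_eq_reg_r with (u ^ 2); [|apply pow_nonzero; lra].
  rewrite Ex. replace (u ^ 2) with ((us * (1 + y)) ^ 2) by (rewrite <- Eu; reflexivity).
  field. repeat split; lra.
Qed.

Lemma psi_lt s : s < 0 -> s - exp s < -1.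
Proof.
  intros Hs. pose proof (sbr_mono s (s / 2) ltac:(lra) ltac:(lra)).
  pose proof (exp_ineq1_le (s / 2)). lra.
Qed.

(** [lam] times this is the increment of [ln y - y] over [0,x]; [phase0] is the value of [ln y - y]
    at the entrance. *)
Definition phase (l us : R) (mb : R -> R) (x : R) : R :=
  RInt (fun t => mb (clamp l t)) 0 (clamp l x) / us.

Definition phase0 (gamma p0 rho0 u0 : R) : R :=
  ln (u0 / uref gamma p0 rho0 u0 - 1) - (u0 / uref gamma p0 rho0 u0 - 1).

(** The two constant fluxes reduce the flow to [y], and [rho * u] becomes a multiple of
    [y / (1 + y)^2]. The mass equation then reads [y' * (1 - y) = lam * mb * y / us], that is,
    [(ln y - y)' = lam * mb / us]. Existence beyond [l] keeps [ln y] negative on [0,l], hence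
    [tau x < -1]. *)
Lemma background_explicit gamma kappa0 c_nu l p0 rho0 u0 mb lam U (L : Rbar) :
  1 < gamma -> 0 < kappa0 -> 0 < l -> Rbar_lt l L ->
  0 < p0 -> 0 < rho0 -> 0 < u0 -> mach gamma p0 rho0 u0 < 1 ->
  cfun (fun x => mb (clamp l x)) ->
  is_background_on gamma kappa0 c_nu mb lam U p0 rho0 u0 L ->
  let us := uref gamma p0 rho0 u0 in let P := mflux p0 rho0 u0 in
  let tau := fun x => phase0 gamma p0 rho0 u0 + lam * phase l us mb x in
  (forall x, 0 <= x <= l -> tau x < -1) /\
  (forall x, 0 <= x <= l ->
    vel U x = u_of us (exp (sbr (tau x))) /\ pres U x = p_of gamma P (exp (sbr (tau x))) /\
    dens U x = rho_of gamma P us (exp (sbr (tau x)))).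
Proof.
  intros Hg Hk Hl HL Hp0 Hr0 Hu0 HM0 Hmb ((E1 & E2 & E3) & (Sp & Sr & Su & _) & HB) us P tau.
  assert (Hico : forall x, 0 <= x <= l -> ico L x).
  { intros x Hx. split; [lra|]. apply Rbar_le_lt_trans with l; [simpl; lra|exact HL]. }
  destruct (uref_pos gamma p0 rho0 u0 Hg Hp0 Hr0 Hu0) as [HP Hus]. fold us in Hus. fold P in HP.
  assert (Hpos : forall x, 0 <= x <= l -> 0 < pres U x /\ 0 < dens U x /\ 0 < vel U x /\
    mach gamma (pres U x) (dens U x) (vel U x) < 1).
  { intros x Hx. destruct (HB x (Hico x Hx)) as (Ea & Ha & Hb & Hc & _).
    split; [|split; [exact Ha|split; [exact Hb|apply Hc]]].
    rewrite Ea. unfold A_of, Rpower. apply Rmult_lt_0_compat; [|apply exp_pos].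
    apply Rmult_lt_0_compat; [exact Hk|apply exp_pos]. }
  assert (HmP : forall x, 0 <= x <= l -> mflux (pres U x) (dens U x) (vel U x) = P).
  { intros x Hx. unfold P. rewrite <- E1, <- E2, <- E3.
    apply (constant_on_icc (fun x => dens U x * vel U x ^ 2 + pres U x) l); [lra| | |exact Hx].
    - apply (D_in_cfun (fun x => dens U x * vel U x ^ 2 + pres U x) (fun _ => 0) (ico L)); [lra|exact Hico|]. intros y Hy. apply HB, Hico, Hy.
    - intros y Hy. apply (D_in_interior _ (fun _ => 0) (ico L) y 0 l); [|exact Hy|intros; apply Hico; lra].
      apply HB, Hico; lra. }
  assert (HE : forall x, 0 <= x <= l -> dens U x * Etot gamma U x * vel U x =
    / 2 * dens U x * vel U x ^ 3 + gamma / (gamma - 1) * pres U x * vel U x).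
  { intros x Hx. destruct (Hpos x Hx) as (H1 & H2 & H3 & _). unfold Etot, sound.
    rewrite sound_sq, pow2_abs by (apply Rdiv_lt_0_compat; [apply Rmult_lt_0_compat; lra|assumption]).
    field. split; lra. }
  assert (Hur : forall x, 0 <= x <= l -> uref gamma (pres U x) (dens U x) (vel U x) = us).
  { intros x Hx. unfold us, uref. rewrite HmP by exact Hx.
    assert (E : dens U x * Etot gamma U x * vel U x = dens U 0 * Etot gamma U 0 * vel U 0).
    { apply (constant_on_icc (fun x => dens U x * Etot gamma U x * vel U x) l); [lra| | |exact Hx].
      - apply (D_in_cfun (fun x => dens U x * Etot gamma U x * vel U x) (fun _ => 0) (ico L)); [lra|exact Hico|]. intros y Hy. apply HB, Hico, Hy.
      - intros y Hy. apply (D_in_interior _ (fun _ => 0) (ico L) y 0 l); [|exact Hy|intros; apply Hico; lra].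
        apply HB, Hico; lra. }
    rewrite !HE in E by lra. rewrite E, E1, E2, E3. reflexivity. }
  set (y := fun x => vel U x / us - 1).
  assert (Hst : forall x, 0 <= x <= l -> 0 < y x < 1 /\ vel U x = u_of us (y x) /\
    pres U x = p_of gamma P (y x) /\ dens U x = rho_of gamma P us (y x)).
  { intros x Hx. destruct (Hpos x Hx) as (H1 & H2 & H3 & H4).
    pose proof (state_of_y gamma _ _ _ Hg H1 H2 H3 H4) as H. cbv zeta in H.
    rewrite HmP, Hur in H by exact Hx. exact H. }
  destruct Su as (F & F0 & F1).
  assert (Hud : forall x, 0 <= x <= l -> D_in (vel U) (F 1%nat) (ico L) x).
  { intros x Hx. apply (D_in_ext (F O)); [exact F0|apply Hico, Hx|apply F1, Hico, Hx]. }
  assert (Huc : cfun (fun x => vel U (clamp l x))).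
  { apply (D_in_cfun _ (F 1%nat) (ico L)); [lra|exact Hico|exact Hud]. }
  assert (Hyd : forall x, 0 < x < l -> exists y', is_derive y x y' /\ y' * (1 - y x) = lam * mb x * y x / us).
  { intros x Hx.
    assert (Hu : is_derive (vel U) x (F 1%nat x)).
    { apply (D_in_interior _ _ (ico L) x 0 l); [apply Hud; lra|exact Hx|intros; apply Hico; lra]. }
    assert (Hy : is_derive y x (F 1%nat x / us)).
    { unfold y. evar_last.
      - apply (is_derive_minus (fun x => vel U x / us) (fun _ => 1)).
        + apply (is_derive_ext (fun x => / us * vel U x)); [intros; apply Rmult_comm|].
          apply (is_derive_scal (vel U)), Hu.
        + apply (is_derive_const (V := R_NormedModule)).
      - unfold minus, plus, opp, zero; simpl. field. lra. }
    destruct (Hst x ltac:(lra)) as (H1 & H2 & H3 & H4).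
    exists (F 1%nat x / us). split; [exact Hy|].
    set (C := 2 * gamma * P / ((gamma + 1) * us ^ 2)).
    assert (HC : 0 < C).
    { unfold C. apply Rdiv_lt_0_compat; [|apply Rmult_lt_0_compat; [lra|apply pow_lt, Hus]].
      apply Rmult_lt_0_compat; lra. }
    assert (Hj : is_derive (fun x => dens U x * vel U x) x (lam * dens U x * mb x)).
    { apply (D_in_interior _ (fun x => lam * dens U x * mb x) (ico L) x 0 l); [|exact Hx|intros; apply Hico; lra].
      apply HB, Hico; lra. }
    assert (Hj2 : is_derive (fun x => dens U x * vel U x) x
      (F 1%nat x / us * (us * C * ((1 - y x) / (1 + y x) ^ 3)))).
    { apply (is_derive_ext_loc (fun x => us * C * (y x / (1 + y x) ^ 2))).
      - apply (locally_between 0 l); [exact Hx|]. intros t Ht.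
        destruct (Hst t ltac:(lra)) as (G1 & G2 & G3 & G4). rewrite G4. rewrite G2.
        unfold rho_of, u_of. fold C. match goal with |- ?a = ?b => change (@eq R a b) end. field. lra.
      - apply (is_derive_comp (fun y => us * C * (y / (1 + y) ^ 2)) y); [|exact Hy].
        auto_derive; [apply Rgt_not_eq; nra|]. field. lra. }
    pose proof (is_derive_unique _ _ _ Hj) as D1. rewrite (is_derive_unique _ _ _ Hj2) in D1.
    rewrite H4 in D1. unfold rho_of in D1. fold C in D1.
    (* The common positive factor of the two expressions for [(rho * u)']. *)
    apply Rmult_eq_reg_r with (us * C / (1 + y x) ^ 3).
    2: { apply Rgt_not_eq, Rdiv_lt_0_compat; [apply Rmult_lt_0_compat; assumption|apply pow_lt; lra]. }
    replace (F 1%nat x / us * (1 - y x) * (us * C / (1 + y x) ^ 3))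
      with (F 1%nat x / us * (us * C * ((1 - y x) / (1 + y x) ^ 3))) by (field; lra).
    rewrite D1. field. lra. }
  assert (Hyc : cfun (fun x => y (clamp l x))).
  { unfold y. apply (cfun_minus (fun x => vel U (clamp l x) / us) (fun _ => 1)); [|apply cfun_const].
    apply (cfun_mult _ (fun _ => / us)); [exact Huc|apply cfun_const]. }
  assert (Hpsi : forall x, 0 <= x <= l -> ln (y x) - exp (ln (y x)) = tau x).
  { intros x Hx. destruct (Hst x Hx) as ([H1 H1'] & _). rewrite exp_ln by exact H1.
    rewrite (primitive_on_icc (fun x => ln (y x) - y x) (fun t => lam / us * mb (clamp l t)) l).
    - unfold tau, phase0, phase. rewrite (clamp_id l x Hx).
      rewrite RInt_scal_c by exact Hmb. unfold y. rewrite E3. fold us.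
      unfold Rdiv. ring.
    - lra.
    - apply cfun_minus; [|exact Hyc]. intros t.
      apply (continuous_comp (fun x => y (clamp l x)) ln); [apply Hyc|].
      apply continuity_pt_filterlim, derivable_continuous_pt.
      exists (/ y (clamp l t)). apply derivable_pt_lim_ln. apply Hst, clamp_in; lra.
    - apply (cfun_mult (fun _ => lam / us)); [apply cfun_const|exact Hmb].
    - intros t Ht. destruct (Hyd t Ht) as (y' & Hy' & Ey'). rewrite clamp_id by lra.
      destruct (Hst t ltac:(lra)) as ([G1 G1'] & _).
      replace (lam / us * mb t) with (minus (scal y' (/ y t)) y').
      + apply (is_derive_minus (fun t => ln (y t)) y); [|exact Hy'].
        apply (is_derive_comp ln y); [|exact Hy']. apply is_derive_Reals, derivable_pt_lim_ln, G1.
      + unfold minus, plus, opp, scal; simpl; unfold mult; simpl.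
        apply Rmult_eq_reg_r with (y t); [|lra].
        replace ((y' * / y t + - y') * y t) with (y' * (1 - y t)) by (field; lra).
        rewrite Ey'. field. lra.
    - exact Hx. }
  assert (Hln : forall x, 0 <= x <= l -> ln (y x) < 0).
  { intros x Hx. destruct (Hst x Hx) as ([H1 H1'] & _). rewrite <- ln_1. apply ln_increasing; assumption. }
  split.
  - intros x Hx. rewrite <- Hpsi by exact Hx. apply psi_lt, Hln, Hx.
  - intros x Hx. rewrite <- Hpsi by exact Hx. rewrite sbr_unique by (apply Hln, Hx).
    destruct (Hst x Hx) as ([H1 H1'] & H2). rewrite exp_ln by exact H1. exact H2.
Qed.

(** * The mode system *)

(* The coefficients of the mode equation as functions of the pointwise values of
   the background state.  Those that carry a factor [rho^(gamma-1)] or [A] in the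
   definitions are taken without it: they act on [W2 * rho^(gamma-1)]. *)
Section Coefficients.

Variables (gamma lam m m1 u rho p dp ddp rlog : R).

Definition csq : R := gamma * p / rho.
Definition Msq : R := rho * u ^ 2 / (gamma * p).
Definition k_E : R := / 2 * u ^ 2 + csq / (gamma - 1).

Definition k_a1 : R := m / u * (1 / 2 - 1 / ((gamma - 1) * Msq)).
Definition k_a2 : R := m * k_E / ((gamma - 1) * u ^ 3).
Definition k_a3 : R := m * k_E / (rho * u ^ 3).
Definition k_b1 : R := gamma * m * (p / rho) / u ^ 3 * (1 + (gamma - 1) / 2 * Msq).
Definition k_b2 : R :=
  m / u * (gamma + 1 / 2 - (gamma - 1) ^ 2 / 2 * Msq + 1 / ((gamma - 1) * Msq)).
Definition k_b3 : R :=
  gamma * m * (p / rho) / (u ^ 3 * rho) *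
  (1 + (gamma - 1) / 2 * Msq + (gamma - 1) ^ 2 / 2 * Msq ^ 2).

Definition k_c1 : R := (1 - Msq) / (rho * u).
Definition k_c2 : R :=
  - (lam * m / (2 * rho * csq)) *
  (((gamma - 1) ^ 2 * Msq ^ 4 + (gamma - 1) * Msq ^ 3
    + (5 * gamma ^ 2 - 12 * gamma + 10) * Msq ^ 2 + (7 * gamma - 11) * Msq + 2)
   / (Msq * (1 - Msq))).
Definition k_c3 : R :=
  lam * m / (2 * u ^ 2) *
  ((3 * (gamma - 1) * Msq ^ 2 + (gamma + 3) * Msq + 2) / (1 - Msq)).
Definition k_c4 : R :=
  - (lam * m / (2 * csq)) *
  (((gamma - 1) * Msq ^ 4 + (gamma - 1) * Msq ^ 3
    + (2 * gamma - 6) * Msq ^ 2 + (gamma + 5) * Msq + 2)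
   / (Msq * (1 - Msq))).

Definition k_d1 : R :=
  - (2 * u ^ 2 / p) * (1 + 1 / (gamma * Msq ^ 2)) * dp
  + lam * m * csq / u * ((gamma - 1) ^ 2 / 2 * Msq ^ 2 + (gamma - 1) / 2 * Msq - 1).
Definition k_d2 : R :=
  u ^ 2 / p * (1 + 1 / (gamma * Msq ^ 2)) * dp ^ 2
  - lam * gamma * u * (1 + (gamma - 1) / 2 * Msq) * m1
  + gamma * lam ^ 2 * m ^ 2 * ((gamma - 1) ^ 2 / 4 * (u ^ 4 / csq ^ 2) - 1).
Definition k_d3 : R :=
  2 * ddp - 2 / p * (1 - 1 / (gamma * Msq ^ 2)) * dp ^ 2
  - lam * (gamma - 1) * rho * u * m1.
Definition k_d4 : R :=
  lam * m * ((3 * (gamma - 1) ^ 2 + 2) * Msq + (gamma - 1)) / 2 * dp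
  - gamma * p * (lam * (gamma - 1) * Msq + 2 * lam) / 2 * m1
  + gamma * lam ^ 2 * (gamma - 1) ^ 2 * m ^ 2 * u ^ 3 * p / csq ^ 2.
Definition k_d5 : R :=
  - ((gamma + 1) / (gamma - 1)) * ddp
  + 2 / ((gamma - 1) * p) * (1 - (1 + (gamma - 1) * Msq) / (gamma * Msq ^ 2)) * dp ^ 2
  + lam * m / u * dp * (1 - (gamma - 1) ^ 2 * Msq ^ 2 / 2)
  + lam * rho * u * (1 + (gamma - 1) / 2 * Msq) * m1
  - gamma * lam ^ 2 * (gamma - 1) ^ 2 * m ^ 2 * u ^ 4 * p / (2 * csq ^ 3).

Definition k_e1 : R := Msq - 1.
Definition k_e2 : R := k_d1 / csq.
Definition k_e3 : R := k_d2 / csq + ((gamma - 1) * k_d5 - k_d4 / u) / (rho * csq).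
Definition k_e4 : R := k_d3 / csq + k_d4 / (u * csq).
Definition k_e5 : R := 1 / ((gamma - 1) * csq) * ((gamma - 1) * k_d5 - k_d4 / u).
Definition k_e (cj : R) : R := lam * gamma * m * p * cj / PI / csq.

(* Matrix of the first-order system for [(q, q', W1, rho^(gamma-1) W2)] with
   [(W1, W2) = Phi (int a4 q, int b4 q)]; [sigma] is [PI] for the mode 0 and 0
   otherwise, [kk] is the square of the mode, [rlog] is [rho'/rho]. *)
Definition mode_matrix (sigma kk : R) (i j : nat) : R :=
  match i, j with
  | 0%nat, 1%nat => 1
  | 1%nat, 0%nat => - (k_e3 + sigma * k_e k_c2 + kk) / k_e1
  | 1%nat, 1%nat => - (lam * k_e2 + sigma * k_e k_c1) / k_e1
  | 1%nat, 2%nat => - (lam * (k_e4 + sigma * k_e k_c3)) / k_e1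
  | 1%nat, 3%nat => - (lam * (k_e5 + sigma * k_e k_c4)) / k_e1
  | 2%nat, 0%nat => k_a3
  | 2%nat, 2%nat => lam * k_a1
  | 2%nat, 3%nat => lam * k_a2
  | 3%nat, 0%nat => k_b3
  | 3%nat, 2%nat => lam * k_b1
  | 3%nat, 3%nat => (gamma - 1) * rlog + lam * k_b2
  | _, _ => 0
  end.

End Coefficients.

Lemma analytic_cfun l lam0 F : analytic_at l lam0 F ->
  cfun (fun x => F x lam0) /\ forall x, F (clamp l x) lam0 = F x lam0.
Proof.
  intros (r & M & a & Hr & HF).
  pose proof (fun x => expansion_0 _ _ _ _ _ _ x Hr HF) as E.
  destruct HF as (H1 & H2 & _). split.
  - intros x. apply (continuous_ext (a O)); [exact E|apply H1].
  - intros x. rewrite <- !E. apply H2.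
Qed.

Ltac neq0 x := cbv beta;
  repeat match goal with
  | H : forall y : R, @?P y <> 0 |- _ => exact (H x)
  | |- _ * _ <> 0 => apply Rmult_integral_contrapositive_currified
  | |- _ ^ _ <> 0 => apply pow_nonzero
  | |- PI <> 0 => exact PI_neq0
  | |- _ <> 0 => apply Rgt_not_eq; lra
  end.

(** Follows the syntax of a rational expression. Hypotheses come first so that [csq], [Msq] and
    other quantities already known to be analytic stay folded; the constant case comes last. *)
Ltac analytic hl :=
  lazymatch goal with
  | H : analytic_at ?l ?l0 ?F |- analytic_at ?l ?l0 ?F => exact H
  | H : analytic_at ?l ?l0 ?f |- analytic_at ?l ?l0 (fun x lam => ?f x lam) => exact H
  | |- analytic_at _ _ (fun x lam => lam) => apply analytic_param
  | |- analytic_at _ _ (fun x lam => @?F x lam + @?G x lam) =>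
      apply (analytic_plus _ _ F G); analytic hl
  | |- analytic_at _ _ (fun x lam => @?F x lam - @?G x lam) =>
      apply (analytic_minus _ _ F G hl); analytic hl
  | |- analytic_at _ _ (fun x lam => @?F x lam * @?G x lam) =>
      apply (analytic_mult _ _ F G); analytic hl
  | |- analytic_at _ _ (fun x lam => @?F x lam / @?G x lam) =>
      apply (analytic_div _ _ F G hl);
        [analytic hl|analytic hl|let x := fresh "x" in intros x; neq0 x]
  | |- analytic_at _ _ (fun x lam => / @?F x lam) =>
      apply (analytic_inv _ _ F hl); [analytic hl|let x := fresh "x" in intros x; neq0 x]
  | |- analytic_at _ _ (fun x lam => - @?F x lam) =>
      apply (analytic_opp _ _ F hl); analytic hl
  | |- analytic_at _ _ (fun x lam => @?F x lam ^ ?n) =>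
      apply (analytic_pow _ _ F n hl); analytic hl
  | |- analytic_at _ _ (fun x lam => ?c) => exact (analytic_const _ _ c hl)
  end.

(** The entries are rational, with denominators composed of constants, [u], [rho], [p], [csq], [Msq]
    and, up to sign, [1 - Msq]; the last is where subsonicity enters. *)
Lemma mode_matrix_analytic l lam0 gamma sigma kk (m m1 u rho p dp ddp rlog : R -> R -> R) :
  0 <= l -> 1 < gamma ->
  analytic_at l lam0 m -> analytic_at l lam0 m1 -> analytic_at l lam0 u ->
  analytic_at l lam0 rho -> analytic_at l lam0 p -> analytic_at l lam0 dp ->
  analytic_at l lam0 ddp -> analytic_at l lam0 rlog ->
  (forall x, 0 < u x lam0) -> (forall x, 0 < rho x lam0) -> (forall x, 0 < p x lam0) ->
  (forall x, Msq gamma (u x lam0) (rho x lam0) (p x lam0) < 1) ->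
  forall i j, analytic_at l lam0 (fun x lam => mode_matrix gamma lam (m x lam) (m1 x lam) (u x lam)
    (rho x lam) (p x lam) (dp x lam) (ddp x lam) (rlog x lam) sigma kk i j).
Proof.
  intros hl hg Am Am1 Au Arho Ap Adp Addp Arl Hu Hrho Hp HM.
  assert (Nu : forall x, u x lam0 <> 0) by (intros x; apply Rgt_not_eq, Hu).
  assert (Nrho : forall x, rho x lam0 <> 0) by (intros x; apply Rgt_not_eq, Hrho).
  assert (Np : forall x, p x lam0 <> 0) by (intros x; apply Rgt_not_eq, Hp).
  assert (Acsq : analytic_at l lam0 (fun x lam => csq gamma (rho x lam) (p x lam)))
    by (unfold csq; analytic hl).
  assert (AMsq : analytic_at l lam0 (fun x lam => Msq gamma (u x lam) (rho x lam) (p x lam)))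
    by (unfold Msq; analytic hl).
  assert (Ncsq : forall x, csq gamma (rho x lam0) (p x lam0) <> 0).
  { intros x; unfold csq. apply Rgt_not_eq, Rdiv_lt_0_compat; [apply Rmult_lt_0_compat; [lra|apply Hp]|apply Hrho]. }
  assert (NMsq : forall x, Msq gamma (u x lam0) (rho x lam0) (p x lam0) <> 0).
  { intros x; unfold Msq. apply Rgt_not_eq, Rdiv_lt_0_compat.
    - apply Rmult_lt_0_compat; [apply Hrho|apply pow_lt, Hu].
    - apply Rmult_lt_0_compat; [lra|apply Hp]. }
  assert (N1M : forall x, 1 - Msq gamma (u x lam0) (rho x lam0) (p x lam0) <> 0)
    by (intros x; specialize (HM x); apply Rgt_not_eq; lra).
  assert (NM1 : forall x, Msq gamma (u x lam0) (rho x lam0) (p x lam0) - 1 <> 0)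
    by (intros x; specialize (HM x); apply Rlt_not_eq; lra).
  assert (Ad4 : analytic_at l lam0 (fun x lam => k_d4 gamma lam (m x lam) (m1 x lam) (u x lam) (rho x lam) (p x lam) (dp x lam)))
    by (unfold k_d4; analytic hl).
  assert (Ad5 : analytic_at l lam0 (fun x lam => k_d5 gamma lam (m x lam) (m1 x lam) (u x lam) (rho x lam) (p x lam) (dp x lam) (ddp x lam)))
    by (unfold k_d5; analytic hl).
  assert (AE : analytic_at l lam0 (fun x lam => k_E gamma (u x lam) (rho x lam) (p x lam)))
    by (unfold k_E; analytic hl).
  intros i j.
  destruct i as [|[|[|[|i]]]]; destruct j as [|[|[|[|j]]]]; cbn [mode_matrix];
    try (apply analytic_const; exact hl);
    unfold k_e1, k_e2, k_e3, k_e4, k_e5, k_e, k_d1, k_d2, k_d3, k_c1, k_c2, k_c3, k_c4,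
      k_a1, k_a2, k_a3, k_b1, k_b2, k_b3; analytic hl.
Qed.

(* With [y' = lam mb y / (us (1 - y))]: p' = lam mb p1_of, (p1_of)' = lam mb p2_of
   and rho' / rho = lam mb r1_of. *)
Definition p1_of (gamma P us y : R) : R :=
  - (2 * gamma * P / ((gamma + 1) * us)) * (y / ((1 - y) * (1 + y) ^ 2)).
Definition p2_of (gamma P us y : R) : R :=
  - (2 * gamma * P / ((gamma + 1) * us)) *
  ((1 - y + 2 * y ^ 2) * y / (us * (1 - y) ^ 3 * (1 + y) ^ 3)).
Definition r1_of (us y : R) : R := (1 - 2 * y) / (us * (1 + y) * (1 - y)).

(** In the variable [y] one has [Msq = 2 y / (2 gamma - (gamma - 1) (1 + y))], which is below 1
    because [y < 1]. *)
Lemma state_bounds gamma P us y : 1 < gamma -> 0 < P -> 0 < us -> 0 < y < 1 ->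
  0 < u_of us y /\ 0 < rho_of gamma P us y /\ 0 < p_of gamma P y /\
  Msq gamma (u_of us y) (rho_of gamma P us y) (p_of gamma P y) < 1.
Proof.
  intros Hg HP Hus Hy.
  assert (Hn : 0 < 2 * gamma - (gamma - 1) * (1 + y)) by nra.
  assert (Hp : p_of gamma P y = P / (gamma + 1) * ((2 * gamma - (gamma - 1) * (1 + y)) / (1 + y)))
    by (unfold p_of; field; lra).
  assert (Hp0 : 0 < p_of gamma P y).
  { rewrite Hp. apply Rmult_lt_0_compat; apply Rdiv_lt_0_compat; lra. }
  split; [apply Rmult_lt_0_compat; lra|split; [|split; [exact Hp0|]]].
  - unfold rho_of. apply Rmult_lt_0_compat.
    + apply Rdiv_lt_0_compat; [apply Rmult_lt_0_compat; lra|].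
      apply Rmult_lt_0_compat; [lra|apply pow_lt, Hus].
    + apply Rdiv_lt_0_compat; [lra|apply pow_lt; lra].
  - assert (E : Msq gamma (u_of us y) (rho_of gamma P us y) (p_of gamma P y) =
      2 * y / (2 * gamma - (gamma - 1) * (1 + y))).
    { unfold Msq. rewrite Hp. unfold rho_of, u_of. field. repeat split; lra. }
    rewrite E. apply Rmult_lt_reg_r with (2 * gamma - (gamma - 1) * (1 + y)); [exact Hn|].
    unfold Rdiv. rewrite Rmult_assoc, Rinv_l by lra. nra.
Qed.

(** * The value at the outlet as an analytic function of [lam] *)

Section Modes.

Variables (gamma l p0 rho0 u0 G0 : R) (mb mb1 : R -> R).
Hypothesis hgamma : 1 < gamma.
Hypothesis hl : 0 < l.
Hypothesis hp0 : 0 < p0.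
Hypothesis hrho0 : 0 < rho0.
Hypothesis hu0 : 0 < u0.
Hypothesis hM0 : mach gamma p0 rho0 u0 < 1.
Hypothesis mb_cont : cfun (fun x => mb (clamp l x)).
Hypothesis mb1_cont : cfun (fun x => mb1 (clamp l x)).
Hypothesis mb_pos : forall x, 0 <= x <= l -> 0 < mb x.

Let us := uref gamma p0 rho0 u0.
Let P := mflux p0 rho0 u0.
Let hl0 : 0 <= l := Rlt_le _ _ hl.

Definition tau_of (x lam : R) : R := phase0 gamma p0 rho0 u0 + lam * phase l (uref gamma p0 rho0 u0) mb x.
Definition y_at (x lam : R) : R := exp (sbr (tau_of x lam)).
(** The [lam] for which [tau_of] reaches the sonic value -1 at the outlet. [phase] is nonnegative
    and largest there, so below this value the state is subsonic on all of [0,l], in particular for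
    every [lam <= 0]. *)
Definition lam_max : R := (-1 - phase0 gamma p0 rho0 u0) / phase l (uref gamma p0 rho0 u0) mb l.

(** Written through [y_at] rather than a flow, so that it is available for all [lam] before any
    background solution is given. *)
Definition flow_matrix (sigma kk : R) (i j : nat) (x lam : R) : R :=
  let us := uref gamma p0 rho0 u0 in let P := mflux p0 rho0 u0 in
  let y := y_at x lam in let m := mb (clamp l x) in
  mode_matrix gamma lam m (mb1 (clamp l x)) (u_of us y) (rho_of gamma P us y) (p_of gamma P y)
    (lam * m * p1_of gamma P us y)
    (lam * mb1 (clamp l x) * p1_of gamma P us y + lam ^ 2 * m ^ 2 * p2_of gamma P us y)
    (lam * m * r1_of us y) sigma kk i j.

(** Cauchy data normalised by [q 0 = 1]; [G0] stands for [gamma0], and the two integral unknowns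
    start at 0. *)
Definition entrance (i : nat) (lam : R) : R :=
  match i with 0%nat => 1 | 1%nat => - lam * G0 | _ => 0 end.

(** The value at [l] of the normalised solution. [analytic_linear_system] yields a family only near
    each [lam0], possibly another one for another [lam0], so a single function of [lam] is defined
    by [epsilon] and compared with the families by uniqueness. *)
Definition mode_value (sigma kk lam : R) : R :=
  epsilon (inhabits 0) (fun d => exists z : nat -> R -> R,
    (forall i, (i <= 3)%nat -> cfun (z i)) /\
    linear_solution l 3 (fun i j x => flow_matrix sigma kk i j x lam) (fun i _ => entrance i lam) z /\
    z O l = d).

Lemma P_us_pos : 0 < P /\ 0 < us.
Proof. apply uref_pos; assumption. Qed.

Lemma phase_cfun : cfun (phase l us mb).
Proof.
  apply (cfun_mult _ (fun _ => / us)); [|apply cfun_const].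
  apply (cfun_comp (clamp l) (fun y => RInt (fun t => mb (clamp l t)) 0 y)); [apply cfun_clamp|].
  apply cfun_RInt, mb_cont.
Qed.

Lemma phase_clamp x : phase l us mb (clamp l x) = phase l us mb x.
Proof. unfold phase. rewrite clamp_idem by exact hl0. reflexivity. Qed.

Lemma phase_bounds : 0 < phase l us mb l /\ forall x, 0 <= phase l us mb x <= phase l us mb l.
Proof.
  destruct P_us_pos as [_ Hus]. unfold phase.
  assert (Hm : forall t, 0 < mb (clamp l t)) by (intros t; apply mb_pos, clamp_in, hl0).
  assert (Hi : 0 < / us) by apply Rinv_0_lt_compat, Hus.
  rewrite (clamp_id l l) by lra. split.
  - apply Rmult_lt_0_compat; [|exact Hi]. apply RInt_gt_0; [exact hl|intros; apply Hm|intros; apply mb_cont].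
  - intros x. pose proof (clamp_in l x hl0) as Hx.
    assert (Hnn : forall a b, a <= b -> 0 <= RInt (fun t => mb (clamp l t)) a b).
    { intros a b Hab. apply RInt_ge_0; [exact Hab|apply cfun_ex_RInt, mb_cont|intros; left; apply Hm]. }
    split; [apply Rmult_le_pos; [apply Hnn; lra|lra]|].
    apply Rmult_le_compat_r; [lra|].
    rewrite <- (RInt_Chasles (fun t => mb (clamp l t)) 0 (clamp l x) l) by apply cfun_ex_RInt, mb_cont.
    specialize (Hnn (clamp l x) l ltac:(lra)). unfold plus; simpl. lra.
Qed.

Lemma phase0_lt : phase0 gamma p0 rho0 u0 < -1.
Proof.
  destruct (state_of_y gamma p0 rho0 u0) as (Hy & _); try assumption.
  unfold phase0. fold us in Hy. fold us.
  rewrite <- (exp_ln (u0 / us - 1)) at 2 by lra. apply psi_lt.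
  rewrite <- ln_1. apply ln_increasing; lra.
Qed.

Lemma lam_max_pos : 0 < lam_max.
Proof.
  pose proof phase0_lt. apply Rdiv_lt_0_compat; [lra|apply phase_bounds].
Qed.

Lemma tau_end_lt lam : lam < lam_max <-> phase0 gamma p0 rho0 u0 + lam * phase l us mb l < -1.
Proof.
  destruct phase_bounds as [Hp _]. unfold lam_max. fold us.
  assert (E : (-1 - phase0 gamma p0 rho0 u0) / phase l us mb l * phase l us mb l = -1 - phase0 gamma p0 rho0 u0)
    by (field; lra).
  split; intros H.
  - apply (Rmult_lt_compat_r _ _ _ Hp) in H. lra.
  - apply Rmult_lt_reg_r with (phase l us mb l); [exact Hp|lra].
Qed.

Lemma tau_lt lam x : lam < lam_max -> tau_of x lam < -1.
Proof.
  intros H. apply tau_end_lt in H. pose proof phase0_lt. unfold tau_of. fold us.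
  destruct phase_bounds as [Hp Hb]. specialize (Hb x).
  destruct (Rle_lt_dec 0 lam); nra.
Qed.

Lemma y_at_bounds lam x : lam < lam_max -> 0 < y_at x lam < 1.
Proof. intros H. apply exp_sbr_bounds, tau_lt, H. Qed.

Lemma y_at_analytic lam0 : lam0 < lam_max -> analytic_at l lam0 y_at.
Proof.
  intros H.
  apply (analytic_ext l lam0 (fun x lam => 1 - / vbr (tau_of x lam))).
  { intros x lam. unfold vbr. rewrite Rinv_inv. unfold y_at. ring. }
  assert (A : analytic_at l lam0 (fun x lam => vbr (tau_of x lam))).
  { apply analytic_vbr; [exact hl0|exact phase_cfun|exact phase_clamp|apply phase_bounds|apply phase_bounds|
      exact phase0_lt|apply tau_end_lt, H]. }
  apply analytic_minus; [exact hl0|apply analytic_const, hl0|].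
  apply (analytic_inv _ _ (fun x lam => vbr (tau_of x lam))); [exact hl0|exact A|].
  intros x. pose proof (vbr_ge1 _ (tau_lt lam0 x H)). lra.
Qed.

Lemma flow_matrix_analytic sigma kk lam0 : lam0 < lam_max ->
  forall i j, analytic_at l lam0 (flow_matrix sigma kk i j).
Proof.
  intros H i j. destruct P_us_pos as [HP Hus].
  pose proof (y_at_analytic lam0 H) as Ay.
  pose proof (fun x => y_at_bounds lam0 x H) as Hy.
  assert (Am : analytic_at l lam0 (fun x _ => mb (clamp l x))).
  { apply (analytic_fun l lam0 (fun x => mb (clamp l x)) hl0 mb_cont).
    intros x; rewrite clamp_idem by exact hl0; reflexivity. }
  assert (Am1 : analytic_at l lam0 (fun x _ => mb1 (clamp l x))).
  { apply (analytic_fun l lam0 (fun x => mb1 (clamp l x)) hl0 mb1_cont).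
    intros x; rewrite clamp_idem by exact hl0; reflexivity. }
  assert (N1 : forall x, 1 + y_at x lam0 <> 0) by (intros x; specialize (Hy x); lra).
  assert (N2 : forall x, 1 - y_at x lam0 <> 0) by (intros x; specialize (Hy x); lra).
  assert (A1 : analytic_at l lam0 (fun x lam => p1_of gamma P us (y_at x lam)))
    by (unfold p1_of; analytic hl0).
  unfold flow_matrix. fold us P. cbv zeta.
  apply (mode_matrix_analytic l lam0 gamma sigma kk (fun x _ => mb (clamp l x)) (fun x _ => mb1 (clamp l x))
    (fun x lam => u_of us (y_at x lam)) (fun x lam => rho_of gamma P us (y_at x lam))
    (fun x lam => p_of gamma P (y_at x lam))
    (fun x lam => lam * mb (clamp l x) * p1_of gamma P us (y_at x lam))
    (fun x lam => lam * mb1 (clamp l x) * p1_of gamma P us (y_at x lam) +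
       lam ^ 2 * mb (clamp l x) ^ 2 * p2_of gamma P us (y_at x lam))
    (fun x lam => lam * mb (clamp l x) * r1_of us (y_at x lam))).
  - exact hl0.
  - exact hgamma.
  - exact Am.
  - exact Am1.
  - unfold u_of; analytic hl0.
  - unfold rho_of; analytic hl0.
  - unfold p_of; analytic hl0.
  - analytic hl0.
  - unfold p2_of; analytic hl0.
  - unfold r1_of; analytic hl0.
  - intros x; apply (state_bounds gamma P us _ hgamma HP Hus (Hy x)).
  - intros x; apply (state_bounds gamma P us _ hgamma HP Hus (Hy x)).
  - intros x; apply (state_bounds gamma P us _ hgamma HP Hus (Hy x)).
  - intros x; apply (state_bounds gamma P us _ hgamma HP Hus (Hy x)).
Qed.

Lemma entrance_analytic lam0 i : analytic_at l lam0 (fun _ lam => entrance i lam).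
Proof.
  destruct i as [|[|i]]; simpl.
  - apply analytic_const, hl0.
  - analytic hl0.
  - apply analytic_const, hl0.
Qed.

Lemma mode_value_spec sigma kk lam : lam < lam_max -> exists z : nat -> R -> R,
  (forall i, (i <= 3)%nat -> cfun (z i)) /\
  linear_solution l 3 (fun i j x => flow_matrix sigma kk i j x lam) (fun i _ => entrance i lam) z /\
  z O l = mode_value sigma kk lam.
Proof.
  intros H. unfold mode_value.
  apply (epsilon_spec (inhabits 0) (fun d => exists z : nat -> R -> R,
    (forall i, (i <= 3)%nat -> cfun (z i)) /\
    linear_solution l 3 (fun i j x => flow_matrix sigma kk i j x lam) (fun i _ => entrance i lam) z /\
    z O l = d)).
  destruct (analytic_linear_system l lam 3 (flow_matrix sigma kk) (fun i _ lam => entrance i lam) hl0)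
    as (Z & _ & d & Hd & HZ).
  - intros i j _ _. apply flow_matrix_analytic, H.
  - intros i _. apply entrance_analytic.
  (* At [h = 0] the analytic family is a solution for the given [lam]. *)
  - destruct (HZ 0) as [H1 H2]; [rewrite Rabs_R0; exact Hd|].
    rewrite Rplus_0_r in H2. 
    exists (Z O l lam), (fun i x => Z i x lam). split; [|split; [exact H2|reflexivity]].
    intros i Hi. specialize (H1 i Hi). rewrite Rplus_0_r in H1. exact H1.
Qed.

(** Linearity in the entrance data. The factor [c] is 1 when an analytic family is compared with
    [mode_value], and [q 0] for an actual solution of the mode problem. *)
Lemma mode_value_unique sigma kk lam c (z : nat -> R -> R) : lam < lam_max ->
  (forall i, (i <= 3)%nat -> cfun (z i)) ->
  (forall x i, 0 <= x <= l -> (i <= 3)%nat -> z i x = c * entrance i lam +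
     RInt (fun t => sum_f_R0 (fun j => flow_matrix sigma kk i j t lam * z j t) 3) 0 x) ->
  forall w, (forall i, (i <= 3)%nat -> cfun (w i)) ->
  linear_solution l 3 (fun i j x => flow_matrix sigma kk i j x lam) (fun i _ => entrance i lam) w ->
  forall x, 0 <= x <= l -> z O x = c * w O x.
Proof.
  intros H Hz Hze w Hw Hwe x Hx.
  pose proof (fun i j => analytic_cfun _ _ _ (flow_matrix_analytic sigma kk lam H i j)) as HB.
  apply (linear_system_unique l 3 (fun i j x => flow_matrix sigma kk i j x lam) z (fun i x => c * w i x)
    (fun i _ => c * entrance i lam) hl0).
  - intros i j _ _. apply HB.
  - exact Hz.
  - intros i Hi. apply (cfun_mult (fun _ => c)); [apply cfun_const|apply Hw, Hi].
  - exact Hze.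
  - intros y i Hy Hi. rewrite (Hwe y i Hi), clamp_id by exact Hy.
    rewrite Rmult_plus_distr_l. f_equal. rewrite <- RInt_scal_c.
    + apply RInt_ext. intros t _. rewrite scal_sum. apply sum_eq. intros j _. ring.
    + simpl. repeat apply cfun_plus; (apply cfun_mult; [apply HB|apply Hw; lia]).
  - exact Hx.
  - lia.
Qed.

Lemma mode_value_analytic sigma kk lam0 : lam0 < lam_max -> real_analytic_at (mode_value sigma kk) lam0.
Proof.
  intros H.
  destruct (analytic_linear_system l lam0 3 (flow_matrix sigma kk) (fun i _ lam => entrance i lam) hl0)
    as (Z & HZ0 & d & Hd & HZ).
  - intros i j _ _. apply flow_matrix_analytic, H.
  - intros i _. apply entrance_analytic.
  - destruct (HZ0 O ltac:(lia)) as (r & M & a & Hr & Ha).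
    (* Within this radius the expansion converges, the family solves the system and [lam0 + h] stays
       below [lam_max]. *)
    set (q := Rmin r (Rmin d (lam_max - lam0))).
    assert (Hq : 0 < q) by (repeat apply Rmin_pos; lra).
    assert (Hq1 : q <= r) by apply Rmin_l.
    assert (Hq2 : q <= d) by (eapply Rle_trans; [apply Rmin_r|apply Rmin_l]).
    assert (Hq3 : q <= lam_max - lam0) by (eapply Rle_trans; [apply Rmin_r|apply Rmin_r]).
    apply (expansion_mono _ _ _ _ _ _ q M) in Ha; [|split; assumption|lra].
    destruct Ha as (_ & _ & H3 & H4).
    exists q, M, (fun n => a n l). split; [exact Hq|split; [intros n; apply H3|]].
    intros h Hh. specialize (H4 l h Hh).
    assert (Hlam : lam0 + h < lam_max) by (apply Rabs_def2 in Hh; lra).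
    destruct (HZ h) as [G1 G2]; [lra|].
    destruct (mode_value_spec sigma kk (lam0 + h) Hlam) as (w & Hw & Hwe & E).
    replace (mode_value sigma kk (lam0 + h)) with (Z O l (lam0 + h)); [exact H4|].
    rewrite <- E, <- (Rmult_1_l (w O l)).
    apply (mode_value_unique sigma kk (lam0 + h) 1 (fun i x => Z i x (lam0 + h))); try assumption; [|lra].
    intros x i Hx Hi. rewrite Rmult_1_l. rewrite (G2 x i Hi), clamp_id by exact Hx. reflexivity.
Qed.

(** At [lam = 0] the background is constant, so the derivatives of [p] and every coefficient with a
    factor [lam] vanish; what is left in this row is [kk / (1 - M^2)]. *)
Lemma flow_matrix_0 sigma kk x :
  exists b, (0 <= kk -> 0 <= b) /\ flow_matrix sigma kk 1 0 x 0 = b /\ flow_matrix sigma kk 1 1 x 0 = 0 /\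
  flow_matrix sigma kk 1 2 x 0 = 0 /\ flow_matrix sigma kk 1 3 x 0 = 0.
Proof.
  destruct P_us_pos as [HP Hus].
  pose proof (y_at_bounds 0 x lam_max_pos) as Hy.
  destruct (state_bounds gamma P us _ hgamma HP Hus Hy) as (H1 & H2 & H3 & H4).
  unfold flow_matrix. fold us P. cbv zeta.
  set (y := y_at x 0) in *. set (u := u_of us y) in *. set (rho := rho_of gamma P us y) in *.
  set (p := p_of gamma P y) in *. cbn [mode_matrix]. unfold k_e1.
  set (M := Msq gamma u rho p) in *.
  exists (kk / (1 - M)). split; [|split; [|split; [|split]]].
  - intros Hk. apply Rmult_le_pos; [exact Hk|left; apply Rinv_0_lt_compat; lra].
  - assert (E3 : forall m m1, k_e3 gamma 0 m m1 u rho p (0 * m * p1_of gamma P us y)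
      (0 * m1 * p1_of gamma P us y + 0 ^ 2 * m ^ 2 * p2_of gamma P us y) = 0).
    { intros m m1. unfold k_e3, k_d2, k_d5, k_d4. unfold Rdiv. ring. }
    rewrite E3. unfold k_e. unfold Rdiv. rewrite !Rmult_0_l, Rmult_0_r, Rplus_0_l, Rplus_0_l.
    field. lra.
  - unfold k_e, Rdiv. ring.
  - unfold Rdiv. ring.
  - unfold Rdiv. ring.
Qed.

Lemma mode_value_0 sigma kk : 0 <= kk -> mode_value sigma kk 0 <> 0.
Proof.
  intros Hk. destruct (mode_value_spec sigma kk 0 lam_max_pos) as (z & Hz & He & E).
  rewrite <- E.
  pose proof (fun i j => proj1 (analytic_cfun _ _ _ (flow_matrix_analytic sigma kk 0 lam_max_pos i j))) as HB.
  set (b := fun x => flow_matrix sigma kk 1 0 x 0).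
  assert (Hb : forall x, 0 <= b x).
  { intros x. destruct (flow_matrix_0 sigma kk x) as (b' & H1 & H2 & _). unfold b. rewrite H2. auto. }
  assert (Ez0 : forall x, 0 <= x <= l -> z O x = 1 + RInt (z 1%nat) 0 x).
  { intros x Hx. rewrite (He x O) by lia. rewrite clamp_id by exact Hx. simpl entrance. f_equal.
    apply RInt_ext. intros t _. simpl. unfold flow_matrix; simpl. match goal with |- ?a = ?b => change (@eq R a b) end. ring. }
  assert (Ez1 : forall x, 0 <= x <= l -> z 1%nat x = RInt (fun t => b t * z O t) 0 x).
  { intros x Hx. rewrite (He x 1%nat) by lia. rewrite clamp_id by exact Hx. simpl entrance.
    replace (- 0 * G0) with 0 by ring. rewrite Rplus_0_l.
    apply RInt_ext. intros t _. destruct (flow_matrix_0 sigma kk t) as (b' & _ & H2 & H3 & H4 & H5).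
        cbn [sum_f_R0]. rewrite H3, H4, H5. unfold b.
    match goal with |- ?a = ?b => change (@eq R a b) end. ring. }
  assert (Hc1 : cfun (fun t => b t * z O t)) by (apply cfun_mult; [apply HB|apply Hz; lia]).
  assert (D0 : forall x, 0 < x < l -> is_derive (z O) x (z 1%nat x)).
  { intros x Hx. apply (is_derive_ext_loc (fun x => 1 + RInt (z 1%nat) 0 x)).
    - apply (locally_between 0 l); [exact Hx|]. intros t Ht. symmetry. apply Ez0; lra.
    - evar_last.
      + apply (is_derive_plus (fun _ => 1) (fun x => RInt (z 1%nat) 0 x)).
        * apply (is_derive_const (V := R_NormedModule)).
        * apply cfun_RInt_derive, Hz; lia.
      + apply Rplus_0_l. }
  assert (D1 : forall x, 0 < x < l -> is_derive (z 1%nat) x (b x * z O x)).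
  { intros x Hx. apply (is_derive_ext_loc (fun x => RInt (fun t => b t * z O t) 0 x)).
    - apply (locally_between 0 l); [exact Hx|]. intros t Ht. symmetry. apply Ez1; lra.
    - apply (cfun_RInt_derive _ x Hc1). }
  assert (I0 : z O 0 = 1).
  { rewrite Ez0 by lra. rewrite RInt_point. apply Rplus_0_r. }
  assert (I1 : z 1%nat 0 = 0).
  { rewrite Ez1 by lra. rewrite RInt_point. reflexivity. }
  assert (Hcz : forall i, (i <= 3)%nat -> forall x, continuity_pt (z i) x).
  { intros i Hi x. apply continuity_pt_filterlim. apply (Hz i Hi). }
  (* (q q')' = q'^2 + b q^2 >= 0, so q^2 does not decrease *)
  assert (Hprod : forall x, 0 <= x <= l -> 0 <= z O x * z 1%nat x).
  { intros x Hx.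
    destruct (MVT_gen (fun x => z O x * z 1%nat x) 0 x (fun x => z 1%nat x * z 1%nat x + z O x * (b x * z O x)))
      as (c & Hc & Ec).
    - rewrite Rmin_left, Rmax_right by lra. intros t Ht.
      apply (is_derive_mult (z O) (z 1%nat)); [apply D0; lra|apply D1; lra|intros; apply Rmult_comm].
    - intros t _. apply (continuity_pt_mult (z O) (z 1%nat)); apply Hcz; lia.
    - rewrite I0, I1, Rminus_0_r, Rmult_0_r, Rminus_0_r in Ec. rewrite Ec.
      apply Rmult_le_pos; [|lra]. specialize (Hb c).
      assert (0 <= b c * (z O c * z O c)) by (apply Rmult_le_pos; [exact Hb|apply Rle_0_sqr]).
      pose proof (Rle_0_sqr (z 1%nat c)) as Hs. unfold Rsqr in Hs. lra. }
  destruct (MVT_gen (fun x => z O x * z O x) 0 l (fun x => z 1%nat x * z O x + z O x * z 1%nat x))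
    as (c & Hc & Ec).
  - rewrite Rmin_left, Rmax_right by lra. intros t Ht.
    apply (is_derive_mult (z O) (z O)); [apply D0; lra|apply D0; lra|intros; apply Rmult_comm].
  - intros t _. apply (continuity_pt_mult (z O) (z O)); apply Hcz; lia.
  - rewrite Rmin_left, Rmax_right in Hc by lra. rewrite I0 in Ec. specialize (Hprod c Hc).
    intros Hzl. rewrite Hzl in Ec.
    assert (0 <= (z 1%nat c * z O c + z O c * z 1%nat c) * (l - 0)) by (apply Rmult_le_pos; lra).
    lra.
Qed.

Theorem mode_zeros_countable sigma kk : 0 <= kk ->
  at_most_countable (fun lam => lam < lam_max /\ mode_value sigma kk lam = 0).
Proof.
  intros Hk. apply analytic_zeros_countable.
  - exact lam_max_pos.
  - intros; apply mode_value_analytic; assumption.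
  - apply mode_value_0, Hk.
Qed.

End Modes.

(** * The coefficients of the S-condition in rational form *)

Section Match.

Variables (gamma kappa0 c_nu : R) (mb : R -> R) (lam : R) (U : flow) (x : R).
Variables (m1 dp ddp : R).
Hypothesis hgamma : 1 < gamma.
Hypothesis hp : 0 < pres U x.
Hypothesis hrho : 0 < dens U x.
Hypothesis hu : 0 < vel U x.

Notation u := (vel U x).
Notation rho := (dens U x).
Notation p := (pres U x).
Notation m := (mb x).
Notation W := (Rpower rho (gamma - 1)).

Lemma sound_pow2 : sound gamma U x ^ 2 = csq gamma rho p.
Proof.
  apply sound_sq. apply Rdiv_lt_0_compat; [apply Rmult_lt_0_compat; lra|exact hrho].
Qed.

Lemma Mach_pow2 : Mach gamma U x ^ 2 = Msq gamma u rho p.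
Proof. apply mach_sq; [lra|exact hp|exact hrho]. Qed.

Lemma pow_even (c s : R) n : c ^ 2 = s -> c ^ (2 * n) = s ^ n.
Proof. intros <-. apply pow_mult. Qed.

Ltac to_squares :=
  rewrite ?(pow_even _ _ 2 Mach_pow2 : Mach gamma U x ^ 4 = _),
    ?(pow_even _ _ 3 Mach_pow2 : Mach gamma U x ^ 6 = _),
    ?(pow_even _ _ 4 Mach_pow2 : Mach gamma U x ^ 8 = _),
    ?(pow_even _ _ 2 sound_pow2 : sound gamma U x ^ 4 = _),
    ?(pow_even _ _ 3 sound_pow2 : sound gamma U x ^ 6 = _),
    ?Mach_pow2, ?sound_pow2.

Lemma E_eq : Etot gamma U x = k_E gamma u rho p.
Proof. unfold Etot, k_E. rewrite pow2_abs. to_squares. reflexivity. Qed.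

Lemma a1_eq : a1 gamma mb U x = k_a1 gamma m u rho p.
Proof. unfold a1, k_a1. to_squares. reflexivity. Qed.

Lemma a2_eq : a2 gamma mb U x = W * k_a2 gamma m u rho p.
Proof. unfold a2, k_a2. rewrite E_eq. unfold Rdiv. ring. Qed.

Lemma a3_eq : a3 gamma mb U x = k_a3 gamma m u rho p.
Proof. unfold a3, k_a3. rewrite E_eq. reflexivity. Qed.

Lemma b2_eq : b2 gamma mb U x = k_b2 gamma m u rho p.
Proof. unfold b2, k_b2. to_squares. reflexivity. Qed.

Section Entropy.

Hypothesis hA : p = A_of kappa0 c_nu (entr U x) * Rpower rho gamma.

(** By the equation of state; this is how the entropy leaves the system. *)
Lemma Aent_eq : W * Aent kappa0 c_nu U x = p / rho.
Proof.
  unfold Aent. rewrite hA. replace (Rpower rho gamma) with (W * rho).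
  - field. lra.
  - rewrite <- (Rpower_1 rho hrho) at 2. rewrite <- Rpower_plus. f_equal. ring.
Qed.

Lemma b1_eq : W * b1 gamma kappa0 c_nu mb U x = k_b1 gamma m u rho p.
Proof. unfold b1, k_b1. to_squares. rewrite <- Aent_eq. unfold Rdiv. ring. Qed.

Lemma b3_eq : W * b3 gamma kappa0 c_nu mb U x = k_b3 gamma m u rho p.
Proof. unfold b3, k_b3. to_squares. rewrite <- Aent_eq. unfold Rdiv. ring. Qed.

End Entropy.

Hypothesis hdp : Derive (pres U) x = dp.
Hypothesis hddp : Derive_n (pres U) 2 x = ddp.
Hypothesis hm1 : Derive mb x = m1.

Lemma e1_eq : e1 gamma U x = k_e1 gamma u rho p.
Proof. unfold e1, k_e1. to_squares. reflexivity. Qed.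

Lemma e2_eq : e2 gamma mb lam U x = k_e2 gamma lam m u rho p dp.
Proof. unfold e2, k_e2, d1, k_d1. to_squares. rewrite hdp. reflexivity. Qed.

Lemma d2_eq : d2 gamma mb lam U x = k_d2 gamma lam m m1 u rho p dp.
Proof. unfold d2, k_d2. to_squares. rewrite hdp, hm1. reflexivity. Qed.

Lemma d3_eq : d3 gamma mb lam U x = k_d3 gamma lam m1 u rho p dp ddp.
Proof. unfold d3, k_d3. to_squares. rewrite hddp, hdp, hm1. reflexivity. Qed.

Lemma d4_eq : d4 gamma mb lam U x = k_d4 gamma lam m m1 u rho p dp.
Proof. unfold d4, k_d4. to_squares. rewrite hdp, hm1. reflexivity. Qed.

Lemma d5_eq : d5 gamma mb lam U x = k_d5 gamma lam m m1 u rho p dp ddp.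
Proof. unfold d5, k_d5. to_squares. rewrite hddp, hdp, hm1. reflexivity. Qed.

Lemma e3_eq : e3 gamma mb lam U x = k_e3 gamma lam m m1 u rho p dp ddp.
Proof. unfold e3, k_e3. to_squares. rewrite d2_eq, d5_eq, d4_eq. reflexivity. Qed.

Lemma e4_eq : e4 gamma mb lam U x = k_e4 gamma lam m m1 u rho p dp ddp.
Proof. unfold e4, k_e4. to_squares. rewrite d3_eq, d4_eq. reflexivity. Qed.

Lemma e5_eq : e5 gamma mb lam U x = W * k_e5 gamma lam m m1 u rho p dp ddp.
Proof. unfold e5, k_e5. to_squares. rewrite d5_eq, d4_eq. unfold Rdiv. ring. Qed.

Lemma e6_eq : e6 gamma mb lam U x = k_e gamma lam m rho p (k_c1 gamma u rho p).
Proof. unfold e6, d6, c1, k_e, k_c1. to_squares. reflexivity. Qed.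

Lemma e7_eq : e7 gamma mb lam U x = k_e gamma lam m rho p (k_c2 gamma lam m u rho p).
Proof. unfold e7, d7, c2, k_e, k_c2. to_squares. reflexivity. Qed.

Lemma e8_eq : e8 gamma mb lam U x = k_e gamma lam m rho p (k_c3 gamma lam m u rho p).
Proof. unfold e8, d8, c3, k_e, k_c3. to_squares. reflexivity. Qed.

Lemma e9_eq : e9 gamma mb lam U x = W * k_e gamma lam m rho p (k_c4 gamma lam m u rho p).
Proof. unfold e9, d9, c4, k_e, k_c4. to_squares. unfold Rdiv. ring. Qed.

End Match.

(** * Derivatives of the background state *)

Section Derivatives.

Variables (gamma l p0 rho0 u0 lam : R) (mb mb1 : R -> R) (U : flow).
Hypothesis hgamma : 1 < gamma.
Hypothesis hl : 0 < l.
Hypothesis hp0 : 0 < p0.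
Hypothesis hrho0 : 0 < rho0.
Hypothesis hu0 : 0 < u0.
Hypothesis mb_cont : cfun (fun x => mb (clamp l x)).
Hypothesis mb_derive : forall x, 0 < x < l -> is_derive mb x (mb1 x).
Hypothesis tau_sub : forall x, 0 <= x <= l -> tau_of gamma l p0 rho0 u0 mb x lam < -1.

Let us := uref gamma p0 rho0 u0.
Let P := mflux p0 rho0 u0.
Notation y := (fun x => y_at gamma l p0 rho0 u0 mb x lam).

Hypothesis U_eq : forall x, 0 <= x <= l ->
  vel U x = u_of us (y x) /\ pres U x = p_of gamma P (y x) /\ dens U x = rho_of gamma P us (y x).

Lemma y_in x : 0 <= x <= l -> 0 < y x < 1.
Proof. intros Hx. apply exp_sbr_bounds, tau_sub, Hx. Qed.

Lemma us_pos : 0 < us.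
Proof. apply uref_pos; assumption. Qed.

(** Since [sbr' = 1 / (1 - y)], the function [y = exp (sbr tau)] has derivative [y / (1 - y)] times
    [tau']. *)
Lemma y_derive x : 0 < x < l -> is_derive y x (lam * mb x * (y x / (us * (1 - y x)))).
Proof.
  intros Hx. pose proof us_pos as Hus. pose proof (y_in x ltac:(lra)) as Hy.
  assert (Ht : is_derive (fun x => tau_of gamma l p0 rho0 u0 mb x lam) x (lam * (mb x / us))).
  { unfold tau_of, phase. fold us.
    apply (is_derive_ext_loc (fun x => phase0 gamma p0 rho0 u0 + lam * (RInt (fun t => mb (clamp l t)) 0 x / us))).
    - apply (locally_between 0 l); [exact Hx|]. intros t Ht. rewrite clamp_id by lra. reflexivity.
    - evar_last.
      + apply (is_derive_plus (fun _ => phase0 gamma p0 rho0 u0)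
          (fun x => lam * (RInt (fun t => mb (clamp l t)) 0 x / us))).
        * apply (is_derive_const (V := R_NormedModule)).
        * apply (is_derive_scal (fun x => RInt (fun t => mb (clamp l t)) 0 x / us)).
          apply (is_derive_ext (fun x => / us * RInt (fun t => mb (clamp l t)) 0 x)); [intros; apply Rmult_comm|].
          apply (is_derive_scal (fun x => RInt (fun t => mb (clamp l t)) 0 x)).
          apply (cfun_RInt_derive (fun t => mb (clamp l t)) x mb_cont).
      + rewrite clamp_id by lra. unfold plus, zero; simpl. unfold Rdiv. ring. }
  unfold y_at. fold (y_at gamma l p0 rho0 u0 mb x lam). evar_last.
  - apply (is_derive_comp exp (fun x => sbr (tau_of gamma l p0 rho0 u0 mb x lam))).
    + apply is_derive_Reals, derivable_pt_lim_exp.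
    + apply (is_derive_comp sbr (fun x => tau_of gamma l p0 rho0 u0 mb x lam)); [|exact Ht].
      apply sbr_derive, tau_sub; lra.
  - unfold scal; simpl; unfold mult; simpl.
    cbv beta in Hy. unfold y_at in *.
    set (e := exp (sbr (tau_of gamma l p0 rho0 u0 mb x lam))) in *. field. split; lra.
Qed.

Lemma y_derive_comp (f : R -> R) f' x : 0 < x < l -> is_derive f (y x) f' ->
  is_derive (fun x => f (y x)) x (lam * mb x * (f' * (y x / (us * (1 - y x))))).
Proof.
  intros Hx Hf. evar_last.
  - apply (is_derive_comp f y); [exact Hf|apply y_derive, Hx].
  - unfold scal; simpl; unfold mult; simpl. ring.
Qed.

Lemma pres_derive x : 0 < x < l -> is_derive (pres U) x (lam * mb x * p1_of gamma P us (y x)).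
Proof.
  intros Hx. pose proof us_pos as Hus. pose proof (y_in x ltac:(lra)) as Hy.
  apply (is_derive_ext_loc (fun x => p_of gamma P (y x))).
  - apply (locally_between 0 l); [exact Hx|]. intros t Ht. symmetry. apply U_eq; lra.
  - evar_last.
    + apply (y_derive_comp (p_of gamma P) (- (2 * gamma * P / ((gamma + 1) * (1 + y x) ^ 2))) x Hx).
      unfold p_of. auto_derive; [lra|]. field. split; lra.
    + unfold p1_of. field. repeat split; lra.
Qed.

Lemma pres_derive2 x : 0 < x < l -> Derive_n (pres U) 2 x =
  lam * mb1 x * p1_of gamma P us (y x) + lam ^ 2 * mb x ^ 2 * p2_of gamma P us (y x).
Proof.
  intros Hx. pose proof us_pos as Hus. pose proof (y_in x ltac:(lra)) as Hy.
  simpl Derive_n. apply is_derive_unique.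
  apply (is_derive_ext_loc (fun x => lam * mb x * p1_of gamma P us (y x))).
  - apply (locally_between 0 l); [exact Hx|]. intros t Ht. symmetry. apply is_derive_unique, pres_derive, Ht.
  - evar_last.
    + apply (is_derive_mult (fun x => lam * mb x) (fun x => p1_of gamma P us (y x)));
        [apply (is_derive_scal mb), mb_derive, Hx| |intros; apply Rmult_comm].
      apply (y_derive_comp (p1_of gamma P us)
        (- (2 * gamma * P / ((gamma + 1) * us)) * ((1 - y x + 2 * y x ^ 2) / ((1 - y x) ^ 2 * (1 + y x) ^ 3))) x Hx).
      unfold p1_of. auto_derive.
      * apply Rgt_not_eq. apply Rmult_lt_0_compat; [lra|nra].
      * field. repeat split; lra.
    + unfold plus, mult; simpl. unfold p1_of, p2_of. field. repeat split; lra.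
Qed.

Lemma dens_derive x : 0 < x < l -> is_derive (dens U) x (lam * mb x * r1_of us (y x) * dens U x).
Proof.
  intros Hx. pose proof us_pos as Hus. pose proof (y_in x ltac:(lra)) as Hy.
  apply (is_derive_ext_loc (fun x => rho_of gamma P us (y x))).
  - apply (locally_between 0 l); [exact Hx|]. intros t Ht. symmetry. apply U_eq; lra.
  - evar_last.
    + apply (y_derive_comp (rho_of gamma P us)
        (2 * gamma * P / ((gamma + 1) * us ^ 2) * ((1 - 2 * y x) / (1 + y x) ^ 4)) x Hx).
      unfold rho_of. auto_derive; [apply Rgt_not_eq; nra|]. field. repeat split; lra.
    + rewrite (proj2 (proj2 (U_eq x ltac:(lra)))). unfold rho_of, r1_of. field. repeat split; lra.
Qed.

Lemma dens_power_derive x : 0 < x < l -> 0 < dens U x ->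
  is_derive (fun x => Rpower (dens U x) (gamma - 1)) x
    ((gamma - 1) * (lam * mb x * r1_of us (y x)) * Rpower (dens U x) (gamma - 1)).
Proof.
  intros Hx Hd. unfold Rpower at 1. evar_last.
  - apply (is_derive_comp exp (fun x => (gamma - 1) * ln (dens U x))).
    + apply is_derive_Reals, derivable_pt_lim_exp.
    + apply (is_derive_scal (fun x => ln (dens U x))).
      apply (is_derive_comp ln (dens U)); [|apply dens_derive, Hx].
      apply is_derive_Reals, derivable_pt_lim_ln, Hd.
  - unfold scal; simpl; unfold mult; simpl. unfold Rpower. field. lra.
Qed.

End Derivatives.

(** * From the mode equation to the system *)

#[local] Arguments flow_matrix : simpl never.

Section Reduction.

Variables (gamma kappa0 c_nu l p0 rho0 u0 lam : R) (mb mb1 : R -> R) (U : flow).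
Variables (Phi : R -> mat2) (k : nat) (q : R -> R).
Hypothesis hgamma : 1 < gamma.
Hypothesis hl : 0 < l.
Hypothesis hp0 : 0 < p0.
Hypothesis hrho0 : 0 < rho0.
Hypothesis hu0 : 0 < u0.
Hypothesis hM0 : mach gamma p0 rho0 u0 < 1.
Hypothesis mb_cont : cfun (fun x => mb (clamp l x)).
Hypothesis mb1_cont : cfun (fun x => mb1 (clamp l x)).
Hypothesis mb_pos : forall x, 0 <= x <= l -> 0 < mb x.
Hypothesis mb_derive : forall x, 0 < x < l -> is_derive mb x (mb1 x).
Hypothesis hlam : lam < lam_max gamma l p0 rho0 u0 mb.

Let us := uref gamma p0 rho0 u0.
Let P := mflux p0 rho0 u0.
Notation y := (fun x => y_at gamma l p0 rho0 u0 mb x lam).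

Hypothesis U_eq : forall x, 0 <= x <= l ->
  vel U x = u_of us (y x) /\ pres U x = p_of gamma P (y x) /\ dens U x = rho_of gamma P us (y x).
Hypothesis U_entropy : forall x, 0 <= x <= l ->
  pres U x = A_of kappa0 c_nu (entr U x) * Rpower (dens U x) gamma.
Hypothesis U_pos : forall x, 0 <= x <= l -> 0 < pres U x /\ 0 < dens U x /\ 0 < vel U x.
Hypothesis dens_cont : cfun (fun x => dens U (clamp l x)).
Hypothesis HPhi : is_fundamental_on gamma kappa0 c_nu mb lam U l Phi.
Hypothesis Hq : mode_solution gamma kappa0 c_nu mb lam U Phi l k q.

Let sigma : R := match k with O => PI | S _ => 0 end.
Let kk : R := INR k ^ 2.

Notation M := (fun i j x => flow_matrix gamma l p0 rho0 u0 mb mb1 sigma kk i j x lam).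
Notation R_ := (fun x => Rpower (dens U x) (gamma - 1)).
Let hl0 : 0 <= l := Rlt_le _ _ hl.

Let tau_sub x (_ : 0 <= x <= l) : tau_of gamma l p0 rho0 u0 mb x lam < -1.
Proof. apply tau_lt; assumption. Qed.

Lemma M_cfun i j : cfun (fun x => M i j x).
Proof. apply (analytic_cfun l lam). apply flow_matrix_analytic; assumption. Qed.

Lemma M_at x i j : 0 <= x <= l -> M i j x =
  mode_matrix gamma lam (mb x) (mb1 x) (vel U x) (dens U x) (pres U x)
    (lam * mb x * p1_of gamma P us (y x))
    (lam * mb1 x * p1_of gamma P us (y x) + lam ^ 2 * mb x ^ 2 * p2_of gamma P us (y x))
    (lam * mb x * r1_of us (y x)) sigma kk i j.
Proof.
  intros Hx. destruct (U_eq x Hx) as (E1 & E2 & E3). rewrite E1, E2, E3.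
  cbv beta. unfold flow_matrix. rewrite clamp_id by exact Hx. reflexivity.
Qed.

Lemma M20_eq x : 0 <= x <= l -> M 2%nat 0%nat x = a3 gamma mb U x.
Proof.
  intros Hx. destruct (U_pos x Hx) as (H1 & H2 & H3).
  rewrite M_at by exact Hx. cbn [mode_matrix]. symmetry. apply a3_eq; assumption.
Qed.

Lemma M22_eq x : 0 <= x <= l -> M 2%nat 2%nat x = lam * a1 gamma mb U x.
Proof.
  intros Hx. destruct (U_pos x Hx) as (H1 & H2 & H3).
  rewrite M_at by exact Hx. cbn [mode_matrix]. rewrite a1_eq by assumption. reflexivity.
Qed.

Lemma M23_eq x : 0 <= x <= l -> R_ x * M 2%nat 3%nat x = lam * a2 gamma mb U x.
Proof.
  intros Hx. destruct (U_pos x Hx) as (H1 & H2 & H3).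
  rewrite M_at by exact Hx. cbn [mode_matrix]. rewrite a2_eq by assumption. ring.
Qed.

Lemma M30_eq x : 0 <= x <= l -> M 3%nat 0%nat x = R_ x * b3 gamma kappa0 c_nu mb U x.
Proof.
  intros Hx. destruct (U_pos x Hx) as (H1 & H2 & H3).
  rewrite M_at by exact Hx. cbn [mode_matrix]. symmetry. apply b3_eq; auto.
Qed.

Lemma M32_eq x : 0 <= x <= l -> M 3%nat 2%nat x = lam * (R_ x * b1 gamma kappa0 c_nu mb U x).
Proof.
  intros Hx. destruct (U_pos x Hx) as (H1 & H2 & H3).
  rewrite M_at by exact Hx. cbn [mode_matrix]. rewrite b1_eq by auto. reflexivity.
Qed.

Lemma M33_eq x : 0 <= x <= l -> M 3%nat 3%nat x =
  (gamma - 1) * (lam * mb x * r1_of us (y x)) + lam * b2 gamma mb U x.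
Proof.
  intros Hx. destruct (U_pos x Hx) as (H1 & H2 & H3).
  rewrite M_at by exact Hx. cbn [mode_matrix]. rewrite b2_eq by assumption. reflexivity.
Qed.

Lemma R_pos x : 0 < R_ x.
Proof. apply exp_pos. Qed.

Lemma R_derive x : 0 < x < l ->
  is_derive R_ x ((gamma - 1) * (lam * mb x * r1_of us (y x)) * R_ x).
Proof.
  intros Hx. apply (dens_power_derive gamma l p0 rho0 u0 lam mb U); try assumption.
  apply U_pos; lra.
Qed.

Lemma R_cfun : cfun (fun x => R_ (clamp l x)).
Proof.
  unfold Rpower. apply (cfun_comp (fun x => (gamma - 1) * ln (dens U (clamp l x))) exp).
  - apply (cfun_mult (fun _ => gamma - 1)); [apply cfun_const|]. intros t.
    apply (continuous_comp (fun x => dens U (clamp l x)) ln); [apply dens_cont|].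
    apply continuity_pt_filterlim, derivable_continuous_pt.
    exists (/ dens U (clamp l t)). apply derivable_pt_lim_ln. apply U_pos, clamp_in, hl0.
  - intros t. apply continuous_exp.
Qed.

Notation F11 := (fun x => m11 (Phi x)).
Notation F12 := (fun x => m12 (Phi x)).
Notation F21 := (fun x => R_ x * m21 (Phi x)).
Notation F22 := (fun x => R_ x * m22 (Phi x)).

Lemma Phi_interior (f f' : R -> R) : (forall x, icc l x -> D_in f f' (icc l) x) ->
  cfun (fun x => f (clamp l x)) /\ forall x, 0 < x < l -> is_derive f x (f' x).
Proof.
  intros H. split.
  - apply (D_in_cfun f f' (icc l)); [exact hl0|intros x Hx; exact Hx|exact H].
  - intros x Hx. apply (D_in_interior f f' (icc l) x 0 l); [apply H; split; lra|exact Hx|].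
    intros t Ht; split; lra.
Qed.

(** Scaling the second row of [Phi] by [rho^(gamma-1)] turns the matrix of the fundamental system
    into the block of [M] with indices 2 and 3; the logarithmic derivative of the scaling is the
    extra term in the entry (3,3). *)
Lemma F_facts :
  (cfun (fun x => F11 (clamp l x)) /\ forall x, 0 < x < l ->
     is_derive F11 x (M 2%nat 2%nat x * F11 x + M 2%nat 3%nat x * F21 x)) /\
  (cfun (fun x => F12 (clamp l x)) /\ forall x, 0 < x < l ->
     is_derive F12 x (M 2%nat 2%nat x * F12 x + M 2%nat 3%nat x * F22 x)) /\
  (cfun (fun x => F21 (clamp l x)) /\ forall x, 0 < x < l ->
     is_derive F21 x (M 3%nat 2%nat x * F11 x + M 3%nat 3%nat x * F21 x)) /\
  (cfun (fun x => F22 (clamp l x)) /\ forall x, 0 < x < l ->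
     is_derive F22 x (M 3%nat 2%nat x * F12 x + M 3%nat 3%nat x * F22 x)).
Proof.
  destruct HPhi as [_ H].
  destruct (Phi_interior _ _ (fun x Hx => proj1 (H x Hx))) as [C1 D1].
  destruct (Phi_interior _ _ (fun x Hx => proj1 (proj2 (H x Hx)))) as [C2 D2].
  destruct (Phi_interior _ _ (fun x Hx => proj1 (proj2 (proj2 (H x Hx))))) as [C3 D3].
  destruct (Phi_interior _ _ (fun x Hx => proj2 (proj2 (proj2 (H x Hx))))) as [C4 D4].
  cbv beta in D1, D2, D3, D4. simpl in D1, D2, D3, D4.
  split; [|split; [|split]]; (split; [first [exact C1|exact C2|apply cfun_mult; [exact R_cfun|first [exact C3|exact C4]]]|]);
    intros x Hx; assert (Hx' : 0 <= x <= l) by lra;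
    pose proof (M22_eq x Hx') as E22; pose proof (M23_eq x Hx') as E23;
    pose proof (M32_eq x Hx') as E32; pose proof (M33_eq x Hx') as E33; cbv beta in E22, E23, E32, E33.
  - evar_last; [apply D1, Hx|]. rewrite E22.
    match goal with |- ?a = ?b => change (@eq R a b) end.
    replace (M 2%nat 3%nat x * (R_ x * m21 (Phi x))) with (lam * a2 gamma mb U x * m21 (Phi x))
      by (rewrite <- E23; ring). ring.
  - evar_last; [apply D2, Hx|]. rewrite E22.
    match goal with |- ?a = ?b => change (@eq R a b) end.
    replace (M 2%nat 3%nat x * (R_ x * m22 (Phi x))) with (lam * a2 gamma mb U x * m22 (Phi x))
      by (rewrite <- E23; ring). ring.
  - evar_last; [apply (is_derive_mult R_ (fun x => m21 (Phi x)));
      [apply R_derive, Hx|apply D3, Hx|intros; apply Rmult_comm]|].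
    rewrite E32, E33. unfold plus, mult; simpl. ring.
  - evar_last; [apply (is_derive_mult R_ (fun x => m22 (Phi x)));
      [apply R_derive, Hx|apply D4, Hx|intros; apply Rmult_comm]|].
    rewrite E32, E33. unfold plus, mult; simpl. ring.
Qed.

(* Liouville's formula: the determinant solves [d' = trace * d]. *)
Lemma det_neq0 x : 0 <= x <= l -> mat2_det (Phi x) <> 0.
Proof.
  intros Hx.
  destruct F_facts as ((C1 & D1) & (C2 & D2) & (C3 & D3) & (C4 & D4)).
  set (T := fun x => M 2%nat 2%nat x + M 3%nat 3%nat x).
  assert (HT : cfun T) by (apply cfun_plus; apply M_cfun).
  set (det := fun x => (F11 x * F22 x - F12 x * F21 x) * exp (- RInt T 0 x)).
  assert (Hdet : forall x, 0 <= x <= l -> det x = det 0).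
  { apply constant_on_icc; [exact hl0| |].
    - unfold det.
      apply (cfun_mult (fun x => F11 (clamp l x) * F22 (clamp l x) - F12 (clamp l x) * F21 (clamp l x))
        (fun x => exp (- RInt T 0 (clamp l x)))).
      + apply cfun_minus; apply cfun_mult; assumption.
      + intros t. apply (continuous_comp (fun x => - RInt T 0 (clamp l x)) exp); [|apply continuous_exp].
        apply (continuous_opp (V := R_NormedModule) (fun x => RInt T 0 (clamp l x))).
        apply (cfun_comp (clamp l) (fun x => RInt T 0 x)); [apply cfun_clamp|apply cfun_RInt, HT].
    - intros t Ht. unfold det. evar_last.
      + apply (is_derive_mult (fun x => F11 x * F22 x - F12 x * F21 x) (fun x => exp (- RInt T 0 x)));
          [| |intros; apply Rmult_comm].
        * apply (is_derive_minus (fun x => F11 x * F22 x) (fun x => F12 x * F21 x)).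
          -- apply (is_derive_mult F11 F22); [apply D1, Ht|apply D4, Ht|intros; apply Rmult_comm].
          -- apply (is_derive_mult F12 F21); [apply D2, Ht|apply D3, Ht|intros; apply Rmult_comm].
        * apply (is_derive_comp exp (fun x => - RInt T 0 x)).
          -- apply is_derive_Reals, derivable_pt_lim_exp.
          -- apply (is_derive_opp (fun x => RInt T 0 x)). apply cfun_RInt_derive, HT.
      + unfold plus, mult, minus, opp, scal, plus; simpl; unfold mult; simpl. unfold T. ring. }
  assert (H0 : det 0 <> 0).
  { unfold det. rewrite (proj1 HPhi). simpl m11. simpl m12. simpl m21. simpl m22.
    apply Rmult_integral_contrapositive. split; [|apply Rgt_not_eq, exp_pos].
    pose proof (R_pos 0) as HR. cbv beta in HR. apply Rgt_not_eq. lra. }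
  intros E. apply H0. rewrite <- (Hdet x Hx). unfold det, mat2_det in *.
  replace (m11 (Phi x) * (R_ x * m22 (Phi x)) - m12 (Phi x) * (R_ x * m21 (Phi x)))
    with (R_ x * (m11 (Phi x) * m22 (Phi x) - m12 (Phi x) * m21 (Phi x))) by ring.
  rewrite E. ring.
Qed.

Notation A4 := (a4 gamma kappa0 c_nu mb U Phi).
Notation B4 := (b4 gamma kappa0 c_nu mb U Phi).

(** Undoes the inverse in the definition of [a4] and [b4], hence the nonzero determinant. *)
Lemma Phi_a4_b4 x : 0 <= x <= l ->
  F11 x * A4 x + F12 x * B4 x = M 2%nat 0%nat x /\ F21 x * A4 x + F22 x * B4 x = M 3%nat 0%nat x.
Proof.
  intros Hx. pose proof (det_neq0 x Hx) as Hd.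
  pose proof (M20_eq x Hx) as E20. pose proof (M30_eq x Hx) as E30. cbv beta in E20, E30 |- *.
  rewrite ?E20, ?E30. unfold a4, b4, mat2_mulcol, mat2_inv, mat2_scale. simpl.
  unfold mat2_det in *. split; field; exact Hd.
Qed.

(** Cramer's rule in the scaled entries, whose continuity comes from [F_facts] and from the analytic
    matrix. *)
Lemma a4_b4_cfun : cfun (fun x => A4 (clamp l x)) /\ cfun (fun x => B4 (clamp l x)).
Proof.
  destruct F_facts as ((C1 & _) & (C2 & _) & (C3 & _) & (C4 & _)).
  assert (HR : forall x, R_ x <> 0) by (intros x; apply Rgt_not_eq, R_pos).
  assert (HRc : cfun (fun x => / R_ (clamp l x))) by (apply cfun_inv; [exact R_cfun|intros; apply HR]).
  assert (Ha3 : cfun (fun x => M 2%nat 0%nat (clamp l x)))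
    by (apply (cfun_comp (clamp l) (M 2%nat 0%nat)); [apply cfun_clamp|apply M_cfun]).
  assert (Hb3 : cfun (fun x => M 3%nat 0%nat (clamp l x)))
    by (apply (cfun_comp (clamp l) (M 3%nat 0%nat)); [apply cfun_clamp|apply M_cfun]).
  set (det := fun x => F11 (clamp l x) * F22 (clamp l x) - F12 (clamp l x) * F21 (clamp l x)).
  assert (Hdet : forall x, det x = R_ (clamp l x) * mat2_det (Phi (clamp l x)))
    by (intros x; unfold det, mat2_det; ring).
  assert (Hdc : cfun (fun x => / det x)).
  { apply cfun_inv; [apply cfun_minus; apply cfun_mult; assumption|].
    intros x. rewrite Hdet. apply Rmult_integral_contrapositive. split; [apply HR|].
    apply det_neq0, clamp_in, hl0. }
  assert (Hc : forall f g, (forall x, f x = g x) -> cfun f -> cfun g).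
  { intros f g E Hf x. apply (continuous_ext f g); [exact E|apply Hf]. }
  split.
  - apply (Hc (fun x => / det x * (F22 (clamp l x) * M 2%nat 0%nat (clamp l x)
      - F12 (clamp l x) * M 3%nat 0%nat (clamp l x)))).
    + intros x. pose proof (clamp_in l x hl0) as Hx. pose proof (det_neq0 _ Hx) as Hd.
      pose proof (M20_eq _ Hx) as E20. pose proof (M30_eq _ Hx) as E30. cbv beta in E20, E30.
      rewrite Hdet, E20, E30. specialize (HR (clamp l x)).
      unfold a4, mat2_mulcol, mat2_inv, mat2_scale. simpl. field. split; assumption.
    + apply cfun_mult; [exact Hdc|]. apply cfun_minus; apply cfun_mult; assumption.
  - apply (Hc (fun x => / det x * (F11 (clamp l x) * M 3%nat 0%nat (clamp l x)
      - F21 (clamp l x) * M 2%nat 0%nat (clamp l x)))).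
    + intros x. pose proof (clamp_in l x hl0) as Hx. pose proof (det_neq0 _ Hx) as Hd.
      pose proof (M20_eq _ Hx) as E20. pose proof (M30_eq _ Hx) as E30. cbv beta in E20, E30.
      rewrite Hdet, E20, E30. specialize (HR (clamp l x)).
      unfold b4, mat2_mulcol, mat2_inv, mat2_scale. simpl. field. split; assumption.
    + apply cfun_mult; [exact Hdc|]. apply cfun_minus; apply cfun_mult; assumption.
Qed.

Lemma q_cfun : cfun (fun x => q (clamp l x)).
Proof.
  apply (continue_in_cfun q (icc l)); [exact hl0|intros x Hx; exact Hx|apply Hq].
Qed.

(** The integrand is controlled only on [0,l]; its clamped version has the same integrals for [x] in
    [0,l] and is continuous everywhere. *)
Lemma integral_facts (f : R -> R) : cfun (fun x => f (clamp l x)) ->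
  let I := fun x => RInt (fun t => f t * q t) 0 x in
  cfun (fun x => I (clamp l x)) /\ I 0 = 0 /\ forall x, 0 < x < l -> is_derive I x (f x * q x).
Proof.
  intros Hf I.
  assert (Hg : cfun (fun t => f (clamp l t) * q (clamp l t))) by (apply cfun_mult; [exact Hf|exact q_cfun]).
  assert (E : forall x, 0 <= x <= l -> I x = RInt (fun t => f (clamp l t) * q (clamp l t)) 0 x).
  { intros x Hx. apply RInt_ext. rewrite Rmin_left, Rmax_right by lra. intros t Ht.
    rewrite clamp_id by lra. reflexivity. }
  split; [|split].
  - intros x. apply (continuous_ext (fun x => RInt (fun t => f (clamp l t) * q (clamp l t)) 0 (clamp l x))).
    + intros t. symmetry. apply E, clamp_in, hl0.
    + apply (cfun_comp (clamp l) (fun x => RInt (fun t => f (clamp l t) * q (clamp l t)) 0 x));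
        [apply cfun_clamp|apply cfun_RInt, Hg].
  - unfold I. rewrite RInt_point. reflexivity.
  - intros x Hx. apply (is_derive_ext_loc (fun x => RInt (fun t => f (clamp l t) * q (clamp l t)) 0 x)).
    + apply (locally_between 0 l); [exact Hx|]. intros t Ht. symmetry. apply E; lra.
    + evar_last; [apply cfun_RInt_derive, Hg|]. cbv beta. rewrite clamp_id by lra. reflexivity.
Qed.

Notation IA := (fun x => RInt (fun t => A4 t * q t) 0 x).
Notation IB := (fun x => RInt (fun t => B4 t * q t) 0 x).
Notation V1 := (fun x => F11 x * IA x + F12 x * IB x).
Notation V2 := (fun x => F21 x * IA x + F22 x * IB x).

(** Product rule for the scaled [Phi] times the vector of integrals: differentiating [Phi] gives the
    block of [M], differentiating the integrals gives the column of [a3] and scaled [b3], times [q].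
    The particular [Phi] disappears from the coefficients here. *)
Lemma V_facts :
  (cfun (fun x => V1 (clamp l x)) /\ V1 0 = 0 /\ forall x, 0 < x < l ->
     is_derive V1 x (M 2%nat 0%nat x * q x + M 2%nat 2%nat x * V1 x + M 2%nat 3%nat x * V2 x)) /\
  (cfun (fun x => V2 (clamp l x)) /\ V2 0 = 0 /\ forall x, 0 < x < l ->
     is_derive V2 x (M 3%nat 0%nat x * q x + M 3%nat 2%nat x * V1 x + M 3%nat 3%nat x * V2 x)).
Proof.
  destruct F_facts as ((C1 & D1) & (C2 & D2) & (C3 & D3) & (C4 & D4)).
  destruct (integral_facts A4 (proj1 a4_b4_cfun)) as (CA & ZA & DA).
  destruct (integral_facts B4 (proj2 a4_b4_cfun)) as (CB & ZB & DB).
  cbv zeta in *.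
  split; (split; [apply cfun_plus; apply cfun_mult; assumption|split; [cbv beta; rewrite ZA, ZB; ring|]]);
    intros x Hx; destruct (Phi_a4_b4 x ltac:(lra)) as [E1 E2]; cbv beta in E1, E2; rewrite <- ?E1, <- ?E2.
  - evar_last.
    + apply (is_derive_plus (fun x => F11 x * IA x) (fun x => F12 x * IB x)).
      * apply (is_derive_mult F11 IA); [apply D1, Hx|apply DA, Hx|intros; apply Rmult_comm].
      * apply (is_derive_mult F12 IB); [apply D2, Hx|apply DB, Hx|intros; apply Rmult_comm].
    + unfold plus, mult; simpl. ring.
  - evar_last.
    + apply (is_derive_plus (fun x => F21 x * IA x) (fun x => F22 x * IB x)).
      * apply (is_derive_mult F21 IA); [apply D3, Hx|apply DA, Hx|intros; apply Rmult_comm].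
      * apply (is_derive_mult F22 IB); [apply D4, Hx|apply DB, Hx|intros; apply Rmult_comm].
    + unfold plus, mult; simpl. ring.
Qed.

Lemma mode_equation_system x : 0 < x < l -> Derive (Derive q) x =
  M 1%nat 0%nat x * q x + M 1%nat 1%nat x * Derive q x + M 1%nat 2%nat x * V1 x + M 1%nat 3%nat x * V2 x.
Proof.
  intros Hx. assert (Hx' : 0 <= x <= l) by lra.
  destruct (U_pos x Hx') as (H1 & H2 & H3).
  destruct Hq as (_ & _ & _ & _ & He). specialize (He x Hx).
  assert (Edp : Derive (pres U) x = lam * mb x * p1_of gamma P us (y x)).
  { apply is_derive_unique. apply (pres_derive gamma l p0 rho0 u0 lam mb U); try assumption. }
  assert (Eddp : Derive_n (pres U) 2 x =
    lam * mb1 x * p1_of gamma P us (y x) + lam ^ 2 * mb x ^ 2 * p2_of gamma P us (y x)).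
  { apply (pres_derive2 gamma l p0 rho0 u0 lam mb mb1 U); try assumption. }
  assert (Em1 : Derive mb x = mb1 x) by (apply is_derive_unique, mb_derive, Hx).
  assert (HMsq : Msq gamma (vel U x) (dens U x) (pres U x) < 1).
  { destruct (U_eq x Hx') as (E1 & E2 & E3). rewrite E1, E2, E3.
    destruct (uref_pos gamma p0 rho0 u0) as [HP Hus]; try assumption.
    apply state_bounds; try assumption. apply y_at_bounds; assumption. }
  rewrite !M_at by exact Hx'. cbn [mode_matrix]. cbv beta.
  (* Both cases of [mode_equation] at once: [sigma = PI] and [kk = 0] for mode 0, [sigma = 0] and
     [kk = INR k ^ 2] otherwise. *)
  assert (He' : e1 gamma U x * Derive (Derive q) x + (lam * e2 gamma mb lam U x + sigma * e6 gamma mb lam U x) * Derive q x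
    + (e3 gamma mb lam U x + sigma * e7 gamma mb lam U x + kk) * q x
    + lam * (e10 gamma mb lam U Phi x + sigma * e12 gamma mb lam U Phi x) * IA x
    + lam * (e11 gamma mb lam U Phi x + sigma * e13 gamma mb lam U Phi x) * IB x = 0).
  { unfold mode_equation in He. unfold sigma, kk. destruct k as [|k']; cbv iota; simpl Derive_n in He.
    - eapply eq_trans; [|exact He]. simpl INR. cbv beta.
      change (Derive (fun x0 => Derive (fun x1 => q x1) x0) x) with (Derive (Derive q) x). ring.
    - eapply eq_trans; [|exact He]. cbv beta.
      change (Derive (fun x0 => Derive (fun x1 => q x1) x0) x) with (Derive (Derive q) x). ring. }
  clear He.
  rewrite (e1_eq gamma U x), (e2_eq gamma mb lam U x _ hgamma H1 H2 Edp) in He' by assumption.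
  rewrite (e3_eq gamma mb lam U x _ _ _ hgamma H1 H2 Edp Eddp Em1) in He'.
  rewrite (e6_eq gamma mb lam U x), (e7_eq gamma mb lam U x) in He' by assumption.
  (* The rows [(e4, e5) Phi] and [(e8, e9) Phi] meet the integrals and recombine into [V1] and [V2];
     the factor [rho^(gamma-1)] of [e5] and [e9] is the one contained in [V2]. *)
  unfold e10, e11, e12, e13, mat2_mulrow in He'. simpl fst in He'. simpl snd in He'.
  rewrite (e4_eq gamma mb lam U x _ _ _ hgamma H1 H2 Edp Eddp Em1) in He'.
  rewrite (e5_eq gamma mb lam U x _ _ _ hgamma H1 H2 Edp Eddp Em1) in He'.
  rewrite (e8_eq gamma mb lam U x), (e9_eq gamma mb lam U x) in He' by assumption.
  set (E1 := k_e1 _ _ _ _) in *.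
  assert (HE1 : E1 <> 0) by (unfold E1, k_e1; apply Rlt_not_eq; lra).
  apply Rmult_eq_reg_l with E1; [|exact HE1].
  match type of He' with ?L = 0 =>
    transitivity (E1 * Derive (Derive q) x - L); [rewrite He'; ring|] end.
  field. exact HE1.
Qed.

(* On (0,l) the equation is q'' = b q' + s with b, s continuous on [0,l], so an
   integrating factor shows that q' extends continuously to [0,l]. *)
Lemma derivative_extends : exists r : R -> R, cfun r /\ r 0 = - lam * gamma0 gamma mb U * q 0 /\
  (forall x, 0 < x < l -> is_derive q x (r x)) /\
  (forall x, 0 < x < l -> is_derive r x
    (M 1%nat 0%nat x * q x + M 1%nat 1%nat x * r x + M 1%nat 2%nat x * V1 x + M 1%nat 3%nat x * V2 x)).
Proof.
  destruct V_facts as ((C1 & _ & _) & (C2 & _ & _)).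
  pose proof q_cfun as Cq. cbv beta in C1, C2.
  destruct Hq as (_ & Hqd & (q1 & Hq1 & Eq1) & _).
  set (B := (fun x => RInt (M 1%nat 1%nat) 0 x) : R -> R).
  set (s := fun x => M 1%nat 0%nat x * q (clamp l x) + M 1%nat 2%nat x * V1 (clamp l x) + M 1%nat 3%nat x * V2 (clamp l x)).
  assert (Hs : cfun s).
  { unfold s. apply cfun_plus; [apply cfun_plus|]; (apply cfun_mult; [apply M_cfun|assumption]). }
  assert (HB : cfun B) by (apply cfun_RInt, M_cfun).
  assert (HBd : forall x, is_derive B x (M 1%nat 1%nat x)) by (intros x; exact (cfun_RInt_derive (M 1%nat 1%nat) x (M_cfun 1%nat 1%nat))).
  assert (He : forall c, cfun (fun x => exp (c * B x))).
  { intros c. apply (cfun_comp (fun x => c * B x) exp).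
    - apply (cfun_mult (fun _ => c)); [apply cfun_const|exact HB].
    - intros x; apply continuous_exp. }
  assert (Hed : forall c x, is_derive (fun x => exp (c * B x)) x (c * M 1%nat 1%nat x * exp (c * B x))).
  { intros c x. evar_last.
    - apply (is_derive_comp exp (fun x => c * B x)).
      + apply is_derive_Reals, derivable_pt_lim_exp.
      + apply (is_derive_scal B), HBd.
    - unfold scal; simpl; unfold mult; simpl. reflexivity. }
  set (h := fun x => exp (-1 * B x) * s x).
  assert (Hh : cfun h) by (apply cfun_mult; [apply He|exact Hs]).
  set (G := fun x => exp (-1 * B x) * Derive q x - RInt h 0 x).
  assert (HGd : forall x, 0 < x < l -> is_derive G x 0).
  { intros x Hx. evar_last.
    - apply (is_derive_minus (fun x => exp (-1 * B x) * Derive q x) (fun x => RInt h 0 x)).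
      + apply (is_derive_mult (fun x => exp (-1 * B x)) (Derive q));
          [apply Hed| |intros; apply Rmult_comm].
        apply Derive_correct, Hqd, Hx.
      + apply cfun_RInt_derive, Hh.
    - rewrite mode_equation_system by exact Hx.
      unfold minus, plus, mult, opp; simpl. unfold h, s. rewrite clamp_id by lra. ring. }
  (* The constant is read off at an interior point, since at the entrance only a one-sided
     derivative is given. *)
  set (C := G (l / 2)).
  assert (HG : forall x, 0 < x < l -> G x = C).
  { intros x Hx.
    pose proof (Rmin_l x (l / 2)). pose proof (Rmin_r x (l / 2)).
    pose proof (Rmax_l x (l / 2)). pose proof (Rmax_r x (l / 2)).
    assert (Hmin : 0 < Rmin x (l / 2)) by (apply Rmin_pos; lra).
    assert (Hmax : Rmax x (l / 2) < l) by (apply Rmax_lub_lt; lra).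
    destruct (MVT_gen G (l / 2) x (fun _ => 0)) as (c & _ & E).
    - rewrite Rmin_comm, Rmax_comm. intros t Ht. apply HGd. lra.
    - rewrite Rmin_comm, Rmax_comm. intros t Ht. apply continuity_pt_filterlim.
      apply (ex_derive_continuous (V := R_NormedModule)). exists 0. apply HGd. lra.
    - unfold C. lra. }
  set (r := fun x => exp (1 * B x) * (C + RInt h 0 x)).
  assert (Hexp : forall x, exp (1 * B x) * exp (-1 * B x) = 1).
  { intros x. transitivity (exp 0); [rewrite <- exp_plus; f_equal; ring|apply exp_0]. }
  assert (Hr : cfun r).
  { apply cfun_mult; [apply He|]. apply cfun_plus; [apply cfun_const|apply cfun_RInt, Hh]. }
  assert (Hrq : forall x, 0 < x < l -> Derive q x = r x).
  { intros x Hx. unfold r. rewrite <- (HG x Hx). unfold G.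
    replace (exp (1 * B x) * (exp (-1 * B x) * Derive q x - RInt h 0 x + RInt h 0 x))
      with (exp (1 * B x) * exp (-1 * B x) * Derive q x) by ring.
    rewrite Hexp. ring. }
  assert (Dq : forall x, 0 < x < l -> is_derive q x (r x)).
  { intros x Hx. rewrite <- Hrq by exact Hx. apply Derive_correct, Hqd, Hx. }
  exists r. split; [exact Hr|split; [|split; [exact Dq|]]].
  (* [q t - q 0] is the integral of [r], so [r 0] and the one-sided derivative [q1 0] are both
     limits of [(q t - q 0) / t] as [t] decreases to 0. *)
  - pose proof (primitive_on_icc q r l hl0 Cq Hr Dq) as Ep.
    assert (D0 : derivable_pt_lim (fun x => RInt r 0 x) 0 (r 0)) by (apply is_derive_Reals, cfun_RInt_derive, Hr).
    enough (E : r 0 = q1 0) by (rewrite E; lra).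
    apply cond_eq. intros eps Heps.
    destruct (D0 (eps / 2)) as (d & Hd); [lra|].
    destruct (Hq1 (eps / 2)) as (a & Ha & Hqa); [lra|].
    set (t := Rmin (l / 2) (Rmin (d / 2) (a / 2))).
    pose proof (cond_pos d) as Hd0.
    assert (Ht : 0 < t) by (repeat apply Rmin_pos; lra).
    assert (Ht1 : t <= l / 2) by apply Rmin_l.
    assert (Ht2 : t <= d / 2) by (eapply Rle_trans; [apply Rmin_r|apply Rmin_l]).
    assert (Ht3 : t <= a / 2) by (eapply Rle_trans; [apply Rmin_r|apply Rmin_r]).
    specialize (Hd t). rewrite Rplus_0_l, RInt_point in Hd. unfold zero in Hd; simpl in Hd. rewrite Rminus_0_r in Hd.
    specialize (Hd ltac:(lra) ltac:(rewrite Rabs_pos_eq; lra)).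
    specialize (Hqa t). simpl in Hqa. unfold Rdist in Hqa. rewrite !Rminus_0_r in Hqa.
    assert (Hta : Rabs ((q t - q 0) / t - q1 0) < eps / 2).
    { apply Hqa. split; [split; [split; lra|lra]|]. rewrite Rabs_pos_eq; lra. }
    pose proof (Ep t ltac:(lra)) as Et. generalize dependent (RInt r 0 t : R). intros J Hd Et.
    replace (q t - q 0) with J in Hta by lra.
    replace (r 0 - q1 0) with ((J / t - q1 0) - (J / t - r 0)) by ring.
    eapply Rle_lt_trans; [apply Rabs_triang|]. rewrite Rabs_Ropp. lra.
  - intros x Hx. rewrite <- (Hrq x Hx). evar_last.
    + apply (is_derive_ext_loc (Derive q)).
      * apply (locally_between 0 l); [exact Hx|]. intros t Ht. apply Hrq, Ht.
      * apply Derive_correct, Hqd, Hx.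
    + apply mode_equation_system, Hx.
Qed.

(** By uniqueness [q] is [q 0] times the normalised solution. At [x = l] this reads
    [0 = q 0 * mode_value], so [q 0 = 0] and [q] vanishes identically. *)
Lemma mode_solution_trivial :
  mode_value gamma l p0 rho0 u0 (gamma0 gamma mb U) mb mb1 sigma kk lam <> 0 ->
  forall x, icc l x -> q x = 0.
Proof.
  intros Hv.
  destruct derivative_extends as (r & Cr & Er & Dq & Dr).
  destruct V_facts as ((C1 & Z1 & D1) & (C2 & Z2 & D2)).
  set (z := fun (i : nat) (x : R) => match i with
    | 0%nat => q (clamp l x) | 1%nat => r x | 2%nat => V1 (clamp l x) | _ => V2 (clamp l x) end).
  assert (Hz : forall i, cfun (z i)).
  { intros [|[|[|i]]]; [exact q_cfun|exact Cr|exact C1|exact C2]. }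
  assert (Hsum : forall i, cfun (fun t => sum_f_R0 (fun j => M i j t * z j t) 3)).
  { intros i. apply (cfun_sum (fun j t => M i j t * z j t)). intros j. apply cfun_mult; [apply M_cfun|apply Hz]. }
  assert (Hsys : forall x i, 0 <= x <= l -> (i <= 3)%nat ->
    z i x = q 0 * entrance (gamma0 gamma mb U) i lam + RInt (fun t => sum_f_R0 (fun j => M i j t * z j t) 3) 0 x).
  { intros x i Hx Hi.
    assert (Hcl : forall t, 0 < t < l -> clamp l t = t) by (intros; apply clamp_id; lra).
    destruct i as [|[|[|[|i]]]]; [| | | |lia]; unfold z at 1; cbv iota.
    - rewrite clamp_id by exact Hx.
      rewrite (primitive_on_icc q (fun t => sum_f_R0 (fun j => M 0%nat j t * z j t) 3) l hl0 q_cfun (Hsum 0%nat));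
        [simpl entrance; ring| |exact Hx].
      intros t Ht. evar_last; [apply Dq, Ht|]. cbn [sum_f_R0 z]. unfold flow_matrix; cbn [mode_matrix]. cbv zeta.
      match goal with |- ?a = ?b => change (@eq R a b) end. ring.
    - rewrite (primitive_on_icc r (fun t => sum_f_R0 (fun j => M 1%nat j t * z j t) 3) l hl0); [| | | |exact Hx].
      + rewrite Er. simpl entrance. ring.
      + apply (cfun_comp (clamp l) r); [apply cfun_clamp|exact Cr].
      + apply Hsum.
      + intros t Ht. evar_last; [apply Dr, Ht|]. cbn [sum_f_R0 z]. rewrite Hcl by exact Ht. reflexivity.
    - rewrite clamp_id by exact Hx.
      rewrite (primitive_on_icc V1 (fun t => sum_f_R0 (fun j => M 2%nat j t * z j t) 3) l hl0 C1 (Hsum 2%nat));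
        [rewrite Z1; simpl entrance; ring| |exact Hx].
      intros t Ht. evar_last; [apply D1, Ht|]. cbn [sum_f_R0 z]. rewrite Hcl by exact Ht.
      unfold flow_matrix; cbn [mode_matrix]. cbv zeta.
      match goal with |- ?a = ?b => change (@eq R a b) end. ring.
    - rewrite clamp_id by exact Hx.
      rewrite (primitive_on_icc V2 (fun t => sum_f_R0 (fun j => M 3%nat j t * z j t) 3) l hl0 C2 (Hsum 3%nat));
        [rewrite Z2; simpl entrance; ring| |exact Hx].
      intros t Ht. evar_last; [apply D2, Ht|]. cbn [sum_f_R0 z]. rewrite Hcl by exact Ht.
      unfold flow_matrix; cbn [mode_matrix]. cbv zeta.
      match goal with |- ?a = ?b => change (@eq R a b) end. ring. }
  destruct (mode_value_spec gamma l p0 rho0 u0 (gamma0 gamma mb U) mb mb1 hgamma hl hp0 hrho0 hu0 hM0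
    mb_cont mb1_cont mb_pos sigma kk lam hlam) as (w & Hw & Hwe & E).
  assert (Hqw : forall x, 0 <= x <= l -> z 0%nat x = q 0 * w 0%nat x).
  { apply (mode_value_unique gamma l p0 rho0 u0 (gamma0 gamma mb U) mb mb1 hgamma hl hp0 hrho0 hu0 hM0
      mb_cont mb1_cont mb_pos sigma kk lam (q 0) z hlam); auto. }
  assert (Hq0 : q 0 = 0).
  { pose proof (Hqw l ltac:(lra)) as El. rewrite E in El. unfold z in El. rewrite clamp_id in El by lra.
    destruct Hq as (_ & _ & _ & Hql & _). rewrite Hql in El.
    destruct (Rmult_integral _ _ (eq_sym El)) as [H|H]; [exact H|contradiction]. }
  intros x Hx. specialize (Hqw x Hx). rewrite Hq0, Rmult_0_l in Hqw. unfold z in Hqw.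
  rewrite clamp_id in Hqw by exact Hx. exact Hqw.
Qed.

End Reduction.

(** * The exceptional set *)

Theorem lemma5p2
  (gamma kappa0 c_nu : R) (hgamma : 1 < gamma) (hkappa0 : 0 < kappa0) (hc_nu : 0 < c_nu)
  (l : R) (hl : 0 < l)
  (p0 rho0 u0 : R) (hp0 : 0 < p0) (hrho0 : 0 < rho0) (hu0 : 0 < u0)
  (hM0 : 0 < mach gamma p0 rho0 u0 < 1)
  (mb : R -> R) (hmb_smooth : smooth_on half_line mb)
  (hmb_pos : forall x, 0 <= x -> 0 < mb x) :
  exists S : R -> Prop, at_most_countable S /\
    forall lam : R, ~ S lam ->
      Rbar_lt (Finite l) (critical_length gamma kappa0 c_nu mb lam p0 rho0 u0) ->
      forall U : flow, is_background gamma kappa0 c_nu mb lam p0 rho0 u0 U ->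
        S_condition gamma kappa0 c_nu mb lam U l.
Proof.
  destruct hM0 as [_ HM1]. destruct hmb_smooth as (F & F0 & F1).
  assert (Hhl : forall x, 0 <= x <= l -> half_line x) by (intros x Hx; exact (proj1 Hx)).
  assert (Fm : forall x, half_line x -> D_in mb (F 1%nat) half_line x).
  { intros x Hx. apply (D_in_ext (F O)); [exact F0|exact Hx|apply F1, Hx]. }
  assert (Cm : cfun (fun x => mb (clamp l x))).
  { apply (D_in_cfun mb (F 1%nat) half_line); [lra|exact Hhl|intros; apply Fm, Hhl; assumption]. }
  assert (Cm1 : cfun (fun x => F 1%nat (clamp l x))).
  { apply (D_in_cfun (F 1%nat) (F 2%nat) half_line); [lra|exact Hhl|intros; apply F1, Hhl; assumption]. }
  assert (Dm : forall x, 0 < x < l -> is_derive mb x (F 1%nat x)).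
  { intros x Hx. apply (D_in_interior mb (F 1%nat) half_line x 0 l); [apply Fm, Hhl; lra|exact Hx|].
    intros t Ht; apply Hhl; lra. }
  assert (Pm : forall x, 0 <= x <= l -> 0 < mb x) by (intros x Hx; apply hmb_pos; lra).
  (* [gamma0] reads only pressure, density and velocity at 0, so a constant flow with the entrance
     data yields its value before any background solution is chosen; the entropy 0 is arbitrary. *)
  set (V0 := Flow (fun _ => p0) (fun _ => rho0) (fun _ => u0) (fun _ => 0)).
  set (sigma := fun k : nat => match k with O => PI | Datatypes.S _ => 0 end).
  (* One zero set per mode, restricted to the half-line on which the value at the outlet is
     analytic. *)
  exists (fun lam => exists k, lam < lam_max gamma l p0 rho0 u0 mb /\
    mode_value gamma l p0 rho0 u0 (gamma0 gamma mb V0) mb (F 1%nat) (sigma k) (INR k ^ 2) lam = 0).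
  split.
  - apply countable_union. intros k. apply mode_zeros_countable; try assumption. apply pow2_ge_0.
  - intros lam HS HL U HU Phi HPhi k q Hq.
    destruct (background_explicit gamma kappa0 c_nu l p0 rho0 u0 mb lam U _ hgamma hkappa0 hl HL hp0 hrho0 hu0
      HM1 Cm HU) as (Htau & HUeq).
    (* Existence beyond [l] keeps the flow subsonic at [l], which is exactly this bound on [lam]. *)
    assert (Hlam : lam < lam_max gamma l p0 rho0 u0 mb).
    { apply tau_end_lt; try assumption. apply Htau. lra. }
    destruct HU as ((E1 & E2 & E3) & (_ & (Fr & Fr0 & Fr1) & _) & HB).
    assert (Hico : forall x, 0 <= x <= l -> ico (critical_length gamma kappa0 c_nu mb lam p0 rho0 u0) x).
    { intros x Hx. split; [lra|]. apply Rbar_le_lt_trans with l; [simpl; lra|exact HL]. }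
    assert (Hent : forall x, 0 <= x <= l -> pres U x = A_of kappa0 c_nu (entr U x) * Rpower (dens U x) gamma)
      by (intros x Hx; apply HB, Hico, Hx).
    assert (Hpos : forall x, 0 <= x <= l -> 0 < pres U x /\ 0 < dens U x /\ 0 < vel U x).
    { intros x Hx. destruct (HB x (Hico x Hx)) as (Ea & Ha & Hb & _). split; [|split; assumption].
      rewrite Ea. apply Rmult_lt_0_compat; [|apply exp_pos].
      apply Rmult_lt_0_compat; [exact hkappa0|apply exp_pos]. }
    apply (mode_solution_trivial gamma kappa0 c_nu l p0 rho0 u0 lam mb (F 1%nat) U Phi k q); try assumption.
    + apply (D_in_cfun (dens U) (Fr 1%nat) (ico (critical_length gamma kappa0 c_nu mb lam p0 rho0 u0)));
        [lra|exact Hico|].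
      intros x Hx. apply (D_in_ext (Fr O)); [exact Fr0|apply Hico, Hx|apply Fr1, Hico, Hx].
    + replace (gamma0 gamma mb U) with (gamma0 gamma mb V0).
      * intros E. apply HS. exists k. split; [exact Hlam|exact E].
      * unfold gamma0, sound, Mach. simpl. rewrite E1, E2, E3. reflexivity.
Qed.
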